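(* Suppose $\mathscr H_{r,n}$ is semisimple and let $\boldsymbol\lambda\in\mathscr P_{r,n}$. Put $a=\sum_{i=1}^{o_{\boldsymbol\lambda}}|\boldsymbol\lambda^{[i]}|$ and $\rho_i=\mathrm{res}_{\mathfrak t^{\boldsymbol\lambda}}(i)$ for $1\le i\le a$. Define $h_{\boldsymbol\lambda}$ by $$h_{\boldsymbol\lambda}=\prod_{k=1}^{(p_{\boldsymbol\lambda}-1)/2}\prod_{i=1}^a\prod_{j=1}^a\frac{(q\rho_j-\varepsilon^{ko_{\boldsymbol\lambda}}\rho_i)(\rho_j-q\varepsilon^{ko_{\boldsymbol\lambda}}\rho_i)}{(\rho_j-\varepsilon^{ko_{\boldsymbol\lambda}}\rho_i)^2}$$ if $p_{\boldsymbol\lambda}$ is odd (so $h_{\boldsymbol\lambda}=1$ if $p_{\boldsymbol\lambda}=1$), and by $$h_{\boldsymbol\lambda}=\Biggl(\prod_{k=1}^{p_{\boldsymbol\lambda}/2-1}\prod_{i=1}^a\prod_{j=1}^a\frac{(q\rho_j-\varepsilon^{ko_{\boldsymbol\lambda}}\rho_i)(\rho_j-q\varepsilon^{ko_{\boldsymbol\lambda}}\rho_i)}{(\rho_j-\varepsilon^{ko_{\boldsymbol\lambda}}\rho_i)^2}\Biggr)\cdot\frac{(q+1)^a}{2^a}\cdot\prod_{1\le j<i\le a}\frac{(q\rho_j+\rho_i)(\rho_j+q\rho_i)}{(\rho_j+\rho_i)^2}$$ if $p_{\boldsymbol\lambda}$ is even. Then $h_{\boldsymbol\lambda}$ is a well-defined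 invertible element of $K$ and $$\frac{\gamma_{\mathfrak t^{\boldsymbol\lambda}\langle o_{\boldsymbol\lambda}\rangle}}{\gamma_{\mathfrak t^{\boldsymbol\lambda}}}=(h_{\boldsymbol\lambda})^2 .$$
   Context: Setting. $r,p,d\ge1$ and $n\ge2$ are integers with $r=pd$; $K$ is a field containing a primitive $p$-th root of unity $\varepsilon$; $q\in K^\times$, $q\ne1$; $Q_1,\dots,Q_d\in K^\times$. $\mathscr H_{r,n}$ is the unital associative $K$-algebra with generators $T_0,\dots,T_{n-1}$ and relations $(T_0^p-Q_1^p)\cdots(T_0^p-Q_d^p)=0$; $T_0T_1T_0T_1=T_1T_0T_1T_0$; $(T_i-q)(T_i+1)=0$ for $1\le i\le n-1$; $T_iT_j=T_jT_i$ for $0\le i<j-1<n-1$; $T_iT_{i+1}T_i=T_{i+1}T_iT_{i+1}$ for $1\le i<n-1$. Its cyclotomic parameters, in order, are $\mathsf Q_{c+(t-1)d}=\varepsilon^tQ_c$ ($1\le c\le d$, $1\le t\le p$). It is (split) semisimple iff $\prod_{i=1}^n(1+q+\cdots+q^{i-1})\prod_{-n<k<n}\bigl(\prod_{1\le i<j\le d}\prod_{0\le t<p}(Q_i-\varepsilon^tq^kQ_j)\bigr)\bigl(\prod_{1\le i\le d}\prod_{1\le t<p}Q_i(1-\varepsilon^tq^k)\bigr)\ne0$. Combinatorics. $\mathscr P_{r,n}$ is the set of $r$-multipartitions $\boldsymbol\lambda=(\lambda^{(1)},\dots,\lambda^{(r)})$ of $n$. $\mathrm{Std}(\boldsymbol\lambda)$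 is the set of standard $\boldsymbol\lambda$-tableaux $\mathfrak t=(\mathfrak t^{(1)},\dots,\mathfrak t^{(r)})$ (bijective fillings by $1,\dots,n$, increasing along rows and columns of each component). $\mathfrak S_n$ acts on tableaux from the right by permuting entries. $\mathfrak t^{\boldsymbol\lambda}$ is the tableau with $1,\dots,n$ entered in order along successive rows of $\lambda^{(1)}$, then $\lambda^{(2)}$, etc.; $d(\mathfrak t)\in\mathfrak S_n$ is defined by $\mathfrak t=\mathfrak t^{\boldsymbol\lambda}d(\mathfrak t)$. Put $\boldsymbol\lambda^{[t]}=(\lambda^{(dt-d+1)},\dots,\lambda^{(dt)})$, $\mathfrak t^{[t]}=(\mathfrak t^{(dt-d+1)},\dots,\mathfrak t^{(dt)})$ for $1\le t\le p$, with superscripts $[t]$ read modulo $p$. For $z\in\mathbb Z$: $\boldsymbol\lambda\langle z\rangle=(\boldsymbol\lambda^{[z+1]},\dots,\boldsymbol\lambda^{[z+p]})$ and $\mathfrak t\langle z\rangle=(\mathfrak t^{[z+1]},\dots,\mathfrak t^{[z+p]})\in\mathrm{Std}(\boldsymbol\lambda\langle z\rangle)$. $o_{\boldsymbol\lambda}=\min\{k\ge1:\boldsymbol\lambda^{[k+t]}=\boldsymbol\lambda^{[t]}\ \forall t\in\mathbb Z\}$ (it divides $p$), $p_{\boldsymbol\lambda}=p/o_{\boldsymbol\lambda}$. The residue is $\mathrm{res}_{\mathfrak t}(k)=\varepsilon^tq^{b-a}Q_c$ if $k$ lies in row $a$, column $b$ of $\mathfrak t^{(c+(t-1)d)}$,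 $1\le c\le d$, $1\le t\le p$. Seminormal basis. $L_1=T_0$, $L_{k+1}=q^{-1}T_kL_kT_k$; $*$ is the anti-automorphism fixing all $T_i$; $m_{\boldsymbol\lambda}=\bigl(\prod_{s=2}^r\prod_{k=1}^{|\lambda^{(1)}|+\cdots+|\lambda^{(s-1)}|}(L_k-\mathsf Q_s)\bigr)\sum_{w\in\mathfrak S_{\boldsymbol\lambda}}T_w$ with $\mathfrak S_{\boldsymbol\lambda}$ the row stabilizer of $\mathfrak t^{\boldsymbol\lambda}$; $R(k)=\{\mathrm{res}_{\mathfrak s}(k):\mathfrak s\in\mathrm{Std}(\boldsymbol\mu),\boldsymbol\mu\in\mathscr P_{r,n}\}$; $F_{\mathfrak t}=\prod_{k=1}^n\prod_{c\in R(k),c\ne\mathrm{res}_{\mathfrak t}(k)}\frac{L_k-c}{\mathrm{res}_{\mathfrak t}(k)-c}$; $f_{\mathfrak s\mathfrak t}=F_{\mathfrak s}T_{d(\mathfrak s)}^*m_{\boldsymbol\lambda}T_{d(\mathfrak t)}F_{\mathfrak t}$. In the semisimple case $\{f_{\mathfrak s\mathfrak t}\}$ is a $K$-basis of $\mathscr H_{r,n}$ and there are unique $\gamma_{\mathfrak t}\in K^\times$ with $f_{\mathfrak u\mathfrak v}f_{\mathfrak s\mathfrak t}=\delta_{\mathfrak v\mathfrak s}\gamma_{\mathfrak s}f_{\mathfrak u\mathfrak t}$. Equivalently: $\gamma_{\mathfrak t^{\boldsymbol\lambda}}=\prod_{c,i}[\lambda^{(c)}_i]_q^!\prod_{1\le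 b<c\le r}\prod_{(i,j)\in\lambda^{(b)}}(q^{j-i}\mathsf Q_b-\mathsf Q_c)$, where $[m]_q^!=\prod_{i=1}^m\frac{q^i-1}{q-1}$, and if $\mathfrak s$ and $\mathfrak t=\mathfrak s(i,i+1)$ are standard with $\ell(d(\mathfrak t))=\ell(d(\mathfrak s))+1$ then $\gamma_{\mathfrak t}=\frac{(qx-y)(x-qy)}{(x-y)^2}\gamma_{\mathfrak s}$ with $x=\mathrm{res}_{\mathfrak s}(i)$, $y=\mathrm{res}_{\mathfrak s}(i+1)$. *)

(* Defs.v *)
From HB Require Import structures.
From mathcomp Require Import all_boot all_order all_algebra all_fingroup.

Set Implicit Arguments.
Unset Strict Implicit.
Unset Printing Implicit Defensive.

Import Order.TTheory GRing.Theory Num.Theory.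
Local Open Scope ring_scope.

(* All 1-based indices of the mathematics are shifted to 0-based ones, except  *)
(* for the generators T_0, ..., T_(n-1).  In particular the component indexed  *)
(* by c + (t - 1)d (1 <= c <= d, 1 <= t <= p) is s : 'I_r with s %% d = c - 1  *)
(* and s %/ d = t - 1, so that eps^t becomes eps ^+ (s %/ d).+1.               *)

Definition hecke_relations (K : fieldType) (p d n : nat) (q : K)
    (Q : d.-tuple K) (A : algType K) (T : nat -> A) : Prop :=
  [/\ \prod_(c < d) (T 0%N ^+ p - (tnth Q c ^+ p)%:A) = 0,
      T 0%N * T 1%N * T 0%N * T 1%N = T 1%N * T 0%N * T 1%N * T 0%N,
      (forall i, (0 < i < n)%N -> (T i - q%:A) * (T i + 1) = 0),
      (forall i j, (i.+1 < j < n)%N -> T i * T j = T j * T i) &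
      (forall i, (0 < i)%N -> (i.+1 < n)%N ->
         T i * T i.+1 * T i = T i.+1 * T i * T i.+1)].

(* Only T 0, ..., T n.-1 are meaningful.  Test algebras are nonzero, as every  *)
(* algType is; the presented algebra is itself nonzero.                        *)
Definition is_hecke_algebra (K : fieldType) (p d n : nat) (q : K)
    (Q : d.-tuple K) (H : algType K) (T : nat -> H) : Prop :=
  hecke_relations p n q Q T /\
  forall (A : algType K) (U : nat -> A), hecke_relations p n q Q U ->
    exists phi : {lrmorphism H -> A},
      (forall i, (i < n)%N -> phi (T i) = U i) /\
      (forall psi : {lrmorphism H -> A},
         (forall i, (i < n)%N -> psi (T i) = U i) -> psi =1 phi).

Definition left_ideal (A : nzRingType) (I : A -> Prop) : Prop :=
  [/\ I 0, (forall x y, I x -> I y -> I (x + y)) &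
      (forall a x, I x -> I (a * x))].

Definition semisimple (A : nzRingType) : Prop :=
  forall I : A -> Prop, left_ideal I ->
  exists J : A -> Prop,
    [/\ left_ideal J, (forall x, I x -> J x -> x = 0) &
        (forall x, exists y z, [/\ I y, J z & x = y + z])].

Definition is_anti_automorphism_fixing (K : fieldType) (n : nat)
    (H : algType K) (T : nat -> H) (star : H -> H) : Prop :=
  [/\ linear star, bijective star,
      (forall x y, star (x * y) = star y * star x) &
      (forall i, (i < n)%N -> star (T i) = T i)].

(* la c i is the length of row i of component c.  A partition of at most n has *)
(* at most n nonzero rows, each of length at most n; zero rows are padding.    *)
Definition is_multipartition (r n : nat)
    (la : {ffun 'I_r -> {ffun 'I_n -> 'I_n.+1}}) : bool :=
  [forall c : 'I_r, forall i : 'I_n, forall j : 'I_n, (i <= j)%N ==> (la c j <= la c i)%N]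
  && (\sum_c \sum_i la c i == n)%N.

Record multipartition (r n : nat) := Multipartition {
  mp_rows :> {ffun 'I_r -> {ffun 'I_n -> 'I_n.+1}};
  mp_rowsP : is_multipartition mp_rows }.

HB.instance Definition _ r n := [isSub for @mp_rows r n].
HB.instance Definition _ r n := [Finite of multipartition r n by <:].

Definition mp_size (r n : nat) (la : multipartition r n) (c : 'I_r) : nat :=
  (\sum_i la c i)%N.

(* (component, row, column) *)
Definition node (r n : nat) := ('I_r * 'I_n * 'I_n)%type.

Definition diagram (r n : nat) (la : multipartition r n) : {set node r n} :=
  [set x : node r n | (x.2 < la x.1.1 x.1.2)%N].

(* A filling by pairwise distinct entries is encoded by the function sending   *)
(* an entry to the node that contains it.                                      *)
Definition tableau (r n : nat) := {ffun 'I_n -> node r n}.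

Definition std (r n : nat) (la : multipartition r n) (t : tableau r n) : bool :=
  [&& injectiveb t, [set t k | k : 'I_n] == diagram la,
      [forall k : 'I_n, forall l : 'I_n,
         ((t k).1 == (t l).1) && ((t k).2 < (t l).2)%N ==> (k < l)%N] &
      [forall k : 'I_n, forall l : 'I_n,
         [&& (t k).1.1 == (t l).1.1, (t k).2 == (t l).2
           & ((t k).1.2 < (t l).1.2)%N] ==> (k < l)%N]].

(* Right action: the entry k is replaced by w k. *)
Definition tab_act (r n : nat) (t : tableau r n) (w : 'S_n) : tableau r n :=
  [ffun k => t ((w^-1)%g k)].

Definition nodes (r n : nat) (la : multipartition r n) : seq (node r n) :=
  [seq (ci, j) | ci <- [seq (c, i) | c <- enum 'I_r, i <- enum 'I_n],
                 j <- take (la ci.1 ci.2) (enum 'I_n)].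

Lemma size_nodes (r n : nat) (la : multipartition r n) :
  size (nodes la) == n.
Proof.
case/andP: (mp_rowsP la) => _ /eqP sum_la; apply/eqP.
rewrite /nodes size_allpairs_dep sumnE big_map big_allpairs -[RHS]sum_la.
rewrite big_enum; apply: eq_bigr => c _; rewrite big_enum; apply: eq_bigr => i _.
by rewrite size_takel //= size_enum_ord -ltnS.
Qed.

Definition initial_tableau (r n : nat) (la : multipartition r n) : tableau r n :=
  [ffun k => tnth (Tuple (size_nodes la)) k].

Definition tab_perm (r n : nat) (la : multipartition r n) (t : tableau r n)
    : 'S_n :=
  odflt 1%g [pick w : 'S_n | tab_act (initial_tableau la) w == t].

Definition row_stab (r n : nat) (la : multipartition r n) : {set 'S_n} :=
  [set w : 'S_n | [forall k, (initial_tableau la (w k)).1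
                             == (initial_tableau la k).1]].

(* Shifts <z> move components by z blocks of d; blocks are read modulo p, i.e. *)
(* components modulo r = pd, so naturals z suffice.                            *)

Lemma add_comp_subproof (r m : nat) (c : 'I_r) : ((c + m) %% r < r)%N.
Proof. by rewrite ltn_pmod // (leq_ltn_trans _ (ltn_ord c)). Qed.

Definition add_comp (r m : nat) (c : 'I_r) : 'I_r :=
  Ordinal (add_comp_subproof m c).

Lemma add_comp_bij (r m : nat) : bijective (@add_comp r m).
Proof.
apply: injF_bij => c e /(congr1 val) /= /eqP; rewrite eqn_modDr => /eqP.
by rewrite !modn_small // => /val_inj.
Qed.

Definition shift_rows (d r n z : nat) (la : multipartition r n) :
    {ffun 'I_r -> {ffun 'I_n -> 'I_n.+1}} :=
  [ffun c => la (add_comp (z * d) c)].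

Lemma shift_rowsP (d r n z : nat) (la : multipartition r n) :
  is_multipartition (shift_rows d z la).
Proof.
case/andP: (mp_rowsP la) => /forallP mono /eqP sum_la; apply/andP; split.
  by apply/forallP => c; rewrite ffunE; apply: mono.
apply/eqP; rewrite -[RHS]sum_la [RHS](reindex (@add_comp r (z * d))) /=; last first.
  exact/onW_bij/add_comp_bij.
by apply: eq_bigr => c _; rewrite ffunE.
Qed.

Definition mp_shift (d r n z : nat) (la : multipartition r n) :
    multipartition r n :=
  Multipartition (shift_rowsP d z la).

(* Component c of the shifted tableau is component c + zd (mod r) of t, so the *)
(* node of an entry moves back by zd, i.e. forward by r - (zd mod r).          *)
Definition tab_shift (d r n z : nat) (t : tableau r n) : tableau r n :=
  [ffun k => (add_comp (r - (z * d) %% r) (t k).1.1, (t k).1.2, (t k).2)].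

Lemma tab_shift_comp (d r n z : nat) (t : tableau r n) (k : 'I_n) :
  add_comp (z * d) (tab_shift d z t k).1.1 = (t k).1.1.
Proof.
have r_gt0 : (0 < r)%N by exact: leq_ltn_trans (ltn_ord (t k).1.1).
apply: val_inj; rewrite ffunE /= modnDml -modnDmr -addnA subnK; last first.
  exact/ltnW/ltn_pmod.
by rewrite modnDr modn_small.
Qed.

Lemma mp_shift_period (d r n : nat) (la : multipartition r n) :
  exists k : nat, (0 < k)%N && (mp_shift d k la == la).
Proof.
case: r la => [|r] la; first by exists 1%N; apply/eqP/val_inj/ffunP; case.
exists r.+1; apply/eqP/val_inj/ffunP => c; rewrite ffunE; congr (mp_rows la _).
by apply: val_inj; rewrite /= addnC mulnC modnMDl modn_small.
Qed.

Definition o_lambda (d r n : nat) (la : multipartition r n) : nat :=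
  ex_minn (mp_shift_period d la).

Definition p_lambda (p d r n : nat) (la : multipartition r n) : nat :=
  (p %/ o_lambda d la)%N.

Definition cyc_param (K : fieldType) (d : nat) (eps : K) (Q : d.-tuple K)
    (s : nat) : K :=
  eps ^+ (s %/ d).+1 * Q`_(s %% d).

Definition res (K : fieldType) (d r n : nat) (eps q : K) (Q : d.-tuple K)
    (t : tableau r n) (k : 'I_n) : K :=
  q ^ ((t k).2%:Z - (t k).1.2%:Z) * cyc_param eps Q (t k).1.1.

(* R(k) is a set of values: distinct tableaux may share a residue. *)
Definition residues (K : fieldType) (d r n : nat) (eps q : K) (Q : d.-tuple K)
    (k : 'I_n) : seq K :=
  undup [seq res eps q Q t k
        | t <- enum [pred t : tableau r n
                    | [exists la : multipartition r n, std la t]]].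

(* L k is the Jucys-Murphy element L_(k+1). *)
Fixpoint JM (K : fieldType) (q : K) (H : algType K) (T : nat -> H) (k : nat)
    : H :=
  if k is j.+1 then q^-1 *: (T j.+1 * JM q T j * T j.+1) else T 0%N.

Definition perm_length (n : nat) (w : 'S_n) : nat :=
  #|[set x : 'I_n * 'I_n | (x.1 < x.2)%N && (w x.2 < w x.1)%N]|.

(* T_w is the product of the T_i along a reduced expression of w; by the braid *)
(* relations the choice is irrelevant.  For 0 < i, tperm (ord_pred i) i is the *)
(* simple reflection s_i, and products of permutations act from the right.     *)
Definition Tperm (K : fieldType) (n : nat) (H : algType K) (T : nat -> H)
    (w : 'S_n) : H :=
  if [pick u : (perm_length w).-tuple 'I_n
     | all (fun i : 'I_n => 0 < i)%N u
       && ((\prod_(i <- u) tperm (ord_pred i) i)%g == w)] is Some u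
  then \prod_(i <- u) T i else 0.

Definition m_elt (K : fieldType) (d r n : nat) (eps q : K) (Q : d.-tuple K)
    (H : algType K) (T : nat -> H) (la : multipartition r n) : H :=
  (\prod_(s < r) \prod_(0 <= k < (\sum_(c < r | c < s) mp_size la c)%N)
      (JM q T k - (cyc_param eps Q s)%:A))
  * \sum_(w in row_stab la) Tperm T w.

Definition F_elt (K : fieldType) (d r n : nat) (eps q : K) (Q : d.-tuple K)
    (H : algType K) (T : nat -> H) (t : tableau r n) : H :=
  \prod_(k < n)
    \prod_(c <- residues r eps q Q k | c != res eps q Q t k)
      ((res eps q Q t k - c)^-1 *: (JM q T k - c%:A)).

Definition f_elt (K : fieldType) (d r n : nat) (eps q : K) (Q : d.-tuple K)
    (H : algType K) (T : nat -> H) (star : H -> H) (la : multipartition r n)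
    (s t : tableau r n) : H :=
  F_elt eps q Q T s * star (Tperm T (tab_perm la s)) * m_elt eps q Q T la
    * Tperm T (tab_perm la t) * F_elt eps q Q T t.

Definition is_gamma (K : fieldType) (d r n : nat) (eps q : K) (Q : d.-tuple K)
    (H : algType K) (T : nat -> H) (star : H -> H) (gam : tableau r n -> K)
    : Prop :=
  (forall (la : multipartition r n) (t : tableau r n),
     std la t -> gam t != 0) /\
  (forall (la mu : multipartition r n) (u v s t : tableau r n),
     std la u -> std la v -> std mu s -> std mu t ->
     f_elt eps q Q T star la u v * f_elt eps q Q T star mu s t
     = if v == s then gam s *: f_elt eps q Q T star la u t else 0).

(* The number a = |la^[1]| + ... + |la^[o]|; note that a <= n, so that the     *)
(* indices i : 'I_n with i < a are exactly the a first entries.                *)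
Definition h_bound (d r n : nat) (la : multipartition r n) : nat :=
  (\sum_(c < r | c %/ d < o_lambda d la) mp_size la c)%N.

Definition h_elt (K : fieldType) (p d r n : nat) (eps q : K) (Q : d.-tuple K)
    (la : multipartition r n) : K :=
  let o := o_lambda d la in
  let pl := p_lambda p d la in
  let a := h_bound d la in
  let rho := res eps q Q (initial_tableau la) in
  let factor k := \prod_(i < n | (i < a)%N) \prod_(j < n | (j < a)%N)
    ((q * rho j - eps ^+ (k * o) * rho i)
     * (rho j - q * eps ^+ (k * o) * rho i)
     / (rho j - eps ^+ (k * o) * rho i) ^+ 2) in
  if odd pl then \prod_(1 <= k < ((pl - 1) %/ 2).+1) factor k
  else \prod_(1 <= k < pl %/ 2) factor k
       * ((q + 1) ^+ a / 2%:R ^+ a)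
       * \prod_(i < n | (i < a)%N) \prod_(j < n | (j < i)%N)
           ((q * rho j + rho i) * (rho j + q * rho i) / (rho j + rho i) ^+ 2).

Definition h_well_defined (K : fieldType) (p d r n : nat) (eps q : K)
    (Q : d.-tuple K) (la : multipartition r n) : Prop :=
  let o := o_lambda d la in
  let pl := p_lambda p d la in
  let a := h_bound d la in
  let rho := res eps q Q (initial_tableau la) in
  let factor_ok k := forall i j : 'I_n, (i < a)%N -> (j < a)%N ->
    (rho j - eps ^+ (k * o) * rho i) ^+ 2 != 0 in
  if odd pl then forall k, (1 <= k < ((pl - 1) %/ 2).+1)%N -> factor_ok k
  else [/\ (forall k, (1 <= k < pl %/ 2)%N -> factor_ok k),
           (2%:R ^+ a : K) != 0 &
           (forall i j : 'I_n, (i < a)%N -> (j < i)%N ->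
              (rho j + rho i) ^+ 2 != 0)].

(* Main.v *)
Require Import Defs.
From HB Require Import structures.
From mathcomp Require Import all_boot all_order all_algebra all_fingroup.
From mathcomp Require Import zify ring boolp.

(**
Only a quotient of two of the numbers gamma is needed, both for the same multipartition la, and such
a quotient can be read off a single matrix representation of the algebra.

The representation.  Let the algebra act on the functions on tableaux by Young's seminormal form:
if x and y are the residues of the entries i - 1 and i of a standard tableau t, then (T_i v)(t) is
(q - 1) y / (y - x) v(t) + (q x - y) / (x - y) v(t s_i), the second term being dropped when t s_i is
not standard, and T_0 multiplies v(t) by the residue of the first entry.  The relations hold as soon
as nodes of la with equal residues lie on a common diagonal of a common component
([ex_monomial_rep], [ex_seminormal_rep]).  Here L_k multiplies v(t) by the residue of k
([apply_JM]), so that F_t cuts out the coordinate t; and the rows of m_la at standard tableaux have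
a single nonzero entry mu, in position (t0, t0) with t0 the initial tableau ([m_elt_entry]).  Hence
gamma_t is mu times an entry of T_d(t) times an entry of its image under the anti-automorphism.
Along a reduced word of d(t) only one path leads from t0 to t ([path_reduced]); each entry is a
product of coefficients along it, and

  gamma_t / gamma_t0 = product over the inversions (i, j) of d(t) of
                       (q x - y) (x - q y) / (x - y)^2

with x and y the residues of i and j in t0 ([core_elt_entry], [gam_ratio]).

Semisimplicity.  A common left eigenvector of the T_i in some representation of a semisimple
algebra comes with a right eigenvector that pairs to 1 with it ([split_character]).  In the regular
representation of the Hecke algebra of the symmetric group the pairing is a multiple of the
Poincare polynomial at q, so that this polynomial does not vanish and q^k <> 1 for 0 < k <= n.  A
Jordan block of size 2 for T_0 has no such pairing, so that the Q_c^p are distinct.  Finally, if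
one cyclotomic parameter were q^k times another one with 0 < k < n, the seminormal representation of
a shape with two rows would contradict the lemma ([cyc_param_neq]).  Together these say that
residues separate the nodes of every multipartition of n ([all_separated]), and they make mu and all
the denominators nonzero.

The product.  Let o be the period of la, so that la consists of pl = p / o copies of one block of o
d components.  Passing from t0 to its shift moves the last block in front of the others, and the
inversions are the pairs made of an entry of an earlier block and one of the last block.  The
residues of the block m, counted from 0, are eps^(m o) times those of the first block, and the
factor above is invariant under scaling, so that the product over the inversions becomes Phi(1) ...
Phi(pl - 1), where Phi(k) is the k-th factor of h ([prod_swap_Phi]).  The same invariance gives
Phi(pl - k) = Phi(k).  For odd pl the product is therefore the square of its first half.  For even
pl there remains the middle factor Phi(pl / 2), in which eps^(k o) = -1; it is a product over pairs
(i, j) of a symmetric function of i and j whose diagonal values are the squares ((q + 1) / 2)^2,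
hence a square as well ([Phi_middle]).
*)

Set Implicit Arguments.
Unset Strict Implicit.
Unset Printing Implicit Defensive.

Import Order.TTheory GRing.Theory Num.Theory.
Local Open Scope ring_scope.

(** * Inversions and simple reflections *)

Lemma ord_eqE m (a b : 'I_m) : (a == b) = (a == b :> nat).
Proof. by []. Qed.

Section SimpleReflections.
Variable n : nat.
Implicit Types (w : 'S_n) (i j a b : 'I_n) (u v : seq 'I_n).

Definition srefl i : 'S_n := tperm (ord_pred i) i.

Lemma val_ord_pred i : (0 < i)%N -> ord_pred i = i.-1 :> nat.
Proof.
move=> i0; rewrite /=; have -> : ((i + n).-1 = n + i.-1)%N by lia.
by rewrite modnDl modn_small //; have := ltn_ord i; lia.
Qed.

Lemma srefl_lt i a b : (0 < i)%N ->
  (srefl i a < srefl i b)%N =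
  ~~ ((a == ord_pred i) && (b == i)) &&
  (((a == i) && (b == ord_pred i)) || (a < b)%N).
Proof.
move=> i0; have pi := val_ord_pred i0.
rewrite /srefl !ord_eqE; case: tpermP => [->|->|/eqP + /eqP +];
  case: tpermP => [->|->|/eqP + /eqP +]; rewrite ?ord_eqE ?pi; lia.
Qed.

Definition inverted w (x : 'I_n * 'I_n) := (x.1 < x.2)%N && (w x.2 < w x.1)%N.

Lemma invertedE w a b : inverted w (a, b) = (a < b)%N && (w b < w a)%N.
Proof. by []. Qed.

(** The reflection s_i reverses no pair but (i - 1, i); thus the inversions of s_i w are
    that pair and the images under s_i of the inversions of w. An arbitrary operation and
    weight serve both lengths and products of coefficients. *)
Lemma big_inverted_srefl (R : Type) (idx : R) (op : Monoid.com_law idx)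
    (g : 'I_n -> 'I_n -> R) i w : (0 < i)%N -> (w (ord_pred i) < w i)%N ->
  \big[op/idx]_(x | inverted (srefl i * w)%g x) g x.1 x.2
  = op (g (ord_pred i) i)
       (\big[op/idx]_(x | inverted w x) g (srefl i x.1) (srefl i x.2)).
Proof.
move=> i0 wi; have pi := val_ord_pred i0.
rewrite (bigD1 (ord_pred i, i)) /=; last first.
  rewrite invertedE pi; apply/andP; split; first by lia.
  by rewrite !permM tpermL tpermR.
congr (op _ _).
rewrite (reindex (fun x : 'I_n * 'I_n => (srefl i x.1, srefl i x.2))) /=; last first.
  exists (fun x => (srefl i x.1, srefl i x.2)) => -[a b] _ /=;
  by rewrite /srefl !tpermK.
apply: eq_bigl => -[a b]; rewrite !invertedE !permM /srefl !tpermK -!/(srefl i).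
rewrite srefl_lt //.
have -> : (srefl i a, srefl i b) == (ord_pred i, i) = (a == i) && (b == ord_pred i).
  rewrite xpair_eqE -(inj_eq (@perm_inj _ (srefl i)) (srefl i a)).
  rewrite -(inj_eq (@perm_inj _ (srefl i)) (srefl i b)).
  by rewrite !tpermK tpermL tpermR.
move: (ord_pred i) pi wi => p pi wi.
have [->|na] := eqVneq a p; have [->|nb] := eqVneq b i; rewrite /= ?andbF ?andbT.
- by rewrite [(w i < _)%N]ltnNge (ltnW wi) !andbF.
- by rewrite !ord_eqE; case: (w b < w p)%N; lia.
- by rewrite !ord_eqE; case: (w i < w a)%N; lia.
have [->|nai] := eqVneq a i; have [->|nbi] := eqVneq b p; rewrite /= ?andbF ?andbT //.
by apply/esym/negbTE; rewrite negb_and -leqNgt; apply/orP; left; lia.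
Qed.
End SimpleReflections.

(** * Reduced words *)

Section ReducedWords.
Variable n : nat.
Implicit Types (w : 'S_n) (i j a b : 'I_n) (u v : seq 'I_n).

Definition simple_word u := all (fun i : 'I_n => 0 < i)%N u.
Definition word_perm u : 'S_n := (\prod_(i <- u) srefl i)%g.
Definition reduced u := simple_word u && (perm_length (word_perm u) == size u).

Lemma word_perm_cons i u : word_perm (i :: u) = (srefl i * word_perm u)%g.
Proof. by rewrite /word_perm big_cons. Qed.

Lemma word_perm_nil : word_perm [::] = 1%g.
Proof. by rewrite /word_perm big_nil. Qed.

Lemma perm_length_inverted w :
  perm_length w = (\sum_(x : 'I_n * 'I_n | inverted w x) 1)%N.
Proof. by rewrite sum1_card /perm_length cardsE. Qed.

Lemma srefl_mulK i w : (srefl i * (srefl i * w) = w)%g.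
Proof. by rewrite mulgA tperm2 mul1g. Qed.

Lemma perm_length1 : perm_length (1%g : 'S_n) = 0%N.
Proof.
rewrite perm_length_inverted big1 // => -[a b] /=.
by rewrite invertedE !perm1; lia.
Qed.

Lemma reduced_nil : reduced [::].
Proof. by rewrite /reduced word_perm_nil perm_length1. Qed.

Lemma perm_length_up i w : (0 < i)%N -> (w (ord_pred i) < w i)%N ->
  perm_length (srefl i * w)%g = (perm_length w).+1.
Proof.
move=> i0 wi; rewrite !perm_length_inverted.
by rewrite (big_inverted_srefl _ (fun _ _ => 1%N) i0 wi).
Qed.

Lemma perm_length_down i w : (0 < i)%N -> (w i < w (ord_pred i))%N ->
  perm_length w = (perm_length (srefl i * w)%g).+1.
Proof.
move=> i0 wi; rewrite -(perm_length_up i0) ?srefl_mulK //.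
by rewrite !permM tpermL tpermR.
Qed.

Lemma descent_or_ascent i w : (0 < i)%N ->
  (w i < w (ord_pred i))%N || (w (ord_pred i) < w i)%N.
Proof.
move=> i0; have pi := val_ord_pred i0; case: ltngtP => // /val_inj /perm_inj e.
by move: pi; rewrite -e; lia.
Qed.

Lemma perm_length_srefl_le i w : (0 < i)%N ->
  (perm_length (srefl i * w)%g <= (perm_length w).+1)%N.
Proof.
move=> i0; case/orP: (descent_or_ascent w i0) => wi.
  by rewrite (perm_length_down i0 wi); lia.
by rewrite perm_length_up.
Qed.

Lemma perm_length_word u : simple_word u -> (perm_length (word_perm u) <= size u)%N.
Proof.
elim: u => [|i u IH] /=.
  by rewrite word_perm_nil perm_length1.
case/andP=> i0 /IH le_u; rewrite word_perm_cons.
exact: leq_trans (perm_length_srefl_le _ i0) _.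
Qed.

(** Ascending forces k <= w k for every k, and both sides have the same sum over k. *)
Lemma ascending_perm1 w :
  (forall i, (0 < i)%N -> (w (ord_pred i) < w i)%N) -> w = 1%g.
Proof.
move=> asc.
have le_w m (Hm : (m < n)%N) : (m <= w (Ordinal Hm))%N.
  elim: m Hm => [//|m IH] Hm; have Hm' : (m < n)%N by lia.
  have := asc (Ordinal Hm) isT; have -> : ord_pred (Ordinal Hm) = Ordinal Hm'.
    by apply: val_inj; rewrite [LHS]val_ord_pred.
  by have := IH Hm'; lia.
have sumE : (\sum_(k < n) k = \sum_(k < n) w k)%N.
  by rewrite [LHS](reindex_inj (@perm_inj _ w)).
have le_w' (k : 'I_n) : true -> (k <= w k ?= iff (k == w k :> nat))%N.
  by move=> _; split=> //; case: k => m Hm; apply: le_w.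
have := (leqif_sum le_w').2; rewrite sumE eqxx => /esym/forallP /= all_eq.
by apply/permP => k; rewrite perm1; apply/val_inj/esym/eqP/all_eq.
Qed.

Lemma reduced_cons i u : (0 < i)%N -> reduced u ->
  (word_perm u (ord_pred i) < word_perm u i)%N -> reduced (i :: u).
Proof.
move=> i0 /andP[su /eqP lu] wi; rewrite /reduced /= i0 su /=.
by rewrite word_perm_cons perm_length_up // lu.
Qed.

Lemma reduced_behead i u : reduced (i :: u) ->
  [/\ (0 < i)%N, reduced u &
      (word_perm u (ord_pred i) < word_perm u i)%N].
Proof.
case/andP=> /= /andP[i0 su]; rewrite word_perm_cons => /eqP lu.
case/orP: (descent_or_ascent (word_perm u) i0) => wi.
  have := perm_length_word su; have := perm_length_down i0 wi.
  by lia.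
split=> //; rewrite /reduced su /=; move: lu; rewrite perm_length_up //.
by move=> [<-].
Qed.

(** Induction on the length: a permutation without descent is the identity, and a descent
    can be removed by a reflection. *)
Lemma ex_reduced w : exists2 u, reduced u & word_perm u = w.
Proof.
move: {2}(perm_length w) (leqnn (perm_length w)) => m; elim: m w => [|m IH] w le_m.
  exists [::]; rewrite ?word_perm_nil ?reduced_nil //.
  apply/esym/ascending_perm1 => i i0.
  case/orP: (descent_or_ascent w i0) => // /(perm_length_down i0); lia.
have [i /andP[i0 wi]|asc] := pickP (fun i => (0 < i)%N && (w i < w (ord_pred i))%N).
  have [|u ru wu] := IH (srefl i * w)%g.
    by have := perm_length_down i0 wi; lia.
  exists (i :: u); last by rewrite word_perm_cons wu srefl_mulK.
  by apply: reduced_cons => //; rewrite wu !permM tpermL tpermR.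
exists [::]; rewrite ?word_perm_nil ?reduced_nil //.
apply/esym/ascending_perm1 => i i0.
by case/orP: (descent_or_ascent w i0) => // wi; have := asc i; rewrite i0 wi.
Qed.

Lemma ord_pred_next i j : j = i.+1 :> nat -> ord_pred j = i.
Proof. by move=> ji; apply: val_inj; rewrite [LHS]val_ord_pred ji. Qed.

Lemma srefl_id i a : (0 < i)%N -> a != i -> a != i.-1 :> nat -> srefl i a = a.
Proof.
move=> i0 ai api; rewrite /srefl tpermD // 1?eq_sym //.
by apply: contraNneq api => ->; rewrite val_ord_pred.
Qed.

Lemma srefl_comm i j : (0 < i)%N -> (i.+1 < j)%N ->
  (srefl i * srefl j = srefl j * srefl i)%g.
Proof.
move=> i0 lt_ij; have pi := val_ord_pred i0.
have pj : ord_pred j = j.-1 :> nat by apply: val_ord_pred; lia.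
apply/commgP/conjg_fixP; rewrite /srefl tpermJ.
by rewrite !tpermD // ord_eqE ?pi ?pj; lia.
Qed.

Lemma srefl_braid i j : (0 < i)%N -> j = i.+1 :> nat ->
  (srefl i * srefl j * srefl i = srefl j * srefl i * srefl j)%g.
Proof.
move=> i0 eji; have pi := val_ord_pred i0; have pji := ord_pred_next eji.
have conjE a b : (srefl a * srefl b * srefl a = srefl b ^ srefl a)%g.
  by rewrite conjgE /srefl tpermV !mulgA.
rewrite !conjE /srefl pji !tpermJ !tpermL !tpermR.
rewrite [tperm (ord_pred i) i j]tpermD ?[tperm i j (ord_pred i)]tpermD //;
  by rewrite ord_eqE ?pi; lia.
Qed.

Section Matsumoto.
Variables (M : pzRingType) (f : 'I_n -> M).
Hypothesis f_comm : forall i j, (0 < i)%N -> (i.+1 < j)%N -> f i * f j = f j * f i.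
Hypothesis f_braid : forall i j, (0 < i)%N -> j = i.+1 :> nat ->
  f i * f j * f i = f j * f i * f j.

Definition word_prod u := \prod_(i <- u) f i.

(** Induction on the length. If two reduced words for w begin with different letters i and
    j, both are descents of w, so that w has a reduced word beginning with the longest word
    in i and j, in either of its two forms. The induction hypothesis links the given words
    to these two, which one braid or commutation relation makes equal. *)
Lemma matsumoto u v : reduced u -> reduced v -> word_perm u = word_perm v ->
  word_prod u = word_prod v.
Proof.
move: {2}(size u) (leqnn (size u)) => m; elim: m u v => [|m IH].
  by case=> // -[|i v] // _ _ /andP[_ /eqP] + e; rewrite -e word_perm_nil perm_length1.
move=> [|i u] [|j v] //= le_m ru rv uv.
- by case/andP: rv => _; rewrite -uv word_perm_nil perm_length1.
- by case/andP: ru => _; rewrite uv word_perm_nil perm_length1.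
rewrite /word_prod !big_cons -!/(word_prod _).
have [es] : size (i :: u) = size (j :: v).
  by case/andP: ru => _ /eqP <-; case/andP: rv => _ /eqP <-; rewrite uv.
wlog lt_ij : i j u v le_m ru rv uv es / (i <= j)%N.
  move=> WL; have [le_ij|/ltnW le_ji] := leqP i j; first exact: WL.
  by apply/esym/WL; rewrite ?uv -?es.
have [i0 ru' ui] := reduced_behead ru; have [j0 rv' vj] := reduced_behead rv.
have le_v : (size v <= m)%N by rewrite -es.
move: lt_ij; rewrite leq_eqVlt => /orP[/eqP/val_inj eij|lt_ij].
  rewrite -eij in rv uv *; congr (_ * _); apply: IH => //.
  by move: uv; rewrite !word_perm_cons => /mulgI.
set w := word_perm (i :: u) in uv.
have wu : word_perm u = (srefl i * w)%g by rewrite /w word_perm_cons srefl_mulK.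
have wv : word_perm v = (srefl j * w)%g by rewrite uv word_perm_cons srefl_mulK.
have wi : (w i < w (ord_pred i))%N.
  by move: ui; rewrite wu !permM tpermL tpermR.
have wj : (w j < w (ord_pred j))%N.
  by move: vj; rewrite wv !permM tpermL tpermR.
have pi := val_ord_pred i0; have pj := val_ord_pred j0.
have [eji|nji] := eqVneq (j : nat) i.+1.
  have pji := ord_pred_next eji; rewrite pji in wj pj.
  have [z rz wz] := ex_reduced (srefl i * (srefl j * (srefl i * w)))%g.
  have ij : srefl i j = j by apply: srefl_id; rewrite // ?ord_eqE; lia.
  have jp : srefl j (ord_pred i) = ord_pred i.
    by apply: srefl_id; rewrite // ?ord_eqE pi; lia.
  have jj : srefl j j = i by rewrite /srefl pji tpermR.
  have ji : srefl j i = j by rewrite /srefl pji tpermL.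
  have ii : srefl i i = ord_pred i by rewrite /srefl tpermR.
  have ip : srefl i (ord_pred i) = i by rewrite /srefl tpermL.
  have r1 : reduced (i :: z).
    by apply: reduced_cons; rewrite // wz !permM ip ii ji jp ij ip.
  have r1j : reduced (j :: i :: z).
    apply: reduced_cons; rewrite // word_perm_cons wz pji srefl_mulK !permM.
    by rewrite ji ij jj ii; lia.
  have r2 : reduced (j :: z).
    apply: reduced_cons; rewrite // wz pji !permM ij ii jp ip jj ii.
    done.
  have r2i : reduced (i :: j :: z).
    apply: reduced_cons; rewrite // word_perm_cons wz !permM.
    rewrite ?(ip, ii, ji, jp, ij, jj) ?(ip, ii, ji, jp, ij, jj).
    by rewrite ?ji ?jp ?ij ?ip; lia.
  have e1 : word_perm (j :: i :: z) = word_perm u.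
    by rewrite !word_perm_cons wz srefl_mulK srefl_mulK wu.
  have e2 : word_perm (i :: j :: z) = word_perm v.
    rewrite !word_perm_cons wz wv !mulgA srefl_braid //.
    by rewrite -!mulgA !srefl_mulK.
  rewrite (IH u (j :: i :: z)) ?e1 // (IH v (i :: j :: z)) ?e2 //.
  by rewrite /word_prod !big_cons !mulrA f_braid.
have lt_ij' : (i.+1 < j)%N by rewrite ltn_neqAle eq_sym nji.
have [z rz wz] := ex_reduced (srefl j * (srefl i * w))%g.
have wz' : word_perm z = (srefl i * (srefl j * w))%g.
  by rewrite wz !mulgA (srefl_comm i0 lt_ij').
have ij : srefl i j = j by apply: srefl_id; rewrite // ?ord_eqE; lia.
have ipj : srefl i (ord_pred j) = ord_pred j.
  by apply: srefl_id; rewrite // ?ord_eqE pj; lia.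
have ji : srefl j i = i by apply: srefl_id; rewrite // ?ord_eqE; lia.
have jpi : srefl j (ord_pred i) = ord_pred i.
  by apply: srefl_id; rewrite // ?ord_eqE pi; lia.
have r1 : reduced (j :: z).
  by apply: reduced_cons; rewrite // wz !permM tpermL tpermR ij ipj.
have r2 : reduced (i :: z).
  by apply: reduced_cons; rewrite // wz' !permM tpermL tpermR ji jpi.
rewrite (IH u (j :: z)) // ?(IH v (i :: z)) //.
- by rewrite /word_prod !big_cons !mulrA f_comm.
- by rewrite word_perm_cons wz' srefl_mulK.
- by rewrite word_perm_cons wz srefl_mulK.
Qed.
End Matsumoto.
End ReducedWords.

(** * Young subgroups and Poincare polynomials *)

Section YoungSubgroups.
Variables (n : nat) (L : eqType) (b : 'I_n -> L).
Implicit Types (w u : 'S_n) (i x y z : 'I_n).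

Definition young : {set 'S_n} := [set w : 'S_n | [forall k, b (w k) == b k]].

(** The condition under which the permutations that preserve the levels are generated by the
    simple reflections among them. *)
Definition convex_levels := forall x y z, (x <= y <= z)%N -> b x = b z -> b y = b x.

Lemma youngP w : reflect (forall k, b (w k) = b k) (w \in young).
Proof. by rewrite inE; apply: (iffP forallP) => H k; apply/eqP/H. Qed.

Lemma young1 : 1%g \in young.
Proof. by apply/youngP => k; rewrite perm1. Qed.

Lemma youngM u w : u \in young -> w \in young -> (u * w)%g \in young.
Proof. by move=> /youngP Hu /youngP Hw; apply/youngP => k; rewrite permM Hw Hu. Qed.

Lemma youngV w : w \in young -> (w^-1)%g \in young.
Proof. by move=> /youngP Hw; apply/youngP => k; rewrite -Hw permKV. Qed.

Lemma young_srefl i : b (ord_pred i) = b i -> srefl i \in young.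
Proof. by move=> bi; apply/youngP => k; rewrite /srefl; case: tpermP => [->|->|]. Qed.

Hypothesis bconv : convex_levels.

Lemma young_lt w x y : w \in young -> b x != b y -> (x < y)%N -> (w x < w y)%N.
Proof.
move=> /youngP Hw bxy lt_xy; rewrite ltnNge; apply: contra bxy => le_w.
have [le_y|lt_y] := leqP y (w x).
  by rewrite (@bconv x y (w x)) ?Hw // (ltnW lt_xy).
by rewrite -(Hw x) (@bconv (w y) (w x) y) ?Hw // le_w ltnW.
Qed.

(** A permutation that preserves the levels inverts no pair of points on different levels,
    so that the first letter of a reduced word joins two points of one level. *)
Lemma reduced_young (u : seq 'I_n) : reduced u -> word_perm u \in young ->
  all (fun i => b (ord_pred i) == b i) u.
Proof.
elim: u => //= i u IH /reduced_behead[i0 ru ui]; rewrite word_perm_cons => wY.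
have bi : b (ord_pred i) = b i.
  apply/eqP; apply: contraTT ui => nb; rewrite -leqNgt ltnW //.
  have := young_lt wY nb; rewrite !permM tpermL tpermR; apply.
  by rewrite val_ord_pred // prednK.
rewrite bi eqxx IH // -(srefl_mulK i (word_perm u)) youngM //.
exact: young_srefl.
Qed.

Section Poincare.
Variables (R : comNzRingType) (q : R).

Definition poincare (A : {set 'S_n}) : R := \sum_(w in A) q ^+ perm_length w.

(** On a pair of points of one level w keeps the order chosen by u; on the other pairs u
    keeps the order, and the inversions of w are counted at the images by u. *)
Lemma perm_length_young_mul u w : u \in young ->
  (forall x y, (x < y)%N -> b x = b y -> (w x < w y)%N) ->
  perm_length (u * w)%g = (perm_length u + perm_length w)%N.
Proof.
move=> uY wasc; rewrite !perm_length_inverted.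
rewrite (bigID (fun c => b c.1 == b c.2)) /=; congr (_ + _)%N.
  rewrite [RHS](bigID (fun c => b c.1 == b c.2)) /= [X in (_ + X)%N]big1 ?addn0.
    apply: eq_bigl => -[x y]; rewrite !invertedE /= !permM; have [exy|nxy] := eqVneq.
      rewrite !andbT; case: (ltngtP (u x) (u y)) => [lt|lt|/val_inj ->].
      - have lt_w : (w (u x) < w (u y))%N by apply: wasc; rewrite ?(youngP _ uY).
        by rewrite [(w (u y) < _)%N]ltnNge (ltnW lt_w).
      - have -> // : (w (u y) < w (u x))%N by apply: wasc; rewrite ?(youngP _ uY).
      by rewrite ltnn.
    by rewrite !andbF.
  case=> x y; rewrite invertedE /= => /andP[/andP[lt_xy lt_u] nxy].
  by have := young_lt uY nxy lt_xy; lia.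
rewrite [RHS](bigID (fun c => b c.1 == b c.2)) /= [X in (X + _)%N]big1 ?add0n.
  rewrite [RHS](reindex (fun c => (u c.1, u c.2))) /=; last first.
    exists (fun c => ((u^-1)%g c.1, (u^-1)%g c.2)) => -[x y] _ /=;
    by rewrite ?permK ?permKV.
  apply: eq_bigl => -[x y]; rewrite !invertedE /= !permM !(youngP _ uY).
  have [exy|nxy] := eqVneq; rewrite ?andbF ?andbT //; congr (_ && _).
  case: (ltngtP x y) => [lt|lt|/val_inj exy]; last by rewrite exy eqxx in nxy.
    by rewrite young_lt.
  by apply/esym/negbTE; rewrite -leqNgt ltnW // young_lt // eq_sym.
case=> x y; rewrite invertedE /= => /andP[/andP[lt_xy lt_w] /eqP exy].
by have := wasc _ _ lt_xy exy; lia.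
Qed.

(** Such a set is a disjoint union of cosets of the subgroup. In each of them a shortest
    element w is ascending on every level, and by [perm_length_young_mul] the coset
    contributes the Poincare polynomial of the subgroup times q to the length of w. *)
Lemma poincare_young_dvd (A : {set 'S_n}) :
  (forall u w, u \in young -> w \in A -> (u * w)%g \in A) ->
  exists c, poincare A = poincare young * c.
Proof.
move: {2}#|A| (leqnn #|A|) => m; elim: m A => [|m IH] A le_m Ast.
  exists 0; rewrite mulr0 /poincare big_pred0 // => w.
  by apply/negbTE; move: le_m; rewrite leqn0 cards_eq0 => /eqP->; rewrite inE.
have [->|[w0 w0A]] := set_0Vmem A.
  by exists 0; rewrite mulr0 /poincare big_set0.
case: (arg_minnP (@perm_length n) w0A) => w wA wmin.
have wasc x y : (x < y)%N -> b x = b y -> (w x < w y)%N.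
  case: y => y Hy /= lt_xy bxy.
  elim: y Hy lt_xy bxy => // y IHy Hy; rewrite ltnS leq_eqVlt => lt_xy bxy.
  have Hy' : (y < n)%N by lia.
  have pE : ord_pred (Ordinal Hy) = Ordinal Hy' by apply: ord_pred_next.
  have byy : b (ord_pred (Ordinal Hy)) = b (Ordinal Hy).
    rewrite pE -bxy; apply: bconv bxy => /=; lia.
  have stepw : (w (Ordinal Hy') < w (Ordinal Hy))%N.
    rewrite -pE; have [] // := orP (@descent_or_ascent _ (Ordinal Hy) w isT) => desc.
    have := wmin _ (Ast _ _ (young_srefl byy) wA).
    by have := perm_length_down (i := Ordinal Hy) isT desc; lia.
  case/orP: lt_xy => [/eqP exy|lt_xy].
    by have -> : x = Ordinal Hy' by apply: val_inj.
  apply: leq_trans (ltnW stepw); apply: IHy => //.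
  by rewrite bxy -byy pE.
pose C := [set (u * w)%g | u in young].
have CA : C \subset A by apply/subsetP => _ /imsetP[u uY ->]; apply: Ast.
have wC : w \in C by apply/imsetP; exists 1%g; rewrite ?young1 ?mul1g.
have [||c cE] := IH (A :\: C).
- rewrite -ltnS; apply: leq_trans le_m; apply/proper_card/properP.
  by split; [exact: subsetDl|exists w; rewrite // inE wC].
- move=> u x uY /setDP[xA xC]; rewrite inE Ast // andbT.
  apply: contra xC => /imsetP[v vY uxE]; apply/imsetP; exists (u^-1 * v)%g.
    by rewrite youngM ?youngV.
  by rewrite -mulgA -uxE mulKg.
exists (q ^+ perm_length w + c).
rewrite mulrDr -cE /poincare (big_setID C) /= (setIidPr CA); congr (_ + _).
rewrite /C big_imset /=; last by move=> ? ? _ _ /mulIg.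
rewrite mulr_suml; apply: eq_bigr => u uY.
by rewrite perm_length_young_mul // exprD.
Qed.
End Poincare.
End YoungSubgroups.

Section PoincareFull.
Variables (n : nat) (K : fieldType) (q : K).
Hypothesis q1 : q != 1.
Hypothesis Pn : poincare q [set: 'S_n] != 0.

Lemma poincare_young_neq0 (L : eqType) (b : 'I_n -> L) : convex_levels b ->
  poincare q (young b) != 0.
Proof.
move=> bc; have [//|c cE] := @poincare_young_dvd n L b bc K q setT.
  by move=> *; rewrite inE.
by apply: contraNneq Pn => P0; rewrite cE P0 mul0r.
Qed.

(** The Poincare polynomial of the permutations of k points is a multiple of 1 + q + ... +
    q^(k - 1), as one sees by sorting them according to the place of the largest value; and
    it divides the one of n points. *)
Lemma expr_neq1_of_poincare k : (0 < k <= n)%N -> q ^+ k != 1.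
Proof.
(* The only nontrivial level of b is {0, ..., k - 1}. *)
case/andP=> k0 kn; pose b (x : 'I_n) := if (x < k)%N then 0%N else x.+1.
have bc : convex_levels b.
  suff H (x y z : nat) : (x <= y <= z)%N ->
    (if x < k then 0 else x.+1)%N = (if z < k then 0 else z.+1)%N ->
    (if y < k then 0 else y.+1)%N = (if x < k then 0 else x.+1)%N by move=> x y z; apply: H.
  by case: (ltnP x k); case: (ltnP y k); case: (ltnP z k); lia.
have := poincare_young_neq0 bc; apply: contraNneq => qk1.
have low (w : 'S_n) (x : 'I_n) : w \in young b -> (x < k)%N -> (w x < k)%N.
  by move=> /youngP /(_ x); rewrite /b => + ltx; rewrite ltx; case: ltnP.
have Hk1 : (k.-1 < n)%N by lia.
pose top := Ordinal Hk1.
pose B j := [set w in young b | w j == top :> 'I_n].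
have inB j (w : 'S_n) : (w \in B j) = (w \in young b) && (w j == top).
  by rewrite in_set.
have stepB (x y : 'I_n) : y = x.+1 :> nat -> (y < k)%N ->
    poincare q (B x) = q * poincare q (B y).
  move=> yx yk; have py := ord_pred_next yx.
  have by_ : b (ord_pred y) = b y by rewrite py /b yk; case: ltnP => //; lia.
  have sY := young_srefl by_.
  have inBs w : ((srefl y * w)%g \in B x) = (w \in B y).
    rewrite !inB permM {2}/srefl -{1}py tpermL.
    congr andb; apply/idP/idP => H; last exact: youngM.
    by rewrite -(srefl_mulK y w); apply: youngM.
  rewrite /poincare mulr_sumr (reindex_inj (mulgI (srefl y))) (eq_bigl _ _ inBs).
  apply: eq_bigr => w; rewrite inB => /andP[wY /eqP wy].
  rewrite perm_length_up ?exprS //; first by rewrite yx.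
  rewrite wy py /=; have := low w x wY; have : w x != w y.
    by rewrite (inj_eq perm_inj); apply/eqP => e; move: yx; rewrite e; lia.
  by rewrite wy -(inj_eq val_inj) /=; lia.
have BE j (Hj : (j < n)%N) : (j < k)%N ->
    poincare q (B (Ordinal Hj)) = q ^+ (k.-1 - j) * poincare q (B top).
  move=> jk; have [m mE] : exists m, m = (k.-1 - j)%N by eexists.
  rewrite -mE; elim: m j Hj jk mE => [|m IH] j Hj jk mE.
    rewrite mul1r; congr (poincare q (B _)); apply: val_inj => /=; lia.
  have Hj1 : (j.+1 < n)%N by lia.
  rewrite (stepB _ (Ordinal Hj1)) //= 1?(IH j.+1); try lia.
  by rewrite exprS mulrA.
have -> : poincare q (young b) = \sum_(x < n | (x < k)%N) poincare q (B x).
  rewrite /poincare (partition_big (fun w : 'S_n => (w^-1)%g top)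
                                   (fun x : 'I_n => (x < k)%N)) /=.
    apply: eq_bigr => x _; apply: eq_bigl => w; rewrite inB; congr andb.
    by apply/eqP/eqP => [<-|<-]; rewrite ?permK ?permKV.
  by move=> w wY; apply: (low _ _ (youngV wY)) => /=; lia.
rewrite (eq_bigr (fun x : 'I_n => q ^+ (k.-1 - x) * poincare q (B top))); last first.
  by case=> j Hj /= jk; rewrite BE.
rewrite -mulr_suml -(big_ord_widen n (fun j => q ^+ (k.-1 - j)) kn).
suff -> : \sum_(j < k) q ^+ (k.-1 - j) = 0 by rewrite mul0r.
rewrite (reindex_inj rev_ord_inj) /=.
rewrite (eq_bigr (fun j : 'I_k => q ^+ j)) => [|j _]; last first.
  by congr (_ ^+ _); have := ltn_ord j; lia.
have := subrX1 q k; rewrite qk1 subrr => /esym/eqP.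
by rewrite mulf_eq0 subr_eq0 (negbTE q1) => /eqP.
Qed.
End PoincareFull.

(** * Generators of the algebra *)

Section Generation.
Variables (K : fieldType) (p d n : nat) (q : K) (Q : d.-tuple K).
Variables (H : algType K) (T : nat -> H).
Hypothesis n_gt1 : (1 < n)%N.
Hypothesis hH : is_hecke_algebra p n q Q T.

Section Subalgebra.
Variable P : H -> Prop.
Hypothesis P1 : P 1.
Hypothesis PL : forall c x y, P x -> P y -> P (c *: x + y).
Hypothesis PM : forall x y, P x -> P y -> P (x * y).
Hypothesis PT : forall i, (i < n)%N -> P (T i).

Definition in_subalgebra : {pred H} := fun h => `[< P h >].

Lemma in_subalgebra_closed : GRing.subalg_closed in_subalgebra.
Proof.
split; first exact/asboolP.
- by move=> c x y /asboolP Px /asboolP Py; apply/asboolP/PL.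
- by move=> x y /asboolP Px /asboolP Py; apply/asboolP/PM.
Qed.

HB.instance Definition _ := GRing.isSubalgClosed.Build K H in_subalgebra
  (GRing.subalg_closed_semi in_subalgebra_closed).

(** A subalgebra becomes a type, so that the universal property of H applies to it. *)
Record subalgebra := Subalgebra
  { subalgebra_val :> H; subalgebra_valP : subalgebra_val \in in_subalgebra }.
HB.instance Definition _ := [isSub for subalgebra_val].
HB.instance Definition _ := [Choice of subalgebra by <:].
HB.instance Definition _ := [SubChoice_isSubAlgebra of subalgebra by <:].

Definition subalgebra_incl (x : subalgebra) : H := \val x.

Lemma subalgebra_incl_linear : linear subalgebra_incl.
Proof. by move=> c x y; rewrite /subalgebra_incl linearP. Qed.

Lemma subalgebra_incl_monoid : monoid_morphism subalgebra_incl.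
Proof. by split=> [|x y]; rewrite /subalgebra_incl ?rmorph1 ?rmorphM. Qed.

HB.instance Definition _ :=
  GRing.isLinear.Build K subalgebra H *:%R subalgebra_incl subalgebra_incl_linear.
HB.instance Definition _ :=
  GRing.isMonoidMorphism.Build subalgebra H subalgebra_incl subalgebra_incl_monoid.

Definition subalgebra_gen (i : nat) : subalgebra :=
  if insub (T i) is Some x then x else 0.

Lemma subalgebra_genE i : (i < n)%N -> \val (subalgebra_gen i) = T i.
Proof.
move=> lt_in; rewrite /subalgebra_gen; case: insubP => [//|].
by case/negP; apply/asboolP/PT.
Qed.

(** Uniqueness in the universal property forces generation: a subalgebra that contains the
    T_i receives a morphism from H, whose composite with the inclusion fixes the T_i and is
    the identity. *)
Lemma generated_by h : P h.
Proof.
have gen : hecke_relations p n q Q subalgebra_gen.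
  have n0 : (0 < n)%N by exact: ltnW.
  case: hH => -[r0 r01 rq rc rb] _; split.
  - apply: val_inj; rewrite rmorph_prod rmorph0 -r0; apply: eq_bigr => c _.
    by rewrite rmorphB rmorphXn /= subalgebra_genE.
  - by apply: val_inj; rewrite !rmorphM /= !subalgebra_genE.
  - move=> i Hi; apply: val_inj; rewrite rmorphM rmorphB rmorphD rmorph0 rmorph1 /=.
    by rewrite subalgebra_genE ?rq //; case/andP: Hi.
  - move=> i j Hij; have [Hi Hj] : (i < n)%N /\ (j < n)%N by lia.
    apply: val_inj; rewrite !rmorphM /= (subalgebra_genE Hi) (subalgebra_genE Hj).
    exact: rc.
  - move=> i i0 Hi1; have Hi : (i < n)%N by exact: ltnW.
    apply: val_inj; rewrite !rmorphM /= (subalgebra_genE Hi) (subalgebra_genE Hi1).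
    exact: rb.
have [phi [phiT _]] := hH.2 _ _ gen.
have [psi [psiT uniq_psi]] := hH.2 _ _ hH.1.
pose f1 : {lrmorphism H -> H} := GRing.LRMorphism.clone _ _ _ _ (subalgebra_incl \o phi) _.
pose f2 : {lrmorphism H -> H} := GRing.LRMorphism.clone _ _ _ _ (idfun : H -> H) _.
have e1 : f1 h = psi h.
  by apply: uniq_psi => i lt_in /=; rewrite phiT //; apply: subalgebra_genE.
have e2 : f2 h = psi h by apply: uniq_psi.
have := subalgebra_valP (phi h).
suff -> : subalgebra_val (phi h) = h by move/asboolP.
by rewrite -[LHS]/(f1 h) e1 -e2.
Qed.
End Subalgebra.
End Generation.

(** * Matrix representations and the splitting of characters *)

Section MatrixReps.
Variables (K : fieldType) (X : finType).

(** Matrices are functions of two indices in an arbitrary finite type, and act on functions. *)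
Definition apply (f : X -> X -> K) (v : X -> K) x := \sum_y f x y * v y.

Definition matrix_rep (H : algType K) (E : H -> X -> X -> K) :=
  [/\ forall x y, E 1 x y = (x == y)%:R,
      forall g h x y, E (g * h) x y = \sum_z E g x z * E h z y &
      forall c g h x y, E (c *: g + h) x y = c * E g x y + E h x y].

Section Coordinates.
Variable x0 : X.
(* Square matrices have an algebra structure in size N.+1 only; X contains x0. *)
Let N := #|X|.-1.

Definition ord_point (a : 'I_N.+1) : X := nth x0 (enum X) a.
Definition point_ord (x : X) : 'I_N.+1 := inord (enum_rank x).

Lemma card_point : N.+1 = #|X|.
Proof. by rewrite /N prednK //; apply/card_gt0P; exists x0. Qed.

Lemma point_ordK : cancel point_ord ord_point.
Proof.
move=> x; rewrite /ord_point /point_ord inordK ?card_point //.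
by rewrite -[RHS](enum_rankK x) (enum_val_nth x0).
Qed.

Lemma ord_pointK : cancel ord_point point_ord.
Proof.
move=> a; apply: val_inj; rewrite /ord_point /point_ord /=.
have lt_a : (a < #|X|)%N by rewrite -card_point.
have -> : nth x0 (enum X) a = enum_val (Ordinal lt_a) by rewrite (enum_val_nth x0).
by rewrite enum_valK inordK //= -card_point.
Qed.

Definition to_matrix (f : X -> X -> K) : 'M[K]_N.+1 :=
  \matrix_(a, b) f (ord_point a) (ord_point b).
Definition to_col (v : X -> K) : 'cV[K]_N.+1 := \col_a v (ord_point a).

Lemma sum_ord_point (F : X -> K) : \sum_a F (ord_point a) = \sum_x F x.
Proof.
by rewrite [RHS](reindex ord_point) //; exists point_ord => ? _;
  rewrite ?point_ordK ?ord_pointK.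
Qed.

Lemma mul_to_col f v : to_matrix f *m to_col v = to_col (apply f v).
Proof.
apply/matrixP => a b; rewrite !mxE /apply -sum_ord_point.
by apply: eq_bigr => c _; rewrite !mxE.
Qed.

Lemma eq_to_col (A B : 'M[K]_N.+1) :
  (forall v, A *m to_col v = B *m to_col v) -> A = B.
Proof.
move=> AB; apply/matrixP => a b.
have dE : to_col (fun x => (x == ord_point b)%:R) = delta_mx b 0.
  apply/matrixP => c e; rewrite !mxE !ord1 eqxx andbT.
  by rewrite (inj_eq (can_inj ord_pointK)).
by have /matrixP/(_ a 0) := AB (fun x => (x == ord_point b)%:R);
   rewrite dE -!colE !mxE.
Qed.

Lemma mulmx_ringE (A B : 'M[K]_N.+1) (w : 'cV[K]_N.+1) :
  (A * B) *m w = A *m (B *m w).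
Proof. by rewrite mulmxA. Qed.

Lemma mulmx_ringD (A B : 'M[K]_N.+1) (w : 'cV[K]_N.+1) :
  (A + B) *m w = A *m w + B *m w.
Proof. exact: mulmxDl. Qed.

Lemma mulmx_ringB (A B : 'M[K]_N.+1) (w : 'cV[K]_N.+1) :
  (A - B) *m w = A *m w - B *m w.
Proof. exact: mulmxBl. Qed.

Lemma mulmx_alg c (w : 'cV[K]_N.+1) : (c%:A : 'M[K]_N.+1) *m w = c *: w.
Proof. by rewrite -scalemxAl mul1mx. Qed.

(** The relations are required of the operators on functions, where each of them is an
    identity at a single point, rather than of products of matrices. *)
Lemma ex_matrix_rep (p d n : nat) (q : K) (Q : d.-tuple K) (H : algType K)
    (T : nat -> H) (chi : X -> K) (M : nat -> X -> X -> K) :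
  is_hecke_algebra p n q Q T ->
  (forall x y, M 0%N x y = chi x * (x == y)%:R) ->
  (forall x, exists c : 'I_d, chi x ^+ p = tnth Q c ^+ p) ->
  (forall v, apply (M 0%N) (apply (M 1%N) (apply (M 0%N) (apply (M 1%N) v)))
           =1 apply (M 1%N) (apply (M 0%N) (apply (M 1%N) (apply (M 0%N) v)))) ->
  (forall i v x, (0 < i < n)%N ->
     apply (M i) (apply (M i) v) x = (q - 1) * apply (M i) v x + q * v x) ->
  (forall i j v, (i.+1 < j < n)%N ->
     apply (M i) (apply (M j) v) =1 apply (M j) (apply (M i) v)) ->
  (forall i v, (0 < i)%N -> (i.+1 < n)%N ->
     apply (M i) (apply (M i.+1) (apply (M i) v))
     =1 apply (M i.+1) (apply (M i) (apply (M i.+1) v))) ->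
  exists2 E, @matrix_rep H E &
    forall i, (i < n)%N -> forall x y, E (T i) x y = M i x y.
Proof.
move=> hH M0 chiP r01 rq rc rb.
have eq_col u v : u =1 v -> to_col u = to_col v.
  by move=> uv; apply/matrixP => a b; rewrite !mxE uv.
pose U i := to_matrix (M i).
have UE i v : U i *m to_col v = to_col (apply (M i) v) := mul_to_col _ _.
have U0E v : U 0%N *m to_col v = to_col (fun x => chi x * v x).
  rewrite UE; apply: eq_col => x; rewrite /apply (bigD1 x) //= M0 eqxx mulr1.
  rewrite big1 ?addr0 // => y; rewrite M0 eq_sym => /negbTE->.
  by rewrite mulr0 mul0r.
have U0X k v : U 0%N ^+ k *m to_col v = to_col (fun x => chi x ^+ k * v x).
  elim: k v => [|k IH] v; first by rewrite expr0 mul1mx; apply: eq_col => x; rewrite mul1r.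
  rewrite exprS mulmx_ringE IH U0E.
  by apply: eq_col => x; rewrite exprS mulrA.
have rel : hecke_relations p n q Q U.
  split.
  - apply: eq_to_col => v; rewrite mul0mx.
    have -> : \prod_(c < d) (U 0%N ^+ p - (tnth Q c ^+ p)%:A) *m to_col v =
        to_col (fun x => \prod_(c < d) (chi x ^+ p - tnth Q c ^+ p) * v x).
      elim: (index_enum _) => [|c s IH].
        by rewrite big_nil mul1mx; apply: eq_col => x; rewrite big_nil mul1r.
      rewrite big_cons mulmx_ringE IH mulmx_ringB U0X mulmx_alg.
      apply/matrixP => a b; rewrite !mxE big_cons -!mulrA -mulrBl.
      by rewrite mulrA.
    apply/matrixP => a b; rewrite !mxE.
    have [c cE] := chiP (ord_point a).
    by rewrite (bigD1 c) //= cE subrr !mul0r.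
  - by apply: eq_to_col => v; rewrite !mulmx_ringE !UE; apply: eq_col.
  - move=> i Hi; apply: eq_to_col => v; rewrite mul0mx.
    rewrite mulmx_ringE mulmx_ringB mulmx_ringD mulmx_alg -(scale1r 1) mulmx_alg.
    rewrite UE scale1r mulmxDr !UE.
    apply/matrixP => a b; rewrite !mxE rq //.
    by ring.
  - by move=> i j Hij; apply: eq_to_col => v; rewrite !mulmx_ringE !UE; apply/eq_col/rc.
  - by move=> i i0 Hi; apply: eq_to_col => v; rewrite !mulmx_ringE !UE; apply/eq_col/rb.
have [phi [phiT _]] := hH.2 _ _ rel.
exists (fun h x y => phi h (point_ord x) (point_ord y)).
  split.
  - by move=> x y; rewrite rmorph1 mxE (inj_eq (can_inj point_ordK)).
  - move=> g h x y; rewrite rmorphM mxE -sum_ord_point.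
    by apply: eq_bigr => a _; rewrite ord_pointK.
  by move=> c g h x y; rewrite linearP !mxE.
by move=> i lt_in x y; rewrite phiT // mxE !point_ordK.
Qed.
End Coordinates.
End MatrixReps.

Section SplitCharacter.
Variables (K : fieldType) (p d n : nat) (q : K) (Q : d.-tuple K).
Variables (H : algType K) (T : nat -> H).
Hypothesis n_gt1 : (1 < n)%N.
Hypothesis hH : is_hecke_algebra p n q Q T.
Hypothesis hss : semisimple H.
Variables (X : finType) (E : H -> X -> X -> K).
Hypothesis EP : matrix_rep E.

Lemma matrix_repL h c x y : E (c *: h) x y = c * E h x y.
Proof.
case: EP => _ _ EL.
have E0 : E 0 x y = 0.
  have := EL (-1) 0 0 x y; rewrite scaler0 addr0 mulN1r addNr => ->. done.
by have := EL c h 0 x y; rewrite addr0 E0 addr0.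
Qed.

Lemma matrix_repD g h x y : E (g + h) x y = E g x y + E h x y.
Proof. by case: EP => _ _ EL; rewrite -[g]scale1r EL mul1r scale1r. Qed.

(** A quotient of dimension 1 of a semisimple module splits off. As l is a common left
    eigenvector, the elements h with (l h)_x0 = 0 form a left ideal. Let J be a complement
    and z the component of 1 in J: then h z - chi(h) z lies both in J and in that ideal,
    hence vanishes, and v is the column x0 of z up to a scalar. *)
Lemma split_character (l : X -> K) (chi : nat -> K) x0 : l x0 != 0 ->
  (forall i, (i < n)%N -> forall y, \sum_x l x * E (T i) x y = chi i * l y) ->
  exists v : X -> K, \sum_x l x * v x = 1 /\
    forall i, (i < n)%N -> forall x, \sum_y E (T i) x y * v y = chi i * v x.
Proof.
move=> lx0 lT; case: (EP) => E1 EM EL.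
have lH h : exists c, forall y, \sum_x l x * E h x y = c * l y.
  apply: (generated_by n_gt1 hH (P := fun h => exists c, forall y,
    \sum_x l x * E h x y = c * l y)) => {h}.
  - exists 1 => y; rewrite (bigD1 y) //= E1 eqxx mulr1 mul1r big1 ?addr0 // => x.
    by rewrite E1 => /negbTE->; rewrite mulr0.
  - move=> c g h [a aE] [b bE]; exists (c * a + b) => y.
    rewrite mulrDl -mulrA -aE -bE mulr_sumr -big_split /=.
    by apply: eq_bigr => x _; rewrite EL; ring.
  - move=> g h [a aE] [b bE]; exists (a * b) => y.
    under eq_bigr => x _ do rewrite EM mulr_sumr.
    rewrite exchange_big /= -mulrA -bE mulr_sumr; apply: eq_bigr => z _.
    by rewrite mulrA -aE mulr_suml; apply: eq_bigr => x _; rewrite mulrA.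
  - by move=> i lt_in; exists (chi i); apply: lT.
pose L h := \sum_x l x * E h x x0.
have LL c g h : L (c *: g + h) = c * L g + L h.
  rewrite /L mulr_sumr -big_split /=; apply: eq_bigr => x _.
  by rewrite EL; ring.
have LM c g h : (forall y, \sum_x l x * E g x y = c * l y) -> L (g * h) = c * L h.
  move=> cE; rewrite /L; under eq_bigr => x _ do rewrite EM mulr_sumr.
  rewrite exchange_big mulr_sumr; apply: eq_bigr => z _ /=.
  by rewrite mulrA -cE mulr_suml; apply: eq_bigr => x _; rewrite mulrA.
have [|J [J0 JI dec]] := hss (I := fun h => L h = 0).
  split.
  - by have := LL (-1) 0 0; rewrite scaler0 addr0 mulN1r addNr.
  - by move=> g h g0 h0; rewrite -[g]scale1r LL g0 h0 mulr0 addr0.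
  - by move=> a h h0; have [c cE] := lH a; rewrite (LM _ _ _ cE) h0 mulr0.
have [y [z [Ly Jz yz]]] := dec 1.
have L1 : L 1 = l x0.
  rewrite /L (bigD1 x0) //= E1 eqxx mulr1 big1 ?addr0 // => x /negbTE nx.
  by rewrite E1 nx mulr0.
have Lz : L z = l x0 by rewrite -L1 yz -[y]scale1r LL Ly mulr0 add0r.
have Tz i : (i < n)%N -> T i * z = chi i *: z.
  move=> lt_in; apply/eqP; rewrite -subr_eq0; apply/eqP/JI.
    rewrite addrC -scaleNr LL (LM _ _ _ (lT _ lt_in)).
    by rewrite mulNr addNr.
  case: J0 => _ JD JM; apply: JD; first exact: JM.
  by rewrite -scaleNr -[z]mul1r scalerAl; apply: JM.
exists (fun x => (l x0)^-1 * E z x x0); split.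
  rewrite -(mulVf lx0) -Lz mulr_sumr; apply: eq_bigr => x _; by rewrite mulrCA.
move=> i lt_in x; rewrite mulrCA -matrix_repL -Tz // EM mulr_sumr.
by apply: eq_bigr => w _; rewrite mulrCA.
Qed.
End SplitCharacter.

Section RepresentationAction.
Variables (K : fieldType) (X : finType) (H : algType K) (E : H -> X -> X -> K).
Hypothesis EP : matrix_rep E.

Lemma apply_rep1 v : apply (E 1) v =1 v.
Proof.
case: EP => E1 _ _ x; rewrite /apply (bigD1 x) //= E1 eqxx mul1r big1 ?addr0 // => y.
by rewrite E1 eq_sym => /negbTE->; rewrite mul0r.
Qed.

Lemma apply_repM g h v : apply (E (g * h)) v =1 apply (E g) (apply (E h) v).
Proof.
case: EP => _ EM _ x; rewrite /apply.
under eq_bigr => y _ do rewrite EM mulr_suml.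
rewrite exchange_big; apply: eq_bigr => z _ /=; rewrite mulr_sumr.
by apply: eq_bigr => y _; rewrite mulrA.
Qed.

Lemma apply_repL c h v x : apply (E (c *: h)) v x = c * apply (E h) v x.
Proof.
by rewrite /apply mulr_sumr; apply: eq_bigr => y _; rewrite (matrix_repL EP) mulrA.
Qed.

Lemma eq_apply (f : X -> X -> K) u v : u =1 v -> apply f u =1 apply f v.
Proof. by move=> uv x; apply: eq_bigr => y _; rewrite uv. Qed.

End RepresentationAction.

(** * Monomial representations *)

Section MonomialRep.
Variables (K : fieldType) (n : nat) (q : K).
Hypothesis n_gt1 : (1 < n)%N.
Variables (X : finType) (L : Type) (act : X -> 'S_n -> X) (lab : X -> 'I_n -> L).
Variable P : pred X.
Variables (A B : L -> L -> K) (chi : L -> K) (chi0 : K).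

Hypothesis act1 : forall x, act x 1%g = x.
Hypothesis actM : forall x u w, act x (u * w)%g = act (act x u) w.
Hypothesis lab_act : forall x w k, lab (act x w) k = lab x ((w^-1)%g k).

Definition ord_zero : 'I_n := Ordinal (ltnW n_gt1).

Definition diag_coef i x := if P x then A (lab x (ord_pred i)) (lab x i) else q.
Definition swap_coef i x :=
  if P x && P (act x (srefl i)) then B (lab x (ord_pred i)) (lab x i) else 0.
Definition zero_coef x := if P x then chi (lab x ord_zero) else chi0.

(** The common form of the representations used below: X carries an action of S_n and
    labels, and T_i combines the values of a function at x and x s_i with coefficients that
    depend on the labels of i - 1 and i. Only the part P of X matters; letting every T_i act
    by q outside P allows X to be a full orbit, so that x s_i always exists. *)
Definition monomial (k : nat) (x y : X) : K :=
  if k is 0%N then zero_coef x * (x == y)%:R else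
  if insub k is Some i then
    diag_coef i x * (x == y)%:R + swap_coef i x * (act x (srefl i) == y)%:R
  else 0.

Lemma apply_monomial0 v x : apply (monomial 0) v x = zero_coef x * v x.
Proof.
rewrite /apply (bigD1 x) //= eqxx mulr1 big1 ?addr0 // => y /negbTE ny.
by rewrite eq_sym ny mulr0 mul0r.
Qed.

Lemma monomial_ord (i : 'I_n) x y : (0 < i)%N -> monomial i x y =
  diag_coef i x * (x == y)%:R + swap_coef i x * (act x (srefl i) == y)%:R.
Proof.
move=> i0; rewrite /monomial -(prednK i0); case: insubP => [j _ jE|]; last first.
  by rewrite prednK // ltn_ord.
by have -> : j = i by apply: val_inj; rewrite jE prednK.
Qed.

Lemma sum_delta (v : X -> K) (c : K) x : \sum_y c * (x == y)%:R * v y = c * v x.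
Proof.
rewrite (bigD1 x) //= eqxx mulr1 big1 ?addr0 // => y /negbTE ny.
by rewrite eq_sym ny mulr0 mul0r.
Qed.

Lemma apply_monomial (i : 'I_n) v x : (0 < i)%N -> apply (monomial i) v x =
  diag_coef i x * v x + swap_coef i x * v (act x (srefl i)).
Proof.
move=> i0; rewrite /apply -!sum_delta -big_split /=.
by apply: eq_bigr => y _; rewrite monomial_ord // mulrDl.
Qed.

Lemma srefl_sq i : (srefl i * srefl i)%g = 1%g :> 'S_n.
Proof. exact: tperm2. Qed.

Lemma act_srefl2 x i : act (act x (srefl i)) (srefl i) = x.
Proof. by rewrite -actM srefl_sq act1. Qed.

Lemma lab_srefl x i k : lab (act x (srefl i)) k = lab x (srefl i k).
Proof. by rewrite lab_act /srefl tpermV. Qed.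

(* The quadratic relation, coefficient by coefficient; A_wall is for x s_i outside P. *)
Hypothesis A_swap : forall x (i : 'I_n), (0 < i)%N -> P x ->
  let a := lab x (ord_pred i) in let b := lab x i in
  A a b + A b a = q - 1.
Hypothesis B_swap : forall x (i : 'I_n), (0 < i)%N -> P x -> P (act x (srefl i)) ->
  let a := lab x (ord_pred i) in let b := lab x i in
  B a b * B b a = - ((A a b - q) * (A a b + 1)).
Hypothesis A_wall : forall x (i : 'I_n), (0 < i)%N -> P x -> ~~ P (act x (srefl i)) ->
  let a := lab x (ord_pred i) in let b := lab x i in
  (A a b - q) * (A a b + 1) = 0.
(* The braid relation at x, compared in the coefficients of v x, v (x s_i) and v (x s_j). *)
Hypothesis A_triple : forall x (i j : 'I_n), (0 < i)%N -> j = i.+1 :> nat -> P x ->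
  let a := lab x (ord_pred i) in let b := lab x i in let c := lab x j in
  [/\ A a b ^+ 2 * A b c - (A a b - q) * (A a b + 1) * A a c
      = A b c ^+ 2 * A a b - (A b c - q) * (A b c + 1) * A a c,
      A a b * A b c + A a c * A b a = A b c * A a c &
      A a b * A a c = A b c * A a b + A a c * A c b].
(* Reduced paths between points of P stay in P, which is why steps out of P can be cut off. *)
Hypothesis P_step : forall (i : 'I_n) u x, reduced (i :: u) -> P x ->
  P (act x (word_perm (i :: u))) -> P (act x (srefl i)).
(* The relation T_0 T_1 T_0 T_1 = T_1 T_0 T_1 T_0 in the coefficient of v (x s_1). *)
Hypothesis chi_swap : forall x (i : 'I_n), i = 1%N :> nat -> P x ->
  P (act x (srefl i)) -> let a := lab x (ord_pred i) in let b := lab x i in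
  A a b * chi a + A b a * chi b = 0 \/ chi a = chi b.

(** The two reduced words of s_i s_j lead from x to x s_i s_j along the two sides of a
    square. *)
Lemma P_convex_comm x (i j : 'I_n) : (0 < i)%N -> (i.+1 < j)%N -> P x ->
  P (act (act x (srefl i)) (srefl j)) -> P (act x (srefl i)) /\ P (act x (srefl j)).
Proof.
move=> i0 ij Px Pw; have j0 : (0 < j)%N by lia.
have pi := val_ord_pred i0; have pj := val_ord_pred j0.
have wp (k l : 'I_n) : word_perm [:: k; l] = (srefl k * srefl l)%g.
  by rewrite !word_perm_cons word_perm_nil mulg1.
have red1 (k : 'I_n) : (0 < k)%N -> reduced [:: k].
  move=> k0; apply: reduced_cons => //; first exact: reduced_nil.
  by rewrite word_perm_nil !perm1 val_ord_pred //; lia.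
split.
  apply: (P_step (u := [:: j])) => //; last by rewrite wp actM.
  apply: reduced_cons; rewrite ?red1 // word_perm_cons word_perm_nil mulg1.
  by rewrite !srefl_id // ?ord_eqE ?pi; lia.
apply: (P_step (u := [:: i])) => //; last by rewrite wp -(srefl_comm i0 ij) actM.
apply: reduced_cons; rewrite ?red1 // word_perm_cons word_perm_nil mulg1.
by rewrite !srefl_id // ?ord_eqE ?pj; lia.
Qed.

(** The two reduced words of s_i s_j s_i lead from x to the opposite corner of a hexagon,
    along its two sides. *)
Lemma P_convex x (i j : 'I_n) : (0 < i)%N -> j = i.+1 :> nat -> P x ->
  P (act x (srefl i * srefl j * srefl i)%g) ->
  [/\ P (act x (srefl i)), P (act x (srefl j)),
      P (act (act x (srefl i)) (srefl j)) & P (act (act x (srefl j)) (srefl i))].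
Proof.
move=> i0 eji Px Pw; have j0 : (0 < j)%N by lia.
have pj : ord_pred j = i := ord_pred_next eji; have pi := val_ord_pred i0.
have ij : srefl i j = j by apply: srefl_id; rewrite // ?ord_eqE; lia.
have jp : srefl j (ord_pred i) = ord_pred i.
  by apply: srefl_id; rewrite // ?ord_eqE pi; lia.
have jj : srefl j j = i by rewrite /srefl pj tpermR.
have ji : srefl j i = j by rewrite /srefl pj tpermL.
have ii : srefl i i = ord_pred i by rewrite /srefl tpermR.
have ip : srefl i (ord_pred i) = i by rewrite /srefl tpermL.
have wp1 (k : 'I_n) : word_perm [:: k] = srefl k.
  by rewrite word_perm_cons word_perm_nil mulg1.
have red1 (k : 'I_n) : (0 < k)%N -> reduced [:: k].
  move=> k0; apply: reduced_cons => //; first exact: reduced_nil.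
  by rewrite word_perm_nil !perm1 val_ord_pred //; lia.
have rij : reduced [:: i; j].
  by apply: reduced_cons; rewrite ?red1 // wp1 jp ji pi; lia.
have rji : reduced [:: j; i].
  by apply: reduced_cons; rewrite ?red1 // wp1 pj ii ij pi; lia.
have riji : reduced [:: i; j; i].
  by apply: reduced_cons; rewrite // word_perm_cons wp1 !permM jp ji ip ij; lia.
have rjij : reduced [:: j; i; j].
  by apply: reduced_cons; rewrite // word_perm_cons wp1 pj !permM ii ij jp jj pi; lia.
have wiji : word_perm [:: i; j; i] = (srefl i * srefl j * srefl i)%g.
  by rewrite 2!word_perm_cons wp1 mulgA.
have wjij : word_perm [:: j; i; j] = (srefl i * srefl j * srefl i)%g.
  by rewrite 2!word_perm_cons wp1 mulgA -(srefl_braid i0 eji).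
have Pi : P (act x (srefl i)) by apply: (P_step riji) => //; rewrite wiji.
have Pj : P (act x (srefl j)) by apply: (P_step rjij) => //; rewrite wjij.
split=> //.
  by apply: (P_step rji); rewrite // word_perm_cons wp1 -actM mulgA.
apply: (P_step rij); rewrite // word_perm_cons wp1 -actM mulgA.
by rewrite -(srefl_braid i0 eji).
Qed.

Lemma swap_coef_srefl i x : swap_coef i (act x (srefl i)) =
  if P x && P (act x (srefl i)) then B (lab x i) (lab x (ord_pred i)) else 0.
Proof.
rewrite /swap_coef act_srefl2 andbC !lab_srefl /srefl.
by rewrite tpermL tpermR.
Qed.

Lemma monomial_quadratic (i : 'I_n) v x : (0 < i)%N ->
  apply (monomial i) (apply (monomial i) v) x
  = (q - 1) * apply (monomial i) v x + q * v x.
Proof.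
move=> i0; rewrite !apply_monomial // act_srefl2 swap_coef_srefl.
rewrite /diag_coef /swap_coef !lab_srefl /srefl tpermL tpermR -/(srefl i).
have := @A_swap x i i0; have := @B_swap x i i0; have := @A_wall x i i0 => /=.
case: (P x) => /=; last by move=> _ _ _; ring.
case: (P (act x (srefl i))) => /=.
  move=> _ /(_ isT isT) HB /(_ isT) HA.
  set a := lab x _ in HB HA *; set b := lab x _ in HB HA *.
  have -> : A b a = q - 1 - A a b by rewrite -HA; ring.
  transitivity (A a b ^+ 2 * v x + B a b * B b a * v x
    + (q - 1) * B a b * v (act x (srefl i))); first by ring.
  by rewrite HB; ring.
move=> /(_ isT isT) HA _ _; apply/eqP; rewrite -subr_eq0; apply/eqP.
transitivity ((A (lab x (ord_pred i)) (lab x i) - q) *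
  (A (lab x (ord_pred i)) (lab x i) + 1) * v x); first by ring.
by rewrite HA mul0r.
Qed.

Lemma monomial_comm (i j : 'I_n) v x : (0 < i)%N -> (i.+1 < j)%N ->
  apply (monomial i) (apply (monomial j) v) x
  = apply (monomial j) (apply (monomial i) v) x.
Proof.
move=> i0 ij; have j0 : (0 < j)%N by lia.
have pi := val_ord_pred i0; have pj := val_ord_pred j0.
have sij : srefl i j = j by apply: srefl_id; rewrite // ?ord_eqE; lia.
have sipj : srefl i (ord_pred j) = ord_pred j.
  by apply: srefl_id; rewrite // ?ord_eqE pj; lia.
have sji : srefl j i = i by apply: srefl_id; rewrite // ?ord_eqE; lia.
have sjpi : srefl j (ord_pred i) = ord_pred i.
  by apply: srefl_id; rewrite // ?ord_eqE pi; lia.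
have E2 : act (act x (srefl j)) (srefl i) = act (act x (srefl i)) (srefl j).
  by rewrite -!actM (srefl_comm i0 ij).
rewrite !apply_monomial // E2 /diag_coef /swap_coef E2 !lab_srefl.
rewrite !(sij, sipj, sji, sjpi).
have C := P_convex_comm i0 ij; move: (C x) => {C}.
case: (P x) => /= C; last by ring.
case: (P (act (act _ _) _)) C => [/(_ isT isT)[-> ->]|_] /=; first by ring.
by case: (P _) => /=; case: (P _) => /=; ring.
Qed.

Lemma monomial_comm0 (j : 'I_n) v x : (1 < j)%N ->
  apply (monomial 0) (apply (monomial j) v) x
  = apply (monomial j) (apply (monomial 0) v) x.
Proof.
move=> j1; have j0 : (0 < j)%N by lia.
rewrite !(apply_monomial0, apply_monomial) // /zero_coef.
rewrite lab_srefl srefl_id // /swap_coef -?(inj_eq val_inj) /=; try lia.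
case: (P x) => /=; last by ring.
by case: (P _) => /=; ring.
Qed.

Lemma monomial_braid0 (i : 'I_n) v x : i = 1%N :> nat ->
  apply (monomial 0) (apply (monomial i) (apply (monomial 0) (apply (monomial i) v))) x
  = apply (monomial i) (apply (monomial 0) (apply (monomial i) (apply (monomial 0) v))) x.
Proof.
move=> i1; have i0 : (0 < i)%N by rewrite i1.
have pz : ord_pred i = ord_zero by apply: val_inj; rewrite [LHS]val_ord_pred // i1.
rewrite !(apply_monomial0, apply_monomial) // act_srefl2 swap_coef_srefl.
rewrite /diag_coef /swap_coef /zero_coef !lab_srefl -pz /srefl !tpermL !tpermR -/(srefl i).
have := @chi_swap x i i1; rewrite /=.
case: (P x) => /=; last by move=> _; ring.
case: (P (act x (srefl i))) => /=; last by move=> _; ring.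
move=> /(_ isT isT); move: (lab x _) (lab x i) => a b.
move: (v x) (v (act x (srefl i))) => vx vy.
move: (A a b) (A b a) (B a b) (B b a) => Aab Aba Bab Bba.
move=> H; apply/eqP; rewrite -subr_eq0; apply/eqP.
transitivity ((Aab * chi a + Aba * chi b) * (chi a - chi b) * Bab * vy); first by ring.
by case: H => ->; rewrite ?subrr ?mulr0 !mul0r.
Qed.

(** Both sides are combinations of the values of v at the points of the orbit of x under s_i
    and s_j. The coefficients at x, x s_i and x s_j are compared by A_triple. The others
    agree term by term; at the far corner this uses [P_convex], which keeps both paths
    inside P. *)
Lemma monomial_braid (i j : 'I_n) v x : (0 < i)%N -> j = i.+1 :> nat ->
  apply (monomial i) (apply (monomial j) (apply (monomial i) v)) x
  = apply (monomial j) (apply (monomial i) (apply (monomial j) v)) x.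
Proof.
move=> i0 eji; have j0 : (0 < j)%N by rewrite eji.
have pj : ord_pred j = i := ord_pred_next eji.
have pi := val_ord_pred i0.
have ij : srefl i j = j by apply: srefl_id; rewrite // ?ord_eqE; lia.
have jp : srefl j (ord_pred i) = ord_pred i.
  by apply: srefl_id; rewrite // ?ord_eqE pi; lia.
have jj : srefl j j = i by rewrite /srefl pj tpermR.
have ji : srefl j i = j by rewrite /srefl pj tpermL.
have ii : srefl i i = ord_pred i by rewrite /srefl tpermR.
have ip : srefl i (ord_pred i) = i by rewrite /srefl tpermL.
have [Px|nPx] := boolP (P x); last first.
  by rewrite !apply_monomial // /diag_coef /swap_coef (negbTE nPx) /= !mul0r !addr0.
have E3 : act (act (act x (srefl j)) (srefl i)) (srefl j)
        = act (act (act x (srefl i)) (srefl j)) (srefl i).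
  by rewrite -!actM !mulgA (srefl_braid i0 eji).
rewrite !apply_monomial // !act_srefl2 E3.
have [I1 I2 I3] := A_triple i0 eji Px.
have S1 := A_swap i0 Px; have S2 := A_swap j0 Px; rewrite /= pj in S1 S2.
have B1 := B_swap i0 Px; have B2 := B_swap j0 Px; rewrite /= pj in B1 B2.
have W1 := A_wall i0 Px; have W2 := A_wall j0 Px; rewrite /= pj in W1 W2.
have C := P_convex i0 eji Px; rewrite !actM in C.
rewrite /diag_coef /swap_coef !act_srefl2 E3 !lab_srefl Px pj.
rewrite !(ij, jp, jj, ji, ii, ip).
rewrite /= in I1 I2 I3 S1 S2.
move: I1 I2 I3 S1 S2 B1 B2 W1 W2 C.
move: (lab x (ord_pred i)) (lab x i) (lab x j) => a b c I1 I2 I3 S1 S2 B1 B2 W1 W2 C.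
set xs := act x (srefl i) in B1 W1 C *; set xt := act x (srefl j) in B2 W2 C *.
set xst := act xs (srefl j) in C *; set xts := act xt (srefl i) in C *.
set xsts := act xst (srefl i) in C *.
move: (v x) (v xs) (v xt) (v xst) (v xts) (v xsts) => v0 v1 v2 v3 v4 v5.
move: B1 B2 W1 W2 C.
move: (P xs) (P xt) (P xst) (P xts) (P xsts) => p1 p2 p3 p4 p5 B1 B2 W1 W2 C /=.
pose M1 := if p1 then B a b * B b a else 0.
pose M2 := if p2 then B b c * B c b else 0.
have M1E : (A a b - q) * (A a b + 1) = - M1.
  by rewrite /M1; move: B1 W1; case: (p1) => [/(_ isT) -> _|_ /(_ isT) ->]; ring.
have M2E : (A b c - q) * (A b c + 1) = - M2.
  by rewrite /M2; move: B2 W2; case: (p2) => [/(_ isT) -> _|_ /(_ isT) ->]; ring.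
rewrite M1E M2E in I1 => {S1 S2 B1 B2 W1 W2 M1E M2E}.
apply/eqP; rewrite -subr_eq0; apply/eqP.
transitivity (
  (A a b ^+ 2 * A b c - - M1 * A a c - (A b c ^+ 2 * A a b - - M2 * A a c)) * v0
  + (A a b * A b c + A a c * A b a - A b c * A a c) * (if p1 then B a b else 0) * v1
  + (A a b * A a c - (A b c * A a b + A a c * A c b)) * (if p2 then B b c else 0) * v2);
  last by rewrite I1 I2 I3 !subrr !mul0r !addr0.
rewrite /M1 /M2 => {I1 I2 I3 M1 M2}.
case: p5 C => [/(_ isT)[-> -> -> ->]|_] /=; first by ring.
by case: p1; case: p2; case: p3; case: p4 => /=; ring.
Qed.

Lemma ex_monomial_rep (p d : nat) (Q : d.-tuple K) (H : algType K) (T : nat -> H) (x0 : X) :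
  is_hecke_algebra p n q Q T ->
  (forall x, exists c : 'I_d, zero_coef x ^+ p = tnth Q c ^+ p) ->
  exists2 E, @matrix_rep K X H E &
    forall i, (i < n)%N -> forall x y, E (T i) x y = monomial i x y.
Proof.
move=> hH zeroP; apply: (ex_matrix_rep x0 hH (chi := zero_coef)) => //.
- by move=> v x; apply: (@monomial_braid0 (Ordinal n_gt1)).
- by move=> i v x /andP[i0 lt_in]; apply: (@monomial_quadratic (Ordinal lt_in)).
- move=> i j v /andP[ij jn] x; case: i ij => [|i] ij.
    exact: (@monomial_comm0 (Ordinal jn)).
  have lt_in : (i.+1 < n)%N by lia.
  exact: (@monomial_comm (Ordinal lt_in) (Ordinal jn)).
- move=> i v i0 i1 x; have lt_in : (i < n)%N by lia.
  exact: (@monomial_braid (Ordinal lt_in) (Ordinal i1)).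
Qed.
End MonomialRep.

(** * Matrix entries along reduced words *)

Section Paths.
Variables (K : fieldType) (n : nat) (X : finType) (act : X -> 'S_n -> X).
Hypothesis act1 : forall x, act x 1%g = x.
Hypothesis actM : forall x u w, act x (u * w)%g = act (act x u) w.
(* G u x y is meant to be the entry (x, y) of the operator of the word u, or the entry (y, x) of the
   operator of the reversed word. *)
Variables (alpha beta : 'I_n -> X -> K) (G : seq 'I_n -> X -> X -> K).
Hypothesis G0 : forall x y, G [::] x y = (x == y)%:R.
Hypothesis GS : forall (i : 'I_n) u x y, (0 < i)%N -> G (i :: u) x y =
  alpha i x * G u x y + beta i x * G u (act x (srefl i)) y.

Fixpoint path_coef u x :=
  if u is i :: u' then beta i x * path_coef u' (act x (srefl i)) else 1.

Definition free_point x := forall w, act x w = x -> w = 1%g.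

Lemma free_point_act x w : free_point x -> free_point (act x w).
Proof.
move=> fx u; rewrite -actM => /(congr1 (fun y => act y (w^-1)%g)).
rewrite -!actM mulgV act1 => /fx e.
have -> : u = (w^-1 * (w * u * w^-1) * w)%g by rewrite !mulgA mulVg mul1g mulgKV.
by rewrite e mulg1 mulVg.
Qed.

(** Each letter multiplies a point by at most one reflection, and x w is reached from a free
    point x only by words for w. *)
Lemma path_too_short u x w : simple_word u -> free_point x ->
  (size u < perm_length w)%N -> G u x (act x w) = 0.
Proof.
elim: u x w => [|i u IH] x w /=.
  move=> _ fx lw; rewrite G0; case: eqP => // /esym/fx w1.
  by rewrite w1 perm_length1 in lw.
case/andP=> i0 su fx lw; rewrite (GS _ _ _ i0) IH ?(ltnW lw) // mulr0 add0r.
have -> : act x w = act (act x (srefl i)) (srefl i * w)%g by rewrite -actM srefl_mulK.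
rewrite IH ?mulr0 //; first exact: free_point_act.
have := perm_length_srefl_le (srefl i * w)%g i0; rewrite srefl_mulK; lia.
Qed.

(** All the letters of a reduced word are needed to reach the last point, so that no
    diagonal term contributes. *)
Lemma path_reduced u x : reduced u -> free_point x ->
  G u x (act x (word_perm u)) = path_coef u x.
Proof.
elim: u x => [|i u IH] x; first by rewrite word_perm_nil act1 G0 eqxx.
move=> riu fx; have [i0 ru _] := reduced_behead riu.
have /andP[su _] := ru; have /andP[_ /eqP lu] := riu.
rewrite (GS _ _ _ i0) path_too_short ?lu // mulr0 add0r word_perm_cons actM IH //.
exact: free_point_act.
Qed.
End Paths.

(** The labels exchanged at a step of the path are, seen from x, those of an inversion of
    the permutation, and [big_inverted_srefl] meets each inversion once. *)
Lemma path_coef_mul (K : fieldType) n (X : finType) (act : X -> 'S_n -> X)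
    (L : Type) (lab : X -> 'I_n -> L) (N : L -> L -> K) (P : pred X)
    (b1 b2 : 'I_n -> X -> K) :
  (forall x u w, act x (u * w)%g = act (act x u) w) ->
  (forall x w k, lab (act x w) k = lab x ((w^-1)%g k)) ->
  (forall (i : 'I_n) x, (0 < i)%N -> P x -> P (act x (srefl i)) ->
     b1 i x * b2 i x = N (lab x (ord_pred i)) (lab x i)) ->
  (forall (i : 'I_n) u x, reduced (i :: u) -> P x -> P (act x (word_perm (i :: u))) ->
     P (act x (srefl i))) ->
  forall u x, reduced u -> P x -> P (act x (word_perm u)) ->
  path_coef act b1 u x * path_coef act b2 u x
  = \prod_(c | inverted (word_perm u) c) N (lab x c.1) (lab x c.2).
Proof.
move=> actM lab_act b12 Pstep; elim=> [|i u IH] x ru Px Pw.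
  by rewrite word_perm_nil big1 ?mulr1 // => -[a b]; rewrite invertedE !perm1; lia.
have [i0 ru' ui] := reduced_behead ru; have Ps := Pstep _ _ _ ru Px Pw.
rewrite word_perm_cons (big_inverted_srefl _ (fun a b => N (lab x a) (lab x b)) i0 ui) /=.
rewrite mulrACA b12 // IH // -?actM -?word_perm_cons //; congr (_ * _).
by apply: eq_bigr => c _; rewrite !lab_act /srefl tpermV.
Qed.

(** * The Poincare polynomial and the parameters of a semisimple algebra *)

Section SemisimpleConsequences.
Variables (K : fieldType) (p d n : nat) (q : K) (Q : d.-tuple K).
Variables (H : algType K) (T : nat -> H).
Hypothesis n_gt1 : (1 < n)%N.
Hypothesis d_gt0 : (0 < d)%N.
Hypothesis hH : is_hecke_algebra p n q Q T.
Hypothesis hss : semisimple H.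

(** In the regular representation of the Hecke algebra of S_n, with a scalar for T_0, the
    sum of the coordinates is a left eigenvector with T_i = q. The right eigenvectors with
    these eigenvalues are the multiples of q to the length, whose coordinates add up to the
    Poincare polynomial. *)
Lemma semisimple_poincare_neq0 : poincare q [set: 'S_n] != 0.
Proof.
pose A (a b : 'I_n) : K := if (a < b)%N then 0 else q - 1.
pose B (a b : 'I_n) : K := if (a < b)%N then 1 else q.
pose act (x w : 'S_n) : 'S_n := (w^-1 * x)%g.
pose lab (x : 'S_n) (k : 'I_n) : 'I_n := x k.
pose Q0 := tnth Q (Ordinal d_gt0).
have neq x (i : 'I_n) : (0 < i)%N -> lab x (ord_pred i) != lab x i.
  move=> i0; rewrite (inj_eq perm_inj); apply/eqP => e.
  by have := val_ord_pred i0; rewrite e; lia.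
have [||||||||||E EP ET] := @ex_monomial_rep K n q n_gt1 'S_n 'I_n act lab predT
    A B (fun=> Q0) Q0 _ _ _ _ _ _ _ _ _ p d Q H T 1%g hH _.
- by move=> x; rewrite /act invg1 mul1g.
- by move=> x u w; rewrite /act invMg mulgA.
- by move=> x w k; rewrite /lab /act permM.
- move=> x i i0 _ a b; have ab : a != b := neq x i i0.
  by rewrite /A; case: (ltngtP a b) ab => [_ _|_ _|/val_inj->]; rewrite ?eqxx //; ring.
- move=> x i i0 _ _ a b; have ab : a != b := neq x i i0.
  by rewrite /A /B; case: (ltngtP a b) ab => [_ _|_ _|/val_inj->]; rewrite ?eqxx //; ring.
- by [].
- move=> x i j i0 eji _ a b c.
  have ab : a != b := neq x i i0.
  have bc : b != c by have := @neq x j; rewrite (ord_pred_next eji) eji; apply.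
  have ac : a != c.
    rewrite /a /c (inj_eq perm_inj); apply/eqP => e.
    by have := val_ord_pred i0; rewrite e; lia.
  rewrite /A; case: (ltngtP a b) ab => [lab' _|lab' _|/val_inj->]; rewrite ?eqxx //;
  case: (ltngtP b c) bc => [lbc _|lbc _|/val_inj->]; rewrite ?eqxx //;
  case: (ltngtP a c) ac => [lac _|lac _|/val_inj->]; rewrite ?eqxx //;
  try lia; split; ring.
- by [].
- by move=> *; right.
- by move=> x; exists (Ordinal d_gt0).
have [||v [vsum vT]] := @split_character K p d n q Q H T n_gt1 hH hss _ E EP
  (fun=> 1) (fun i => if i is 0%N then Q0 else q) 1%g.
- exact: oner_neq0.
- move=> i lt_in y; rewrite mulr1.
  under eq_bigr => x _ do rewrite mul1r ET //.
  case: i lt_in => [|i] lt_in.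
    rewrite /monomial (bigD1 y) //= eqxx mulr1 big1 ?addr0 // => x /negbTE->.
    by rewrite mulr0.
  pose k := Ordinal lt_in.
  under eq_bigr => x _ do rewrite (@monomial_ord K n q _ _ _ _ _ _ _ _ _ _ k) //.
  rewrite big_split /= (bigD1 y) //= eqxx mulr1 big1 ?addr0; last first.
    by move=> x /negbTE->; rewrite mulr0.
  have sy : act (srefl k * y)%g (srefl k) = y.
    by rewrite /act /srefl tpermV -/(srefl k) srefl_mulK.
  rewrite (bigD1 (srefl k * y)%g) //= sy eqxx mulr1 big1 ?addr0; last first.
    move=> x nx; case: eqP => [exy|]; last by rewrite mulr0.
    by case/eqP: nx; rewrite -exy /act /srefl tpermV -/(srefl k) srefl_mulK.
  rewrite /diag_coef /swap_coef /= /A /B /lab !permM /srefl tpermL tpermR.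
  have := neq y k isT; rewrite /lab -(inj_eq val_inj) /=.
  by case: (ltngtP (y (ord_pred k)) (y k)) => //= _ _; ring.
have vE w : v w = q ^+ perm_length w * v 1%g.
  have [u ru <-] := ex_reduced w; elim: u ru => [|i u IH] ru.
    by rewrite word_perm_nil perm_length1 mul1r.
  have [i0 ru' ui] := reduced_behead ru.
  rewrite word_perm_cons perm_length_up // exprS -mulrA -IH //.
  have := vT i (ltn_ord i) (word_perm u).
  under eq_bigr => x _ do rewrite ET //.
  have := @apply_monomial K n q n_gt1 'S_n 'I_n act lab predT A B (fun=> Q0) Q0 i v
    (word_perm u) i0.
  rewrite /apply => ->.
  rewrite /diag_coef /swap_coef /= /A /B /lab ui mul0r add0r mul1r.
  by rewrite /act /srefl tpermV => ->; rewrite -(prednK i0).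
apply/eqP => P0; move/eqP: vsum; under eq_bigr => x _ do rewrite mul1r vE.
rewrite -mulr_suml; move: P0; rewrite /poincare.
under eq_bigl => w do rewrite inE; move=> ->.
by rewrite mul0r eq_sym oner_eq0.
Qed.

(** If Q_c^p = Q_e^p, the factor X^p - Q_c^p occurs twice in the relation of T_0, which is
    thus satisfied by a Jordan block of size 2 and eigenvalue Q_c. With T_i = q this is a
    module of length 2 that does not split. *)
Lemma semisimple_param_neq (c e : 'I_d) : c != e -> tnth Q c ^+ p != tnth Q e ^+ p.
Proof.
move=> ce; apply/eqP => eQ; pose x := tnth Q c.
pose N : 'M[K]_2 := delta_mx 0 1; pose J : 'M[K]_2 := x%:M + N.
have N2 : N * N = 0 by rewrite -[LHS]/(N *m N) mul_delta_mx_0.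
have div_lin f : tnth Q f ^+ p = x ^+ p ->
    exists R, 'X^p - (tnth Q f ^+ p)%:P = R * ('X - x%:P).
  move=> ef; apply/factor_theorem; apply/rootP.
  by rewrite hornerD hornerN hornerXn hornerC ef subrr.
have rel : hecke_relations p n q Q (fun i => if i is 0%N then J else q%:A).
  split.
  - transitivity (horner_mx J (\prod_(f < d) ('X^p - (tnth Q f ^+ p)%:P))).
      rewrite rmorph_prod; apply: eq_bigr => f _.
      rewrite rmorphB rmorphXn /= horner_mx_X horner_mx_C.
      by rewrite -scalemx1.
    rewrite (bigD1 c) //= (bigD1 e) /=; last by rewrite eq_sym.
    have [R1 ->] := div_lin c erefl; have [R2 ->] := div_lin e (esym eQ).
    rewrite mulrA mulrACA; set R := \prod_(f < d | _) _.
    rewrite !rmorphM rmorphB /= horner_mx_X horner_mx_C.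
    by rewrite /J [x%:M + N]addrC addrK N2 mulr0 mul0r.
  - by rewrite !mulr_algr mulr_algl -?scalerAl.
  - by move=> [|i] // _; rewrite subrr mul0r.
  - move=> i [|j] // _; case: i => [|i] //.
    by rewrite mulr_algl mulr_algr.
  - by move=> [|i].
have [phi [phiT _]] := hH.2 _ _ rel.
have EP : @matrix_rep K 'I_2 H (fun h => phi h).
  split=> [a b|g h a b|k g h a b]; first by rewrite rmorph1 mxE.
    by rewrite rmorphM mxE.
  by rewrite linearP !mxE.
have [||v [vsum vT]] := @split_character K p d n q Q H T n_gt1 hH hss _ _ EP
  (fun a => (a == 1)%:R) (fun i => if i is 0%N then x else q) 1.
- by rewrite eqxx oner_neq0.
- move=> i lt_in y; rewrite big_ord_recl big_ord1 phiT //= mul0r mul1r add0r.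
  case: i {lt_in} => [|i]; rewrite !mxE eq_sym /=.
    have -> : lift ord0 ord0 = 1 :> 'I_2 by apply: val_inj.
    by rewrite /= addr0 mulr_natr.
  have -> : lift ord0 ord0 = 1 :> 'I_2 by apply: val_inj.
  by rewrite mulr_natr.
have := vT 0%N (ltnW n_gt1) 0; rewrite big_ord_recl big_ord1 phiT ?(ltnW n_gt1) //.
rewrite !mxE /= mulr1n mulr0n addr0 add0r mul1r => /eqP.
rewrite -subr_eq0 addrC addKr => v1.
move: vsum; rewrite big_ord_recl big_ord1 /= mul0r add0r mul1r (eqP v1).
by move=> /eqP; rewrite eq_sym oner_eq0.
Qed.
End SemisimpleConsequences.

(** * Standard tableaux *)

Section Tableaux.
Variables (r n : nat) (la : multipartition r n).
Implicit Types (t : tableau r n) (x y z : node r n) (k l i j : 'I_n).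

(** The order on nodes for which standard tableaux are the linear extensions of the diagram. *)
Definition weakly_nw x y :=
  [&& x.1.1 == y.1.1, (x.1.2 <= y.1.2)%N & (x.2 <= y.2)%N].

Lemma diagram_nw x y : weakly_nw x y -> y \in diagram la -> x \in diagram la.
Proof.
rewrite !inE => /and3P[/eqP -> le_row le_col] y_in.
apply: leq_ltn_trans le_col (leq_trans y_in _).
have /andP[/forallP/(_ y.1.1)/forallP/(_ x.1.2)/forallP/(_ y.1.2) + _] := mp_rowsP la.
by rewrite le_row.
Qed.

Lemma std_inj t : std la t -> injective t.
Proof. by case/and4P=> /injectiveP. Qed.

Lemma std_in t k : std la t -> t k \in diagram la.
Proof.
case/and4P=> _ /eqP <- _ _; exact: imset_f.
Qed.

Lemma std_onto t x : std la t -> x \in diagram la -> exists k, t k = x.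
Proof. by case/and4P=> _ /eqP <- _ _ /imsetP[k _ ->]; exists k. Qed.

Lemma std_nw t k l : std la t -> weakly_nw (t k) (t l) -> (k <= l)%N.
Proof.
move=> st; case/and3P=> ec; rewrite leq_eqVlt => erow; rewrite leq_eqVlt => ecol.
have /and4P[_ _ /forallP rowP /forallP colP] := st.
have [m mE] : exists m, t m = ((t k).1.1, (t k).1.2, (t l).2).
  apply: std_onto => //; apply: (@diagram_nw _ (t l)); last exact: std_in.
  by rewrite /weakly_nw /= ec leqnn /= leq_eqVlt erow.
apply: (@leq_trans m).
  case/orP: ecol => [/eqP/val_inj ecol|lt_col].
    have -> // : k = m by apply: (std_inj st); rewrite mE -ecol; case: (t k) => [[]].
  have /forallP/(_ m)/implyP := rowP k; rewrite mE /= => H; apply/ltnW/H.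
  by rewrite lt_col andbT -surjective_pairing.
case/orP: erow => [/eqP/val_inj erow|lt_row].
  have -> // : m = l.
  by apply: (std_inj st); rewrite mE erow (eqP ec); case: (t l) => [[]].
have /forallP/(_ l)/implyP := colP m; rewrite mE /= => H; apply/ltnW/H.
by rewrite ec eqxx lt_row.
Qed.

Lemma stdI t : injective t -> [set t k | k : 'I_n] = diagram la ->
  (forall k l, weakly_nw (t k) (t l) -> (k <= l)%N) -> std la t.
Proof.
move=> tinj timg tnw; apply/and4P; split; first exact/injectiveP.
- exact/eqP.
- apply/forallP => k; apply/forallP => l; apply/implyP => /andP[/eqP e1 lt2].
  rewrite ltn_neqAle tnw ?andbT; last by rewrite /weakly_nw e1 eqxx leqnn ltnW.
  by apply/negP => /eqP/val_inj ekl; rewrite ekl ltnn in lt2.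
apply/forallP => k; apply/forallP => l; apply/implyP => /and3P[/eqP e1 /eqP e2 lt2].
rewrite ltn_neqAle tnw ?andbT; last by rewrite /weakly_nw e1 e2 eqxx leqnn ltnW.
by apply/negP => /eqP/val_inj ekl; rewrite ekl ltnn in lt2.
Qed.

Lemma tab_act1 t : tab_act t 1%g = t.
Proof. by apply/ffunP => k; rewrite ffunE invg1 perm1. Qed.

Lemma tab_actM t (u w : 'S_n) : tab_act t (u * w)%g = tab_act (tab_act t u) w.
Proof. by apply/ffunP => k; rewrite !ffunE invMg permM. Qed.

Lemma tab_actE t (w : 'S_n) k : tab_act t w k = t ((w^-1)%g k).
Proof. by rewrite ffunE. Qed.

Lemma tab_act_srefl t i k : tab_act t (srefl i) k = t (srefl i k).
Proof. by rewrite tab_actE /srefl tpermV. Qed.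

Lemma tab_act_free t : injective t -> forall w, tab_act t w = t -> w = 1%g.
Proof.
move=> tinj w tw; apply/eqP; rewrite -invg_eq1; apply/eqP/permP => k; rewrite perm1.
by apply: tinj; rewrite -{2}tw tab_actE.
Qed.

Lemma std_act t (w : 'S_n) : std la t ->
  std la (tab_act t w) <-> (forall k l, weakly_nw (t k) (t l) -> (w k <= w l)%N).
Proof.
move=> st; split=> [sw k l nw|H].
  by apply: (std_nw sw); rewrite !tab_actE !permK.
apply: stdI.
- by move=> k l; rewrite !tab_actE => /(std_inj st)/perm_inj.
- have /and4P[_ /eqP <- _ _] := st; apply/setP => x.
  apply/imsetP/imsetP => -[k _ ->].
    by exists ((w^-1)%g k); rewrite ?tab_actE.
  by exists (w k); rewrite ?tab_actE ?permK.
- by move=> k l; rewrite !tab_actE => /H; rewrite !permKV.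
Qed.

(** If t s_i were not standard, the nodes of i - 1 and i would be comparable, and any w that
    has a reduced word beginning with i inverts these two entries. *)
Lemma std_step i u t : reduced (i :: u) -> std la t ->
  std la (tab_act t (word_perm (i :: u))) -> std la (tab_act t (srefl i)).
Proof.
move=> riu st /(std_act _ st) H; have [i0 _ ui] := reduced_behead riu.
apply/(std_act _ st) => k l nw.
have le_kl := std_nw st nw; have pi := val_ord_pred i0.
have [->//|nkl] := eqVneq k l.
have lt_kl : (k < l)%N by rewrite ltn_neqAle le_kl andbT.
apply: ltnW; rewrite srefl_lt // lt_kl orbT andbT; apply/negP => /andP[/eqP ek /eqP el].
have := H _ _ nw; rewrite ek el word_perm_cons !permM /srefl tpermL tpermR.
by rewrite leqNgt ui.
Qed.

Lemma std_consecutive t i x : std la t -> (0 < i)%N -> x \in diagram la ->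
  weakly_nw (t (ord_pred i)) x -> weakly_nw x (t i) -> x = t (ord_pred i) \/ x = t i.
Proof.
move=> st i0 x_in nw1 nw2; have [m mE] := std_onto st x_in; subst x.
have := std_nw st nw1; have := std_nw st nw2; have pi := val_ord_pred i0.
rewrite leq_eqVlt => /orP[/eqP/val_inj->|lt_mi]; first by right.
move=> le_m; left; congr (t _); apply: ord_inj; rewrite pi.
by rewrite pi in le_m; lia.
Qed.

(** The nodes of i - 1 and i must be comparable, and they are neighbours because no entry
    fits between i - 1 and i. *)
Lemma std_wall t i : std la t -> (0 < i)%N -> ~~ std la (tab_act t (srefl i)) ->
  let x := t (ord_pred i) in let y := t i in
  x.1.1 = y.1.1 /\ ((x.1.2 = y.1.2 /\ y.2 = x.2.+1 :> nat) \/
                    (x.2 = y.2 /\ y.1.2 = x.1.2.+1 :> nat)).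
Proof.
move=> st i0 ns x y; have pi := val_ord_pred i0.
have nw : weakly_nw x y.
  apply: contraNT ns => nnw; apply/(std_act _ st) => k l nwkl.
  have le_kl := std_nw st nwkl; have [->//|nkl] := eqVneq k l.
  have lt_kl : (k < l)%N by rewrite ltn_neqAle le_kl andbT.
  apply: ltnW; rewrite srefl_lt // lt_kl orbT andbT.
  by apply: contra nnw => /andP[/eqP ek /eqP el]; rewrite /x /y -ek -el.
have nxy : x <> y.
  by move/(std_inj st) => e; rewrite e in pi; lia.
have between := std_consecutive st i0.
have y_in : y \in diagram la := std_in _ st.
have /and3P[/eqP ec le_row le_col] := nw; split=> //.
rewrite -/x -/y in between.
case: x y ec le_row le_col nxy between y_in {nw} => [[cx rx] kx] [[cy ry] ky] /= ec.
subst cy => le_row le_col nxy between y_in.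
have inD (a b : 'I_n) : (a <= ry)%N -> (b <= ky)%N -> ((cx, a, b) : node r n) \in diagram la.
  move=> la1 lb1; apply: diagram_nw y_in; by rewrite /weakly_nw /= eqxx la1 lb1.
have btw (a b : 'I_n) : (rx <= a <= ry)%N -> (kx <= b <= ky)%N ->
    (a = rx /\ b = kx) \/ (a = ry /\ b = ky).
  move=> /andP[a1 a2] /andP[b1 b2].
  have [||[-> ->]|[-> ->]] := between _ (inD a b a2 b2); try by [left|right].
    by rewrite /weakly_nw /= eqxx a1 b1.
  by rewrite /weakly_nw /= eqxx a2 b2.
have [erow|nrow] := eqVneq rx ry.
  left; split=> //; subst ry.
  have lt_col : (kx < ky)%N.
    rewrite ltn_neqAle le_col andbT; apply/eqP => /val_inj e; by apply: nxy; rewrite e.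
  have Hm : (kx.+1 < n)%N by apply: leq_ltn_trans lt_col _.
  have [||[_ /(congr1 val)/=]|[_ <-//]] := btw rx (Ordinal Hm); rewrite /= ?leqnn ?lt_col //; lia.
right; have [||[e _]|[_ e]] := btw ry kx; rewrite ?leqnn ?le_row ?le_col //.
  by rewrite e eqxx in nrow.
split=> //; have lt_row : (rx < ry)%N by rewrite ltn_neqAle le_row andbT.
have Hm : (rx.+1 < n)%N by apply: leq_ltn_trans lt_row _.
have [||[/(congr1 val)/= e1 _]|[<- _]] := btw (Ordinal Hm) kx; rewrite /= ?leqnn ?lt_row ?leqnSn //.
by move: e1; lia.
Qed.

Lemma std_zero t k : std la t -> k = 0%N :> nat ->
  (t k).1.2 = 0%N :> nat /\ (t k).2 = 0%N :> nat.
Proof.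
move=> st k0; pose z : node r n := ((t k).1.1, k, k).
have nw : weakly_nw z (t k) by rewrite /weakly_nw /= eqxx k0.
have [m mE] := std_onto st (diagram_nw nw (std_in _ st)).
have := std_nw st (k := m) (l := k); rewrite mE => /(_ nw); rewrite k0 leqn0 => /eqP m0.
have emk : m = k by apply: ord_inj; rewrite m0 k0.
by rewrite -emk mE /= k0.
Qed.

(** The nodes to the right of and below that of k lie strictly between those of k and l, and
    carry different entries. *)
Lemma std_same_diagonal t k l : std la t -> (t k).1.1 = (t l).1.1 ->
  ((t k).2 + (t l).1.2 = (t l).2 + (t k).1.2)%N -> (k < l)%N -> (k.+3 <= l)%N.
Proof.
move=> st ec ediag lt_kl.
have nle : ((t k).1.2 < (t l).1.2)%N.
  rewrite ltnNge; apply: contraL lt_kl => le; rewrite -leqNgt; apply: (std_nw st).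
  by rewrite /weakly_nw ec eqxx le /=; lia.
case E1 : (t k) (ec) (ediag) (nle) => [[c a] b] /= ec' ediag' nle'.
case E2 : (t l) ec' ediag' nle' => [[c' a'] b'] /= ec' ediag' nle'.
have Ha : (a.+1 < n)%N by have := ltn_ord a'; lia.
have Hb : (b.+1 < n)%N by have := ltn_ord b'; lia.
have in_l := std_in l st; rewrite E2 in in_l.
have [m mE] : exists m, t m = (c, Ordinal Ha, b).
  by apply: std_onto => //; apply: diagram_nw in_l; rewrite /weakly_nw /= -ec' eqxx /=; lia.
have [m' mE'] : exists m, t m = (c, a, Ordinal Hb).
  by apply: std_onto => //; apply: diagram_nw in_l; rewrite /weakly_nw /= -ec' eqxx /=; lia.
have lt_of u v : weakly_nw (t u) (t v) -> t u != t v -> (u < v)%N.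
  move=> nw ne; rewrite ltn_neqAle (std_nw st nw) andbT; apply: contra ne => /eqP/val_inj->.
  exact: eqxx.
have h1 : (k < m)%N.
  apply: lt_of; rewrite E1 mE; first by rewrite /weakly_nw /= eqxx leqnn leqnSn.
  by rewrite !xpair_eqE -(inj_eq val_inj a) /=; lia.
have h2 : (k < m')%N.
  apply: lt_of; rewrite E1 mE'; first by rewrite /weakly_nw /= eqxx leqnn leqnSn.
  by rewrite !xpair_eqE -(inj_eq val_inj b) /=; lia.
have h3 : (m < l)%N.
  apply: lt_of; rewrite E2 mE; first by rewrite /weakly_nw /= -ec' eqxx /=; lia.
  by rewrite !xpair_eqE -(inj_eq val_inj b) /=; lia.
have h4 : (m' < l)%N.
  apply: lt_of; rewrite E2 mE'; first by rewrite /weakly_nw /= -ec' eqxx /=; lia.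
  by rewrite !xpair_eqE -!(inj_eq val_inj a) /=; lia.
have h5 : m != m'.
  apply/eqP => e; move: mE; rewrite e mE' => -[/(congr1 val) /=]; lia.
have : m != m' :> nat by [].
lia.
Qed.
End Tableaux.

(** * The initial tableau *)

Section ReadingOrder.
Variables (r n : nat) (la : multipartition r n).
Implicit Types (x y z : node r n) (k l i j : 'I_n).

Definition reads_before x y :=
  (x.1.1 < y.1.1)%N || (x.1.1 == y.1.1) &&
  ((x.1.2 < y.1.2)%N || (x.1.2 == y.1.2) && (x.2 < y.2)%N).

Lemma pairwise_enum_ord m : pairwise (fun a b : 'I_m => (a < b)%N) (enum 'I_m).
Proof.
rewrite -(pairwise_map (val : 'I_m -> nat) ltn) val_enum_ord.
by rewrite -sorted_pairwise ?iota_ltn_sorted //; apply: ltn_trans.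
Qed.

Lemma pairwise_nodes : pairwise reads_before (nodes la).
Proof.
have lexP (S U : eqType) (RS : rel S) (RU : S -> rel U) (R : rel (S * U))
    (s : seq S) (t : S -> seq U) :
  pairwise RS s -> (forall a, pairwise (RU a) (t a)) ->
  (forall a a' b b', RS a a' -> R (a, b) (a', b')) ->
  (forall a b b', RU a b b' -> R (a, b) (a, b')) ->
  pairwise R [seq (a, b) | a <- s, b <- t a].
  move=> ps pt R1 R2; elim: s ps => [//|a s IH] /= /andP[Ra ps].
  rewrite pairwise_cat IH // pairwise_map andbT.
  have -> /= : pairwise (relpre (pair a) R) (t a).
    by apply: sub_pairwise (pt a) => b b' /R2.
  rewrite andbT; apply/allrelP => _ _ /mapP[b _ ->] /allpairsPdep[a' [b' [a's _ ->]]].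
  by apply: R1; apply: (allP Ra).
apply: (lexP _ _ (fun a b : 'I_r * 'I_n => (a.1 < b.1)%N || (a.1 == b.1) && (a.2 < b.2)%N)
  (fun _ (a b : 'I_n) => (a < b)%N)).
- apply: (lexP _ _ (fun a b : 'I_r => (a < b)%N) (fun _ (a b : 'I_n) => (a < b)%N)).
  + exact: pairwise_enum_ord.
  + by move=> _; exact: pairwise_enum_ord.
  + by move=> x x' y y' /= ->.
  + by move=> x y y' /= ->; rewrite eqxx orbT.
- move=> x; apply: (subseq_pairwise (take_subseq _ _)).
  exact: pairwise_enum_ord.
- move=> [c i] [c' i'] y y' /=; rewrite /reads_before /=.
  by case/orP=> [->//|/andP[-> ->]]; rewrite orbT.
- by move=> [c i] y y' lt; rewrite /reads_before /= !eqxx lt !orbT.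
Qed.

Lemma mem_nodes x : (x \in nodes la) = (x \in diagram la).
Proof.
case: x => [[c i] j]; rewrite inE /=; apply/allpairsPdep/idP => /=.
  case=> -[c' i'] [j' [_ + [-> -> ->]]] /=.
  by rewrite in_take ?mem_enum // index_enum_ord.
move=> lt_j; exists (c, i), j; split=> //.
  by apply/allpairsP; exists (c, i); rewrite !mem_enum.
by rewrite in_take ?mem_enum // index_enum_ord.
Qed.

Lemma initial_lt k l : (k < l)%N -> reads_before (initial_tableau la k) (initial_tableau la l).
Proof.
move=> lt_kl; rewrite !ffunE !(tnth_nth (initial_tableau la k)) /=.
have sz := eqP (size_nodes la).
by apply: (pairwiseP _ pairwise_nodes); rewrite ?inE ?sz.
Qed.

Lemma reads_before_irr x : ~~ reads_before x x.
Proof. by rewrite /reads_before !ltnn !eqxx. Qed.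

Lemma reads_before_asym x y : reads_before x y -> ~~ reads_before y x.
Proof. by rewrite /reads_before !ord_eqE; lia. Qed.

Lemma initial_inj : injective (initial_tableau la).
Proof.
move=> k l e; apply: val_inj; case: (ltngtP k l) => // /initial_lt;
by rewrite e (negbTE (reads_before_irr _)).
Qed.

(** The list that defines the initial tableau is increasing for the reading order. *)
Lemma initial_ltE k l :
  reads_before (initial_tableau la k) (initial_tableau la l) = (k < l)%N.
Proof.
apply/idP/idP => [|/initial_lt//]; apply: contraLR; rewrite -leqNgt leq_eqVlt.
case/orP=> [/eqP/val_inj->|/initial_lt]; first exact: reads_before_irr.
exact: reads_before_asym.
Qed.

Lemma initial_std : std la (initial_tableau la).
Proof.
apply: stdI; first exact: initial_inj.
  apply/setP => x; rewrite -mem_nodes; apply/imsetP/idP.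
    by case=> k _ ->; rewrite ffunE mem_tnth.
  move=> x_in; have lt_x : (index x (nodes la) < n)%N.
    by have := x_in; rewrite -index_mem (eqP (size_nodes la)).
  by exists (Ordinal lt_x) => //; rewrite ffunE (tnth_nth x) /= nth_index.
move=> k l nw; rewrite leqNgt; apply/negP => /initial_lt.
by case/and3P: nw => /eqP e1 le2 le3; rewrite /reads_before e1 !ord_eqE; lia.
Qed.
End ReadingOrder.

(** * The seminormal representation *)

Section Seminormal.
Variables (K : fieldType) (r p d n : nat) (eps q : K) (Q : d.-tuple K).

Definition node_res (x : node r n) : K :=
  q ^ (x.2%:Z - x.1.2%:Z) * cyc_param eps Q x.1.1.

Definition sn_diag (x y : node r n) : K :=
  (q - 1) * node_res y / (node_res y - node_res x).
(** The off-diagonal entry of the seminormal form. Only the product of [sn_swap x y] and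
    [sn_swap y x] is intrinsic; it is the factor by which gamma changes under a
    transposition. *)
Definition sn_swap (x y : node r n) : K :=
  (q * node_res x - node_res y) / (node_res x - node_res y).

(** Equal residues are tolerated along a diagonal, where the entries differ by at least 3:
    the denominators of the seminormal form and of the braid relation involve entries that
    differ by 1 or 2. *)
Definition separated (la : multipartition r n) :=
  forall x y, x \in diagram la -> y \in diagram la -> node_res x = node_res y ->
  x.1.1 = y.1.1 /\ (x.2 + y.1.2 = y.2 + x.1.2)%N.

Lemma std_res_neq (la : multipartition r n) t (k l : 'I_n) :
  separated la -> std la t -> (k < l <= k.+2)%N -> node_res (t k) != node_res (t l).
Proof.
move=> la_sep st /andP[lt_kl le_lk]; apply/eqP => /la_sep[||ec ediag]; try exact: std_in.
by have := std_same_diagonal st ec ediag lt_kl; lia.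
Qed.

Hypothesis hq0 : q != 0.

Lemma node_res_right (x y : node r n) : x.1.1 = y.1.1 -> x.1.2 = y.1.2 ->
  y.2 = x.2.+1 :> nat -> node_res y = q * node_res x.
Proof.
move=> e1 e2 e3; rewrite /node_res -e1 -e2 e3 [RHS]mulrA; congr (_ * _).
by rewrite -{2}(expr1z q) -expfzDr //; congr (q ^ _); lia.
Qed.

Lemma node_res_below (x y : node r n) : x.1.1 = y.1.1 -> x.2 = y.2 ->
  y.1.2 = x.1.2.+1 :> nat -> node_res x = q * node_res y.
Proof.
move=> e1 e2 e3; rewrite /node_res -e1 -e2 e3 [RHS]mulrA; congr (_ * _).
by rewrite -{2}(expr1z q) -expfzDr //; congr (q ^ _); lia.
Qed.

Lemma node_res_scale (x : node r n) m : (x.1.2 <= m)%N ->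
  q ^+ m * node_res x = q ^+ (m - x.1.2 + x.2) * cyc_param eps Q x.1.1.
Proof.
move=> le_m; rewrite /node_res mulrA; congr (_ * _).
by rewrite !exprnP -expfzDr //; congr (q ^ _); lia.
Qed.

Lemma sn_diag_right x y : q != 1 -> node_res x != 0 -> node_res y = q * node_res x ->
  sn_diag x y = q.
Proof.
move=> q1 x0 yE; have -> : sn_diag x y = (q - 1) * (q * node_res x) / ((q - 1) * node_res x).
  by rewrite /sn_diag yE; congr (_ / _); ring.
by field; rewrite x0 subr_eq0 q1.
Qed.

Hypothesis n_gt1 : (1 < n)%N.
Hypothesis d_gt0 : (0 < d)%N.
Hypothesis heps : p.-primitive_root eps.

Lemma cyc_param_expr s :
  cyc_param eps Q s ^+ p = tnth Q (Ordinal (ltn_pmod s d_gt0)) ^+ p.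
Proof.
rewrite /cyc_param exprMn exprAC (prim_expr_order heps) expr1n mul1r.
by rewrite (tnth_nth 0).
Qed.

Variable la : multipartition r n.
Hypothesis la_sep : separated la.

Definition sn_monomial := monomial q n_gt1 (@tab_act r n) (fun t k => t k) (std la)
  sn_diag sn_swap node_res (tnth Q (Ordinal d_gt0)).

(** The conditions on the coefficients are identities between rational functions of at most
    three residues; when t s_i is not standard, they hold because the residues of i - 1 and
    i have quotient q or its inverse. *)
Lemma ex_seminormal_rep (H : algType K) (T : nat -> H) :
  is_hecke_algebra p n q Q T ->
  exists2 E, @matrix_rep K (tableau r n) H E &
    forall i, (i < n)%N -> forall x y, E (T i) x y = sn_monomial i x y.
Proof.
move=> hH; have neq t (i : 'I_n) : (0 < i)%N -> std la t ->
    node_res (t (ord_pred i)) != node_res (t i).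
  by move=> i0 st; apply: std_res_neq la_sep st _; rewrite val_ord_pred //; lia.
apply: (ex_monomial_rep (P := std la)) (initial_tableau la) hH _.
- exact: tab_act1.
- exact: tab_actM.
- by move=> t w k; rewrite tab_actE.
- move=> t i i0 st a b; have ab : node_res a != node_res b := neq t i i0 st.
  by rewrite /sn_diag; field; rewrite !subr_eq0 ab eq_sym ab.
- move=> t i i0 st _ a b; have ab : node_res a != node_res b := neq t i i0 st.
  by rewrite /sn_diag /sn_swap; field; rewrite !subr_eq0 ab eq_sym ab.
- move=> t i i0 st ns a b; have ab : node_res a != node_res b := neq t i i0 st.
  have -> : (sn_diag a b - q) * (sn_diag a b + 1) =
      - ((q * node_res a - node_res b) * (node_res a - q * node_res b))
      / (node_res a - node_res b) ^+ 2.
    by rewrite /sn_diag; field; rewrite !subr_eq0 ab eq_sym ab.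
  have [ec [[e1 e2]|[e1 e2]]] := std_wall st i0 ns.
    by rewrite [node_res b](node_res_right ec e1 e2) subrr mul0r oppr0 mul0r.
  by rewrite [node_res a](node_res_below ec e1 e2) subrr mulr0 oppr0 mul0r.
- move=> t i j i0 eji st a b c; have pi := val_ord_pred i0.
  have ab : node_res a != node_res b := neq t i i0 st.
  have bc : node_res b != node_res c by apply: std_res_neq la_sep st _; lia.
  have ac : node_res a != node_res c by apply: std_res_neq la_sep st _; rewrite pi; lia.
  have ba := ab; have cb := bc; have ca := ac.
  rewrite eq_sym in ba; rewrite eq_sym in cb; rewrite eq_sym in ca.
  by rewrite /sn_diag; split; field; rewrite !subr_eq0 ?ab ?bc ?ac ?ba ?cb ?ca.
- by move=> i u t; apply: std_step.
- move=> t i i1 st _ a b; left.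
  have i0 : (0 < i)%N by rewrite i1.
  have ab : node_res a != node_res b := neq t i i0 st.
  by rewrite /sn_diag; field; rewrite !subr_eq0 ab eq_sym ab.
move=> t; rewrite /zero_coef; case: ifP => st; last by exists (Ordinal d_gt0).
have [e1 e2] := @std_zero _ _ la t (ord_zero n_gt1) st erefl.
rewrite /node_res e1 e2 subrr expr0z mul1r.
by rewrite cyc_param_expr; eexists.
Qed.
End Seminormal.

(** * Eigenvalues of the Jucys-Murphy elements *)

Section JucysMurphy.
Variables (K : fieldType) (r p d n : nat) (eps q : K) (Q : d.-tuple K).
Hypothesis n_gt1 : (1 < n)%N.
Hypothesis d_gt0 : (0 < d)%N.
Hypothesis heps : p.-primitive_root eps.
Hypothesis hq0 : q != 0.
Hypothesis hq1 : q != 1.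
Hypothesis hQ : forall c : 'I_d, tnth Q c != 0.

Lemma cyc_param_neq0 s : cyc_param eps Q s != 0.
Proof.
rewrite mulf_neq0 //; last first.
  by have := hQ (Ordinal (ltn_pmod s d_gt0)); rewrite (tnth_nth 0).
apply: expf_neq0; apply/eqP => e0; have := prim_expr_order heps.
rewrite e0 expr0n; have := prim_order_gt0 heps; case: (p) => //= m _ /eqP.
by rewrite eq_sym oner_eq0.
Qed.

Lemma node_res_neq0 (x : node r n) : node_res eps q Q x != 0.
Proof. by rewrite mulf_neq0 ?cyc_param_neq0 // expfz_neq0. Qed.

Variable la : multipartition r n.
Hypothesis la_sep : separated eps q Q la.
Variables (H : algType K) (T : nat -> H) (E : H -> tableau r n -> tableau r n -> K).
Hypothesis EP : matrix_rep E.
Hypothesis ET : forall i, (i < n)%N -> forall x y,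
  E (T i) x y = sn_monomial eps q Q n_gt1 d_gt0 la i x y.

Let rs : node r n -> K := node_res eps q Q.

Lemma apply_repT (i : 'I_n) v x : (0 < i)%N -> apply (E (T i)) v x =
  (if std la x then sn_diag eps q Q (x (ord_pred i)) (x i) else q) * v x +
  (if std la x && std la (tab_act x (srefl i))
   then sn_swap eps q Q (x (ord_pred i)) (x i) else 0) * v (tab_act x (srefl i)).
Proof.
move=> i0; rewrite -(@apply_monomial K n q n_gt1 _ _ (@tab_act r n) (fun t k => t k)
  (std la) _ _ rs (tnth Q (Ordinal d_gt0)) i v x i0).
by apply: eq_bigr => y _; rewrite ET.
Qed.

Lemma apply_repT0 v x : apply (E (T 0%N)) v x =
  (if std la x then rs (x (ord_zero n_gt1)) else tnth Q (Ordinal d_gt0)) * v x.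
Proof.
rewrite -(@apply_monomial0 K n q n_gt1 _ _ (@tab_act r n) (fun t k => t k)
  (std la) (sn_diag eps q Q) (sn_swap eps q Q) rs (tnth Q (Ordinal d_gt0)) v x).
by apply: eq_bigr => y _; rewrite ET // ltnW.
Qed.

(** Outside the standard tableaux T_0 is a constant and every T_i is q. *)
Definition JM_coef (m : 'I_n) x :=
  if std la x then rs (x m) else tnth Q (Ordinal d_gt0) * q ^+ m.

(** Induction on m: up to the factor q the next element is T L T with T = T_(m + 1), and T
    only mixes the values at x and x s_(m + 1). *)
Lemma apply_JM (m : 'I_n) v x : apply (E (JM q T m)) v x = JM_coef m x * v x.
Proof.
case: m => m Hm /=; elim: m Hm v x => [|m IH] Hm v x.
  rewrite /= apply_repT0 /JM_coef mulr1.
  by have -> : Ordinal Hm = ord_zero n_gt1 by apply: val_inj.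
have Hm' : (m < n)%N by exact: ltnW.
pose i := Ordinal Hm; have i0 : (0 < i)%N by [].
have pE : ord_pred i = Ordinal Hm' by apply: ord_pred_next.
rewrite /= (apply_repL EP) !(apply_repM EP).
rewrite (eq_apply _ (IH Hm' _)).
rewrite -[m.+1]/(i : nat) !apply_repT //.
rewrite (act_srefl2 (@tab_act1 r n) (@tab_actM r n)) /JM_coef !tab_act_srefl pE.
have -> : srefl i i = Ordinal Hm' by rewrite /srefl pE tpermR.
have -> : srefl i (Ordinal Hm') = i by rewrite /srefl pE tpermL.
(* The product of three matrices of size 2; P1 and P2 say which of the two tableaux are standard. *)
have mk_step (P1 P2 : bool) (ra rb c va vb : K) : ra != 0 -> rb != 0 ->
    (P1 -> ra != rb) ->
    (P1 -> ~~ P2 -> rb = q * ra \/ ra = q * rb) ->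
    q^-1 *
    ((if P1 then (q - 1) * rb / (rb - ra) else q) *
      ((if P1 then ra else c * q ^+ m) *
        ((if P1 then (q - 1) * rb / (rb - ra) else q) * va +
         (if P1 && P2 then (q * ra - rb) / (ra - rb) else 0) * vb)) +
     (if P1 && P2 then (q * ra - rb) / (ra - rb) else 0) *
      ((if P2 then rb else c * q ^+ m) *
        ((if P2 then (q - 1) * ra / (ra - rb) else q) * vb +
         (if P2 && P1 then (q * rb - ra) / (rb - ra) else 0) * va))) =
    (if P1 then rb else c * q ^+ m.+1) * va.
  move=> a0 b0; case: P1 => /=; last by move=> _ _; rewrite exprS; field.
  move=> /(_ isT) ab; have q1 : q - 1 != 0 by rewrite subr_eq0.
  case: P2 => /=; first by move=> _; field; rewrite hq0 !subr_eq0 ab eq_sym ab.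
  have q1' x' : q * x' - x' = (q - 1) * x' by rewrite mulrBl mul1r.
  have q1'' x' : x' - q * x' = - ((q - 1) * x') by rewrite mulrBl mul1r opprB.
  move=> /(_ isT isT) [->|->]; rewrite ?q1' ?q1'' ?invrN; field.
    by rewrite hq0 q1 a0.
  by rewrite hq0 q1 b0.
have W : std la x -> ~~ std la (tab_act x (srefl i)) ->
    rs (x i) = q * rs (x (Ordinal Hm')) \/ rs (x (Ordinal Hm')) = q * rs (x i).
  move=> st ns; have := std_wall st i0 ns; rewrite pE /= => -[ec [[e1 e2]|[e1 e2]]].
    by left; apply: node_res_right.
  by right; apply: node_res_below.
apply: mk_step (node_res_neq0 _) (node_res_neq0 _) _ W.
by move=> st; apply: (std_res_neq la_sep st) => /=; lia.
Qed.
End JucysMurphy.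

(** * Shapes with two rows *)

Section TwoRow.
Variables (r n : nat) (a b : 'I_r) (k : nat).
Hypothesis ab : a != b.
Hypothesis kn : (k < n)%N.

Definition two_row_rows : {ffun 'I_r -> {ffun 'I_n -> 'I_n.+1}} :=
  [ffun c => [ffun i : 'I_n => inord
     (if i == 0%N :> nat then
        if c == a then n - k else if c == b then k else 0 else 0)%N]].

Lemma two_rowE c (i : 'I_n) : two_row_rows c i =
  (if i == 0%N :> nat then
        if c == a then n - k else if c == b then k else 0 else 0)%N :> nat.
Proof.
rewrite !ffunE inordK //; case: ifP => _ //; case: ifP => _; first by lia.
by case: ifP => _ //; lia.
Qed.

Lemma two_rowP : is_multipartition two_row_rows.
Proof.
apply/andP; split.
  apply/forallP => c; apply/forallP => i; apply/forallP => j; apply/implyP.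
  by rewrite !two_rowE; case: (i : nat) => [|i'] ; case: (j : nat) => [|j'].
have Hn : (0 < n)%N by lia.
have sumc c : (\sum_i two_row_rows c i = if c == a then n - k else if c == b then k else 0)%N.
  rewrite (bigD1 (Ordinal Hn)) //= two_rowE /= big1 ?addn0 // => i ni.
  rewrite two_rowE; case: eqP => // i0; case/eqP: ni; exact: val_inj.
rewrite (eq_bigr _ (fun c _ => sumc c)) (bigD1 a) //= eqxx (bigD1 b) 1?eq_sym //=.
rewrite ?[b == a]eq_sym ?(negbTE ab) eqxx big1 ?addn0; first by apply/eqP; lia.
by move=> c /andP[/negbTE -> /negbTE ->].
Qed.

(** The shape that detects a relation cyc_a = q^k cyc_b: the residues of the row of length k
    in component b, starting from cyc_b, are continued by those of the row in component a. *)
Definition two_row : multipartition r n := Multipartition two_rowP.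

Lemma in_two_row (x : node r n) : (x \in diagram two_row) =
  (x.1.2 == 0%N :> nat) &&
  ((x.1.1 == a) && (x.2 < n - k)%N || (x.1.1 == b) && (x.2 < k)%N).
Proof.
rewrite inE two_rowE; case: eqP => //= _.
case: eqP => [->|_] /=; first by rewrite (negbTE ab) orbF.
by case: eqP.
Qed.

Hypothesis n_gt0 : (0 < n)%N.
Let z : 'I_n := Ordinal n_gt0.

Definition two_row_tab : tableau r n :=
  [ffun m : 'I_n => if (m < k)%N then (b, z, m)
    else (a, z, Ordinal (leq_ltn_trans (leq_subr k m) (ltn_ord m)))].

Lemma two_row_tab_std : std two_row two_row_tab.
Proof.
apply: stdI.
- move=> m l; rewrite !ffunE; case: ltnP => Hm; case: ltnP => Hl [].
  + by [].
  + by move=> e; have := ab; rewrite e eqxx.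
  + by move=> e; have := ab; rewrite e eqxx.
  by move=> e; apply: ord_inj; lia.
- apply/setP => x; rewrite in_two_row; apply/imsetP/idP.
    case=> m _ ->; rewrite ffunE; case: ltnP => Hm /=; rewrite !eqxx ?Hm ?orbT //=.
    by apply/orP; left; have := ltn_ord m; lia.
  case: x => [[c i] j] /= /andP[/eqP i0].
  have -> : i = z by apply: val_inj.
  case/orP=> /andP[/eqP -> Hj].
    have Hjk : (j + k < n)%N by lia.
    exists (Ordinal Hjk) => //; rewrite ffunE /= ltnNge leq_addl /=.
    by congr (_, _, _); apply: ord_inj => /=; lia.
  by exists j => //; rewrite ffunE Hj.
move=> m l; rewrite !ffunE /weakly_nw; case: ltnP => Hm; case: ltnP => Hl /=.
- by rewrite eqxx.
- by case/andP=> /eqP e; have := ab; rewrite e eqxx.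
- by case/andP=> /eqP e; have := ab; rewrite e eqxx.
- by rewrite eqxx /=; lia.
Qed.
End TwoRow.

Section CyclotomicParameters.
Variables (K : fieldType) (r p d n : nat) (eps q : K) (Q : d.-tuple K).
Hypothesis n_gt1 : (1 < n)%N.
Hypothesis d_gt0 : (0 < d)%N.
Hypothesis hq0 : q != 0.
Hypothesis hq1 : q != 1.
Variables (H : algType K) (T : nat -> H).
Hypothesis hH : is_hecke_algebra p n q Q T.
Hypothesis hss : semisimple H.

Let cyc := cyc_param eps Q.

Lemma q_expr_neq1 k : (0 < k <= n)%N -> q ^+ k != 1.
Proof.
move=> Hk; apply: (expr_neq1_of_poincare hq1 _ Hk).
exact: (semisimple_poincare_neq0 n_gt1 d_gt0 hH hss).
Qed.

Lemma q_expr_inj i j : (i <= n)%N -> (j <= n)%N -> q ^+ i = q ^+ j -> i = j.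
Proof.
wlog le_ij : i j / (i <= j)%N.
  by move=> WL Hi Hj e; case: (leqP i j) => [|/ltnW] le; [|apply/esym]; apply: WL.
move=> Hi Hj; have [m jE] : exists m, j = (m + i)%N by exists (j - i)%N; rewrite subnK.
rewrite {}jE in le_ij Hj *.
rewrite exprD -{1}[q ^+ i]mul1r => /(mulIf (expf_neq0 _ hq0))/esym/eqP e.
case: (posnP m) => [->|m0]; first by rewrite add0n.
have := q_expr_neq1 (k := m); rewrite e m0 => H0.
by have : false by apply: H0; lia.
Qed.

Hypothesis hr : r = (p * d)%N.
Hypothesis heps : p.-primitive_root eps.
Hypothesis hQ : forall c : 'I_d, tnth Q c != 0.

Lemma cyc_param_inj (a b : 'I_r) : cyc a = cyc b -> a = b.
Proof.
move=> e; have [emod|nmod] := eqVneq (a %% d)%N (b %% d)%N.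
  move: e; rewrite /cyc /cyc_param emod => /(mulIf _) e.
  have /e/eqP : Q`_(b %% d) != 0.
    by have := hQ (Ordinal (ltn_pmod b d_gt0)); rewrite (tnth_nth 0).
  rewrite (eq_prim_root_expr heps) -[(_ %/ _).+1]addn1 -[(b %/ d).+1]addn1 eqn_modDr.
  have lt_div (c : 'I_r) : (c %/ d < p)%N by rewrite ltn_divLR // -hr.
  rewrite !modn_small // => /eqP ediv; apply: ord_inj.
  by rewrite (divn_eq a d) (divn_eq b d) ediv emod.
have ne : Ordinal (ltn_pmod a d_gt0) != Ordinal (ltn_pmod b d_gt0).
  by rewrite ord_eqE.
have := semisimple_param_neq n_gt1 hH hss ne.
by rewrite -!(cyc_param_expr (eps := eps)) // -/cyc e eqxx.
Qed.

(** For k > 0 suppose cyc_a = q^k cyc_b, and take the two-row shape. In the tableau t1 that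
    fills component b first, the entry m has residue q^m cyc_b, so that every T_i with i > 0
    acts on the row t1 by q alone. A right eigenvector v as in [split_character] satisfies
    v(t1) = 1 and L_m v = q^m cyc_b v. It vanishes at t2 = t1 s_k, where the residues are
    different, and then T_k v = q v at t2 says that (q + 1) v(t1) = 0, against q^2 <> 1. *)
Lemma cyc_param_neq (a b : 'I_r) k : a != b -> (k < n)%N -> cyc a != q ^+ k * cyc b.
Proof.
move=> ab kn; case: (posnP k) => [->|k0].
  by rewrite mul1r; apply: contra ab => /eqP/cyc_param_inj->.
apply/eqP => cE; pose z := ord_zero n_gt1.
pose la := two_row ab kn; have c0 c : cyc c != 0 := cyc_param_neq0 d_gt0 heps hQ c.
have la_sep : separated eps q Q la.
  have cross (i j : nat) : (i < n - k)%N -> (j < k)%N -> q ^+ i * cyc a <> q ^+ j * cyc b.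
    move=> Hi Hj; rewrite cE mulrA -exprD => /(mulIf (c0 b))/q_expr_inj; lia.
  move=> x y; rewrite !in_two_row /node_res -!/(cyc _).
  case/andP=> /eqP -> Hx /andP[/eqP -> Hy]; rewrite !subr0 -!exprnP !addn0.
  case/orP: Hx => /andP[/eqP -> Hx]; case/orP: Hy => /andP[/eqP -> Hy].
  - by move=> /(mulIf (c0 a)) e; split=> //; apply: q_expr_inj e; lia.
  - by move=> e; case: (cross _ _ Hx Hy e).
  - by move/esym=> e; case: (cross _ _ Hy Hx e).
  - by move=> /(mulIf (c0 b)) e; split=> //; apply: q_expr_inj e; lia.
have [E EP ET] := ex_seminormal_rep hq0 n_gt1 d_gt0 heps la_sep hH.
pose t1 := two_row_tab a b k (ltnW n_gt1).
have st1 : std la t1 := two_row_tab_std ab kn (ltnW n_gt1).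
have res_t1 (m : 'I_n) : node_res eps q Q (t1 m) = q ^+ m * cyc b.
  rewrite /node_res ffunE; case: ltnP => Hm; rewrite /= subr0 -exprnP -/(cyc _) //.
  by rewrite cE mulrA -exprD subnK.
have Et1 i : (i < n)%N -> forall y, E (T i) t1 y = (if i is 0%N then cyc b else q) * (t1 == y)%:R.
  move=> lt_in y; rewrite ET // /sn_monomial; case: i lt_in => [|i] lt_in.
    by rewrite /= /zero_coef st1 res_t1 mul1r.
  pose o := Ordinal lt_in; have po := val_ord_pred (i := o) isT.
  have rE : node_res eps q Q (t1 o) = q * node_res eps q Q (t1 (ord_pred o)).
    by rewrite !res_t1 po mulrA -exprS.
  rewrite -[i.+1]/(o : nat) monomial_ord // /diag_coef /swap_coef st1.
  rewrite (sn_diag_right hq1 (node_res_neq0 d_gt0 heps hq0 hQ _) rE) /sn_swap rE.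
  by rewrite subrr mul0r if_same mul0r addr0.
have [||v [vsum vT]] := split_character n_gt1 hH hss EP (l := fun x => (x == t1)%:R)
  (chi := fun i => if i is 0%N then cyc b else q) (x0 := t1).
- by rewrite eqxx oner_neq0.
- move=> i lt_in y; rewrite (bigD1 t1) //= eqxx mul1r Et1 // big1 ?addr0; last first.
    by move=> x /negbTE->; rewrite mul0r.
  by rewrite eq_sym.
have v1 : v t1 = 1.
  rewrite -vsum (bigD1 t1) //= eqxx mul1r big1 ?addr0 // => x /negbTE->.
  by rewrite mul0r.
have vL (m : nat) : (m < n)%N -> apply (E (JM q T m)) v =1 (fun x => q ^+ m * cyc b * v x).
  elim: m => [|m IH] Hm x; first by rewrite mul1r; apply: vT; apply: ltnW.
  rewrite /= (apply_repL EP) !(apply_repM EP).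
  have e1 : apply (E (T m.+1)) v =1 (fun x => q * v x) by move=> y; apply: (vT _ Hm).
  have scale (f : tableau r n -> tableau r n -> K) c w y :
      apply f (fun x => c * w x) y = c * apply f w y.
    by rewrite /apply mulr_sumr; apply: eq_bigr => u _; rewrite mulrCA.
  rewrite (eq_apply _ (eq_apply _ e1)) (eq_apply _ (scale _ q v)) scale.
  rewrite (eq_apply _ (IH (ltnW Hm))) scale e1 exprS; field.
  by rewrite hq0.
pose o := Ordinal kn; have po := val_ord_pred (i := o) k0.
have t1c (m : 'I_n) : (t1 m).1.1 = if (m < k)%N then b else a.
  by rewrite ffunE; case: ifP.
pose t2 := tab_act t1 (srefl o).
have st2 : std la t2.
  apply/(std_act _ st1) => x y nw; have le_xy := std_nw st1 nw.
  have [->//|nxy] := eqVneq x y; apply: ltnW; rewrite srefl_lt //.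
  have lt_xy : (x < y)%N by rewrite ltn_neqAle le_xy andbT.
  rewrite lt_xy orbT andbT; apply/negP => /andP[/eqP ex /eqP ey].
  case/and3P: nw => /eqP + _ _; rewrite ex ey !t1c po /= prednK // leqnn ltnn.
  by move=> e; have := ab; rewrite e eqxx.
have t2p : t2 (ord_pred o) = t1 o by rewrite tab_act_srefl /srefl tpermL.
have t2o : t2 o = t1 (ord_pred o) by rewrite tab_act_srefl /srefl tpermR.
have q1 : q - 1 != 0 by rewrite subr_eq0.
have v2 : v t2 = 0.
  have := vL _ (ltn_ord (ord_pred o)) t2.
  rewrite (apply_JM heps hq0 hq1 hQ la_sep EP ET) /JM_coef st2 t2p res_t1 po /=.
  move: (cyc b) (c0 b) => c c_neq0 e.
  have /eqP : (q - 1) * (q ^+ k.-1 * c * v t2) = 0.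
    by rewrite mulrBl mul1r !mulrA -exprS prednK // e subrr.
  by rewrite !mulf_eq0 (negbTE q1) expf_eq0 (negbTE hq0) andbF (negbTE c_neq0) => /eqP.
have := vT _ kn t2; rewrite -[\sum_y _]/(apply (E (T (o : nat))) v t2).
rewrite (apply_repT ET) // st2 (act_srefl2 (@tab_act1 r n) (@tab_actM r n)) st1 v1 v2.
rewrite mulr0 add0r mulr1 t2p t2o /sn_swap !res_t1 po /=.
set x := q ^+ k.-1 * cyc b; have x0 : x != 0 by rewrite mulf_neq0 ?expf_neq0.
have -> : q ^+ k * cyc b = q * x by rewrite /x [RHS]mulrA -exprS prednK.
have -> : (q * (q * x) - x) / (q * x - x) = q + 1.
  have -> : q * x - x = (q - 1) * x by ring.
  by field; rewrite q1 x0.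
move=> /eqP; rewrite mulr0 addr_eq0 => /eqP qE; have := q_expr_neq1 (k := 2).
by rewrite n_gt1 qE sqrrN expr1n eqxx => /(_ isT).
Qed.
End CyclotomicParameters.

(** * Separation of nodes by residues *)

Section DiagramBounds.
Variables (r n : nat) (la : multipartition r n).

Lemma mp_size_sum : (\sum_c mp_size la c = n)%N.
Proof. by have /andP[_ /eqP] := mp_rowsP la. Qed.

(** The hook made of the first row up to the column of x and the first column down to the
    row of y lies in the component, and has x.2 + y.1.2 + 1 nodes. *)
Lemma arm_leg_bound (x y : node r n) : x \in diagram la -> y \in diagram la ->
  x.1.1 = y.1.1 -> (x.2 + y.1.2 < mp_size la x.1.1)%N.
Proof.
rewrite !inE => Hx Hy ec; rewrite -ec in Hy; set c := x.1.1 in Hx Hy *.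
have mono (i j : 'I_n) : (i <= j)%N -> (la c j <= la c i)%N.
  by have /andP[/forallP/(_ c)/forallP/(_ i)/forallP/(_ j)/implyP H _] := mp_rowsP la.
have n0 : (0 < n)%N by have := ltn_ord x.2; lia.
pose o := Ordinal n0.
have o_pos := leq_ltn_trans (leq0n _) (leq_trans Hx (mono o _ isT)).
apply: (@leq_trans (\sum_(i < n | (i < y.1.2.+1)%N)
    (1 + if i == o then (la c o).-1 else 0))%N).
  rewrite big_split /= -(big_ord_widen n (fun=> 1%N) (ltn_ord y.1.2)).
  rewrite sum_nat_const card_ord (bigD1 o) //=.
  by have := mono o x.1.2 isT; lia.
rewrite /mp_size [X in (_ <= X)%N](bigID (fun i : 'I_n => (i < y.1.2.+1)%N)) /=.
apply: leq_trans (leq_addr _ _); apply: leq_sum => i le_i.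
case: eqP => [->|_]; first by lia.
by have := mono _ _ le_i; lia.
Qed.
End DiagramBounds.

Section Separation.
Variables (K : fieldType) (r p d n : nat) (eps q : K) (Q : d.-tuple K).
Hypothesis hr : r = (p * d)%N.
Hypothesis n_gt1 : (1 < n)%N.
Hypothesis d_gt0 : (0 < d)%N.
Hypothesis heps : p.-primitive_root eps.
Hypothesis hq0 : q != 0.
Hypothesis hq1 : q != 1.
Hypothesis hQ : forall c : 'I_d, tnth Q c != 0.
Variables (H : algType K) (T : nat -> H).
Hypothesis hH : is_hecke_algebra p n q Q T.
Hypothesis hss : semisimple H.

Let cyc := cyc_param eps Q.

Lemma cyc_param_cross (a b : 'I_r) i j : a != b -> (i < n)%N -> (j < n)%N ->
  q ^+ i * cyc a != q ^+ j * cyc b.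
Proof.
wlog le_ij : a b i j / (i <= j)%N.
  move=> WL ab Hi Hj; case: (leqP i j) => [|/ltnW] le; first exact: WL.
  by rewrite eq_sym; apply: WL => //; rewrite eq_sym.
move=> ab Hi Hj; rewrite -(subnK le_ij) addnC exprD -mulrA.
rewrite (inj_eq (mulfI (expf_neq0 _ hq0))).
by apply: (cyc_param_neq n_gt1 d_gt0 hq0 hq1 hH hss hr heps hQ) => //; lia.
Qed.

(** Once negative powers of q are cleared, [arm_leg_bound] keeps the exponents below n,
    because the two components have at most n nodes together. The extra factors q leave room
    for the numerators of the seminormal form. *)
Lemma node_res_cross la (x y : node r n) i j :
  x \in diagram la -> y \in diagram la -> x.1.1 != y.1.1 ->
  (i <= 1)%N -> (j <= 1)%N -> q ^+ i * node_res eps q Q x != q ^+ j * node_res eps q Q y.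
Proof.
move=> Dx Dy xy Hi Hj.
have Bx := arm_leg_bound Dx Dx erefl; have By := arm_leg_bound Dy Dy erefl.
have sz : (mp_size la x.1.1 + mp_size la y.1.1 <= n)%N.
  have := mp_size_sum la; rewrite (bigD1 x.1.1) //= (bigD1 y.1.1) 1?eq_sym //=.
  by lia.
have q0 : q ^+ (x.1.2 + y.1.2) != 0 by apply: expf_neq0.
rewrite -(inj_eq (mulfI q0)) [X in X == _]mulrA [X in _ == X]mulrA -!exprD.
rewrite !node_res_scale //; try lia.
apply: cyc_param_cross => //; lia.
Qed.

Lemma node_res_cyc la (x : node r n) (s : 'I_r) : x \in diagram la -> x.1.1 != s ->
  node_res eps q Q x != cyc s.
Proof.
move=> Dx xs; have q0 : q ^+ x.1.2 != 0 by apply: expf_neq0.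
rewrite -(inj_eq (mulfI q0)) node_res_scale // subnn add0n.
by apply: cyc_param_cross.
Qed.

(** Within a component the contents fit in an interval of length less than n, on which the
    powers of q are distinct. *)
Lemma all_separated (la : multipartition r n) : separated eps q Q la.
Proof.
move=> x y Dx Dy e; have ec : x.1.1 = y.1.1.
  apply/eqP/negPn/negP => ne; have := node_res_cross (i := 0) (j := 0) Dx Dy ne isT isT.
  by rewrite !mul1r e eqxx.
split=> //; move: e; rewrite /node_res ec.
move/(mulIf (cyc_param_neq0 d_gt0 heps hQ _)) => e.
have B1 := arm_leg_bound Dx Dy ec; have B2 := arm_leg_bound Dy Dx (esym ec).
have sz c : (mp_size la c <= n)%N.
  by have := mp_size_sum la; rewrite (bigD1 c) //=; lia.
have szx := sz x.1.1; have szy := sz y.1.1.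
apply: (q_expr_inj n_gt1 d_gt0 hq0 hq1 hH hss).
- exact: leq_trans (ltnW B1) szx.
- exact: leq_trans (ltnW B2) szy.
have -> : q ^+ (x.2 + y.1.2) = q ^ (x.2%:Z - x.1.2%:Z) * q ^ (x.1.2 + y.1.2)%:Z.
  by rewrite exprnP -expfzDr //; congr (q ^ _); lia.
have -> : q ^+ (y.2 + x.1.2) = q ^ (y.2%:Z - y.1.2%:Z) * q ^ (x.1.2 + y.1.2)%:Z.
  by rewrite exprnP -expfzDr //; congr (q ^ _); lia.
by rewrite e.
Qed.

(** Induction on the entry k. Its nodes in t and u lie on a common diagonal; if they differ,
    the upper one is occupied in the other tableau by a smaller entry, which both tableaux
    place alike. *)
Lemma std_res_inj la (t u : tableau r n) : std la t -> std la u ->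
  (forall k, node_res eps q Q (t k) = node_res eps q Q (u k)) -> t = u.
Proof.
move=> st su e; apply/ffunP => k; have [m] := ubnP k.
elim: m k => // m IH k; rewrite ltnS => le_k.
wlog le_row : t u st su e IH / ((t k).1.2 <= (u k).1.2)%N.
  move=> WL; case: (leqP (t k).1.2 (u k).1.2) => [|/ltnW] le; first exact: WL.
  by apply/esym; apply: WL => // j Hj; rewrite IH.
have [ec ediag] := all_separated (std_in k st) (std_in k su) (e k).
have nw : weakly_nw (t k) (u k).
  rewrite /weakly_nw ec eqxx le_row /= -(leq_add2r (u k).1.2) ediag.
  by rewrite leq_add2l.
have [l lE] := std_onto su (std_in k st).
have := std_nw su (k := l) (l := k); rewrite lE => /(_ nw).
rewrite leq_eqVlt => /orP[/eqP/ord_inj elk|lt_lk]; first by rewrite -lE elk.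
have := IH l (leq_trans lt_lk le_k); rewrite lE => /(std_inj st) elk.
by rewrite elk ltnn in lt_lk.
Qed.
End Separation.

(** * The elements T_w *)

Section TableauPermutation.
Variables (r n : nat) (la : multipartition r n).

Lemma ex_tab_perm (t : tableau r n) : std la t ->
  exists w : 'S_n, tab_act (initial_tableau la) w = t.
Proof.
move=> st; have pos k : [exists l, t l == initial_tableau la k].
  have [l lE] := std_onto st (std_in k (initial_std la)).
  by apply/existsP; exists l; rewrite lE.
pose f k := xchoose (existsP (pos k)).
have fE k : t (f k) = initial_tableau la k by apply/eqP/(xchooseP (existsP (pos k))).
have finj : injective f.
  by move=> k l e; apply: (@initial_inj _ _ la); rewrite -!fE e.
exists (perm finj); apply/ffunP => k; rewrite tab_actE -fE -(permE finj).
by rewrite permKV.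
Qed.

Lemma tab_permP (t : tableau r n) : std la t ->
  tab_act (initial_tableau la) (tab_perm la t) = t.
Proof.
move=> st; rewrite /tab_perm; case: pickP => [w /eqP //|none].
by have [w wE] := ex_tab_perm st; have := none w; rewrite wE eqxx.
Qed.

Lemma tab_perm_initial : tab_perm la (initial_tableau la) = 1%g.
Proof.
apply: (tab_act_free (@initial_inj _ _ la)); apply: tab_permP.
exact: initial_std.
Qed.
End TableauPermutation.

Section StandardBasis.
Variables (K : fieldType) (p d n : nat) (q : K) (Q : d.-tuple K).
Variables (H : algType K) (T : nat -> H).
Hypothesis hrel : hecke_relations p n q Q T.

Let f (i : 'I_n) : H := T i.

Lemma Tperm_reduced u : reduced u -> Tperm T (word_perm u) = word_prod f u.
Proof.
move=> ru; case: hrel => _ _ _ rc rb; rewrite /Tperm.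
case: pickP => [v /andP[sv /eqP vE]|none].
  apply: matsumoto => //.
  - by move=> i j _ ij; apply: rc; rewrite ij ltn_ord.
  - by move=> i j i0 ji; rewrite /f ji; apply: rb; rewrite // -ji.
  by apply/andP; split=> //; rewrite /word_perm vE size_tuple.
have /andP[su /eqP lu] := ru.
have sz : size u == perm_length (word_perm u) by rewrite lu.
by have := none (Tuple sz); rewrite /= -/(simple_word u) su -/(word_perm u) eqxx.
Qed.

Lemma ex_Tperm w : exists2 u, reduced u & word_perm u = w /\ Tperm T w = word_prod f u.
Proof.
by have [u ru <-] := ex_reduced w; exists u => //; rewrite Tperm_reduced.
Qed.

Lemma Tperm_up (i : 'I_n) (w : 'S_n) : (0 < i)%N -> (w (ord_pred i) < w i)%N ->
  T i * Tperm T w = Tperm T (srefl i * w)%g.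
Proof.
move=> i0 wi; have [u ru [uE ->]] := ex_Tperm w.
have riu : reduced (i :: u) by apply: reduced_cons; rewrite ?uE.
by rewrite -uE -word_perm_cons Tperm_reduced // /word_prod big_cons.
Qed.

Lemma star_word (star : H -> H) u : is_anti_automorphism_fixing n T star ->
  star (word_prod f u) = word_prod f (rev u).
Proof.
case=> starL [starI starK starKI] starM starT.
have star1 : star 1 = 1.
  by rewrite -[star 1]mulr1 -[X in _ * X]starKI -starM mulr1 starKI.
elim: u => [|i u IH]; first by rewrite /word_prod !big_nil.
rewrite /word_prod rev_cons big_cons starM -/(word_prod f u) IH starT //.
by rewrite -cats1 big_cat big_seq1.
Qed.
End StandardBasis.

(** * Elements that act diagonally *)

Section DiagonalElements.
Variables (K : fieldType) (X : finType) (H : algType K) (E : H -> X -> X -> K).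
Hypothesis EP : matrix_rep E.

Definition acts_diagonally h (g : X -> K) := forall v x, apply (E h) v x = g x * v x.

Lemma apply_delta (f : X -> X -> K) x y : apply f (fun z => (z == y)%:R) x = f x y.
Proof.
rewrite /apply (bigD1 y) //= eqxx mulr1 big1 ?addr0 // => z /negbTE->.
by rewrite mulr0.
Qed.

Lemma acts_diagonally_entry h g x y : acts_diagonally h g -> E h x y = g x * (x == y)%:R.
Proof. by move=> hg; rewrite -apply_delta hg. Qed.

Lemma acts_diagonally_prod (I : eqType) (s : seq I) (P : pred I) h g :
  (forall i, i \in s -> P i -> acts_diagonally (h i) (g i)) ->
  acts_diagonally (\prod_(i <- s | P i) h i) (fun x => \prod_(i <- s | P i) g i x).
Proof.
elim: s => [|i s IH] hg v x; first by rewrite !big_nil (apply_rep1 EP) mul1r.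
have IHs : acts_diagonally (\prod_(i <- s | P i) h i) (fun x => \prod_(i <- s | P i) g i x).
  by apply: IH => j js; apply: hg; rewrite inE js orbT.
rewrite !big_cons; case: ifP => Pi; last exact: IHs.
by rewrite (apply_repM EP) hg ?inE ?eqxx // IHs mulrA.
Qed.

Lemma acts_diagonally_affine h g a c : acts_diagonally h g ->
  acts_diagonally (a *: (h - c%:A)) (fun x => a * (g x - c)).
Proof.
move=> hg v x; rewrite (apply_repL EP) -mulrA; congr (_ * _).
have -> : h - c%:A = (- c) *: 1 + h by rewrite addrC scaleNr.
rewrite /apply; case: (EP) => _ _ EL.
under eq_bigr => y _ do rewrite EL mulrDl.
rewrite big_split /= -/(apply _ _ _) hg.
rewrite (eq_bigr (fun y => - c * (E 1 x y * v y))) => [|y _]; last by rewrite mulrA.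
by rewrite -mulr_sumr -/(apply _ _ _) (apply_rep1 EP); ring.
Qed.
End DiagonalElements.

(** * Entries and components *)

Section Counting.
Variables (r n : nat) (la : multipartition r n).

Lemma big_tableau (R : Type) (idx : R) (op : Monoid.com_law idx) (t : tableau r n)
    (P : pred (node r n)) (F : node r n -> R) : std la t ->
  \big[op/idx]_(k | P (t k)) F (t k) = \big[op/idx]_(x in diagram la | P x) F x.
Proof.
move=> st; have /and4P[_ /eqP <- _ _] := st.
rewrite big_mkcond [RHS]big_mkcondr big_imset /=; last first.
  by move=> k l _ _; apply: (std_inj st).
by apply: eq_bigl => k.
Qed.

Lemma big_diagram (R : Type) (idx : R) (op : Monoid.com_law idx) (P : pred 'I_r)
    (F : node r n -> R) :
  \big[op/idx]_(x in diagram la | P x.1.1) F x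
  = \big[op/idx]_(c | P c) \big[op/idx]_(i < n) \big[op/idx]_(j < n | (j < la c i)%N) F (c, i, j).
Proof.
rewrite pair_big /= pair_big_dep /=.
by apply: eq_big => [[[c i] j]|[[c i] j] _]; rewrite // inE andbT andbC.
Qed.

Definition comp_start (s : nat) := (\sum_(c < r | c < s) mp_size la c)%N.

Lemma card_comp_lt s t : std la t ->
  #|[set k : 'I_n | ((t k).1.1 < s)%N]| = comp_start s.
Proof.
move=> st; rewrite -sum1_card; under eq_bigl => k do rewrite inE.
rewrite (big_tableau _ (fun x => (x.1.1 < s)%N) (fun=> 1%N) st).
rewrite (big_diagram _ (fun c : 'I_r => (c < s)%N)); apply: eq_bigr => c _.
apply: eq_bigr => i _; rewrite -(big_ord_widen n (fun=> 1%N)) ?sum_nat_const ?card_ord ?muln1 //.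
by rewrite -ltnS.
Qed.

Lemma comp_start_le s : (comp_start s <= n)%N.
Proof.
have := max_card (mem [set k : 'I_n | ((initial_tableau la k).1.1 < s)%N]).
by rewrite (card_comp_lt _ (initial_std la)) card_ord.
Qed.

Lemma initial_segment (A : {set 'I_n}) m : #|A| = m ->
  (forall k l : 'I_n, (k <= l)%N -> l \in A -> k \in A) ->
  forall k : 'I_n, (k \in A) = (k < m)%N.
Proof.
move=> cA down k; have lt_card (a : nat) : (a <= n)%N -> #|[set j : 'I_n | (j < a)%N]| = a.
  move=> le_a; rewrite -sum1_card; under eq_bigl => j do rewrite inE.
  by rewrite -(big_ord_widen n (fun=> 1%N)) // sum_nat_const card_ord muln1.
apply/idP/idP => [kA|].
  rewrite -cA -(lt_card k.+1) ?ltn_ord //; apply: subset_leq_card.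
  by apply/subsetP => j; rewrite inE ltnS => /down; apply.
apply: contraLR => nkA; rewrite -leqNgt -cA -(lt_card k); last exact: ltnW.
apply: subset_leq_card; apply/subsetP => j jA; rewrite inE ltnNge.
by apply: contra nkA => /down; apply.
Qed.

Lemma initial_comp_lt s k : ((initial_tableau la k).1.1 < s)%N = (k < comp_start s)%N.
Proof.
rewrite -(initial_segment (card_comp_lt s (initial_std la))) ?inE // => i j le_ij.
rewrite !inE; apply: leq_ltn_trans; move: le_ij; rewrite leq_eqVlt.
case/orP=> [/eqP/ord_inj->//|]; rewrite -(initial_ltE la) /reads_before ord_eqE.
by case/orP=> [/ltnW//|/andP[/eqP->]].
Qed.

(** An entry k < comp_start s cannot lie in a component c >= s, since k < comp_start c too.
    So the entries below comp_start s fit in the components before s, and by counting they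
    fill them. *)
Lemma comp_lt_of_avoid t : std la t ->
  (forall (s : 'I_r) (k : 'I_n), (k < comp_start s)%N -> (t k).1.1 != s) ->
  forall k, (t k).1.1 = (initial_tableau la k).1.1.
Proof.
move=> st avoid; have lt_s (s : nat) (k : 'I_n) : (k < comp_start s)%N -> ((t k).1.1 < s)%N.
  move=> Hk; rewrite ltnNge; apply/negP => le_s.
  have : (k < comp_start (t k).1.1)%N.
    apply: leq_trans Hk _; rewrite /comp_start big_mkcond [X in (_ <= X)%N]big_mkcond.
    by apply: leq_sum => c _; case: ifP => // /leq_trans ->.
  by move/avoid; rewrite eqxx.
have ltE (s : nat) (k : 'I_n) : ((t k).1.1 < s)%N = (k < comp_start s)%N.
  have sub : [set j : 'I_n | (j < comp_start s)%N] \subset [set j | ((t j).1.1 < s)%N].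
    by apply/subsetP => j; rewrite !inE; apply: lt_s.
  have cA : #|[set j : 'I_n | (j < comp_start s)%N]| = comp_start s.
    rewrite -[RHS](card_comp_lt s (initial_std la)); apply: eq_card => j.
    by rewrite !inE initial_comp_lt.
  have := subset_leqif_cards sub; rewrite cA (card_comp_lt s st) => -[_].
  by rewrite eqxx => /esym/eqP/setP/(_ k); rewrite !inE.
move=> k; apply/ord_inj/anti_leq; rewrite -[X in X && _]ltnS -[X in _ && X]ltnS.
by rewrite ltE -initial_comp_lt ltnSn initial_comp_lt -ltE ltnSn.
Qed.
End Counting.

Lemma nw_swap_not_std (r n : nat) (la : multipartition r n) t (i : 'I_n) :
  (0 < i)%N -> std la t -> weakly_nw (t (ord_pred i)) (t i) ->
  ~~ std la (tab_act t (srefl i)).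
Proof.
move=> i0 st nw; apply/negP => /(std_act _ st) /(_ _ _ nw).
by rewrite /srefl tpermL tpermR val_ord_pred //; lia.
Qed.

(** * Rows of the initial tableau and the row symmetrizer *)

Section InitialRows.
Variables (r n : nat) (la : multipartition r n).
Let t0 := initial_tableau la.

Lemma initial_row_convex : convex_levels (fun k => (t0 k).1).
Proof.
move=> x y z /andP[le_xy le_yz] exz.
have [<-//|nxy] := eqVneq x y; have [->|nyz] := eqVneq y z; first by rewrite exz.
have lt_xy : (x < y)%N by rewrite ltn_neqAle le_xy andbT.
have lt_yz : (y < z)%N by rewrite ltn_neqAle le_yz andbT.
move: lt_xy lt_yz; rewrite -!(initial_ltE la) -/t0 /reads_before exz !ord_eqE => H1 H2.
by apply/eqP; rewrite -pair_eqE /pair_eq /= !ord_eqE; lia.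
Qed.

Lemma initial_row_next (i : 'I_n) : (0 < i)%N -> (t0 (ord_pred i)).1 = (t0 i).1 ->
  ((t0 i).2 = (t0 (ord_pred i)).2.+1 :> nat) /\ ~~ std la (tab_act t0 (srefl i)).
Proof.
move=> i0 erow; have st := initial_std la.
have lt : ((t0 (ord_pred i)).2 < (t0 i).2)%N.
  have : (ord_pred i < i)%N by rewrite val_ord_pred //; lia.
  rewrite -(initial_ltE la) /reads_before -/t0 erow !ltnn !eqxx /=.
  done.
have ns : ~~ std la (tab_act t0 (srefl i)).
  by apply: nw_swap_not_std => //; rewrite /weakly_nw -/t0 erow eqxx leqnn ltnW.
split=> //; have [_ [[]//|[e _]]] := std_wall st i0 ns.
by move: lt; rewrite /t0 e ltnn.
Qed.

(** The node to the left carries a smaller entry of the same row, and the entries of a row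
    of the initial tableau are consecutive. *)
Lemma initial_row_prev (k : 'I_n) : (0 < (t0 k).2)%N ->
  (0 < k)%N /\ (t0 (ord_pred k)).1 = (t0 k).1.
Proof.
move=> j0; have st := initial_std la.
have Hj : ((t0 k).2.-1 < n)%N by have := ltn_ord (t0 k).2; lia.
pose y : node r n := ((t0 k).1, Ordinal Hj).
have Dy : y \in diagram la.
  apply: diagram_nw (std_in k st); rewrite /weakly_nw /= !eqxx leqnn /=.
  by rewrite -/t0; lia.
have [l lE] := std_onto st Dy.
have lt_lk : (l < k)%N.
  by rewrite -(initial_ltE la) lE /reads_before -/t0 /= !eqxx !ltnn /=; lia.
split; first by lia.
have k0 : (0 < k)%N by lia.
have e : (t0 l).1 = (t0 k).1 by rewrite /t0 lE.
rewrite -e; apply: initial_row_convex e.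
by rewrite val_ord_pred //; lia.
Qed.
End InitialRows.

Section RowSymmetrizer.
Variables (K : fieldType) (p d n : nat) (q : K) (Q : d.-tuple K).
Variables (H : algType K) (T : nat -> H).
Hypothesis hrel : hecke_relations p n q Q T.

Lemma hecke_square (i : 'I_n) : (0 < i)%N -> T i * T i = (q - 1) *: T i + q%:A.
Proof.
move=> i0; case: hrel => _ _ rq _ _.
have := rq i; rewrite i0 ltn_ord => /(_ isT) /eqP.
rewrite mulrDr mulr1 mulrBl mulr_algl -addrA addr_eq0 => /eqP ->.
by rewrite scalerBl scale1r opprD opprK opprB [RHS]addrAC addrA.
Qed.

(** The sum splits into pairs T_w + T_i T_w, each of which T_i multiplies by q. *)
Lemma mul_row_symmetrizer (L : eqType) (b : 'I_n -> L) (i : 'I_n) :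
  (0 < i)%N -> b (ord_pred i) = b i ->
  T i * (\sum_(w in young b) Tperm T w) = q *: \sum_(w in young b) Tperm T w.
Proof.
move=> i0 bi; pose up (w : 'S_n) := (w (ord_pred i) < w i)%N.
have split : \sum_(w in young b) Tperm T w
    = \sum_(w in young b | up w) (Tperm T w + T i * Tperm T w).
  rewrite (bigID up) big_split /=; congr (_ + _).
  rewrite (reindex_inj (mulgI (srefl i))) /=; apply: eq_big => [w|w].
    rewrite /up !permM /srefl tpermL tpermR -/(srefl i) -leqNgt.
    congr andb.
      apply/idP/idP => Hw; last by rewrite youngM ?young_srefl.
      by rewrite -(srefl_mulK i w) youngM ?young_srefl.
    by case/orP: (descent_or_ascent w i0); lia.
  rewrite /up !permM /srefl tpermL tpermR -/(srefl i) -leqNgt => /andP[_ le_w].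
  rewrite (Tperm_up hrel) //.
  by case/orP: (descent_or_ascent w i0) => //; lia.
rewrite split mulr_sumr scaler_sumr; apply: eq_bigr => w _.
rewrite mulrDr mulrA hecke_square // mulrDl -scalerAl mulr_algl scalerDr.
by rewrite scalerBl scale1r addrA [X in X + _]addrC subrK addrC.
Qed.
End RowSymmetrizer.

(** * Quotients of the numbers gamma *)

Section SeminormalForm.
Variables (K : fieldType) (r p d n : nat) (eps q : K) (Q : d.-tuple K).
Hypothesis hr : r = (p * d)%N.
Hypothesis n_gt1 : (1 < n)%N.
Hypothesis d_gt0 : (0 < d)%N.
Hypothesis heps : p.-primitive_root eps.
Hypothesis hq0 : q != 0.
Hypothesis hq1 : q != 1.
Hypothesis hQ : forall c : 'I_d, tnth Q c != 0.
Variables (H : algType K) (T : nat -> H).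
Hypothesis hH : is_hecke_algebra p n q Q T.
Hypothesis hss : semisimple H.
Variable la : multipartition r n.
Variable E : H -> tableau r n -> tableau r n -> K.
Hypothesis EP : matrix_rep E.
Hypothesis ET : forall i, (i < n)%N -> forall x y,
  E (T i) x y = sn_monomial eps q Q n_gt1 d_gt0 la i x y.

Let rs : node r n -> K := node_res eps q Q.
Let t0 := initial_tableau la.
Let la_sep : separated eps q Q la := all_separated hr n_gt1 d_gt0 heps hq0 hq1 hQ hH hss (la := la).

Lemma acts_JM (m : 'I_n) : acts_diagonally E (JM q T m) (JM_coef eps q Q d_gt0 la m).
Proof. by move=> v x; rewrite (apply_JM heps hq0 hq1 hQ la_sep EP ET). Qed.

Lemma JM_coef_std m x : std la x -> JM_coef eps q Q d_gt0 la m x = rs (x m).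
Proof. by rewrite /JM_coef => ->. Qed.

Definition F_coef (t x : tableau r n) : K := \prod_(k < n)
  \prod_(c <- residues r eps q Q k | c != res eps q Q t k)
    ((res eps q Q t k - c)^-1 * (JM_coef eps q Q d_gt0 la k x - c)).

Lemma acts_F t : acts_diagonally E (F_elt eps q Q T t) (F_coef t).
Proof.
apply: (acts_diagonally_prod EP) => k _ _; apply: (acts_diagonally_prod EP) => c _ _.
exact/(acts_diagonally_affine EP)/acts_JM.
Qed.

Lemma F_coef1 t : std la t -> F_coef t t = 1.
Proof.
move=> st; rewrite /F_coef big1 // => k _; rewrite big1 // => c nc.
by rewrite JM_coef_std // mulVf // subr_eq0 eq_sym.
Qed.

(** By [std_res_inj] some entry has different residues in x and t, and its residue in x is
    among the roots. *)
Lemma F_coef0 t x : std la t -> std la x -> x != t -> F_coef t x = 0.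
Proof.
move=> st sx nxt.
have [k nk] : exists k, rs (x k) != rs (t k).
  apply/existsP; apply: contraNT nxt => /existsPn same; apply/eqP.
  apply: (std_res_inj hr n_gt1 d_gt0 heps hq0 hq1 hQ hH hss sx st) => k.
  by apply/eqP/negPn/same.
apply/eqP; rewrite /F_coef (bigD1 k) //= mulf_eq0 prodf_seq_eq0.
apply/orP; left; apply/hasP; exists (rs (x k)).
  rewrite mem_undup; apply/mapP; exists x => //; rewrite mem_enum inE.
  by apply/existsP; exists la.
by rewrite nk /= JM_coef_std // subrr mulr0.
Qed.

(** The coefficient of T_i from a standard tableau to another point is 0, so that standard
    tableaux form a block of the matrices. *)
Lemma block_std h x y : std la x -> ~~ std la y -> E h x y = 0.
Proof.
move: x y; apply: (generated_by n_gt1 hH (P := fun h => forall x y, std la x -> ~~ std la y ->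
  E h x y = 0)) => {h}; case: EP => E1 EM EL.
- by move=> x y sx ny; rewrite E1; case: eqP => // e; rewrite e (negbTE ny) in sx.
- by move=> c g h Hg Hh x y sx ny; rewrite EL Hg // Hh // mulr0 addr0.
- move=> g h Hg Hh x y sx ny; rewrite EM big1 // => z _.
  have [sz|nz] := boolP (std la z); first by rewrite Hh // mulr0.
  by rewrite Hg // mul0r.
move=> i lt_in x y sx ny; rewrite ET //; case: i lt_in => [|i] lt_in.
  rewrite /sn_monomial /=; case: eqP => [e|_]; last by rewrite mulr0.
  by rewrite e (negbTE ny) in sx.
rewrite /sn_monomial -[i.+1]/(Ordinal lt_in : nat) monomial_ord // /swap_coef sx /=.
case: eqP => [e|_]; first by rewrite e (negbTE ny) in sx.
rewrite mulr0 add0r; case: eqP => [e|_]; last by rewrite mulr0.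
by rewrite e (negbTE ny) mul0r.
Qed.

Lemma q_add1_neq0 : q + 1 != 0.
Proof.
have := q_expr_neq1 n_gt1 d_gt0 hq1 hH hss (k := 2); rewrite n_gt1 => /(_ isT).
apply: contra => /eqP; move/eqP; rewrite addr_eq0 => /eqP ->.
by rewrite sqrrN expr1n.
Qed.

(** The product that defines m_elt runs over naturals; those that occur are less than n. *)
Definition JM_nat (k : nat) (x : tableau r n) : K :=
  if insub k is Some o then JM_coef eps q Q d_gt0 la o x else 0.

(** The eigenvalue at x of the product of the factors L_k - Q_s of m_elt. *)
Definition D_coef (x : tableau r n) : K := \prod_(s < r)
  \prod_(0 <= k < comp_start la s) (JM_nat k x - cyc_param eps Q s).

Lemma JM_natE (k : 'I_n) x : std la x -> JM_nat k x = rs (x k).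
Proof. by move=> sx; rewrite /JM_nat valK /JM_coef sx. Qed.

Lemma acts_D : acts_diagonally E
  (\prod_(s < r) \prod_(0 <= k < (\sum_(c < r | c < s) mp_size la c)%N)
      (JM q T k - (cyc_param eps Q s)%:A)) D_coef.
Proof.
apply: (acts_diagonally_prod EP) => s _ _; apply: (acts_diagonally_prod EP) => k.
rewrite mem_index_iota => /andP[_ Hk] _.
have Hkn : (k < n)%N := leq_trans Hk (comp_start_le la s).
rewrite -[_ - _]scale1r => v x.
rewrite (acts_diagonally_affine EP (g := JM_coef eps q Q d_gt0 la (Ordinal Hkn))).
  by rewrite mul1r /JM_nat insubT.
exact: (acts_JM (Ordinal Hkn)).
Qed.

(** If an entry k < comp_start s lies in component s, so does the entry l <= k of the first
    node of that component, whose residue is the parameter of s. *)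
Lemma D_coef_comp u : std la u -> D_coef u != 0 ->
  forall k, (u k).1.1 = (t0 k).1.1.
Proof.
move=> su Du; apply: (comp_lt_of_avoid su) => s k Hk; apply: contra Du => /eqP us.
have n0 : (0 < n)%N by exact: ltnW.
pose z : node r n := (s, Ordinal n0, Ordinal n0).
have nw : weakly_nw z (u k) by rewrite /weakly_nw /= us eqxx.
have [l lE] := std_onto su (diagram_nw nw (std_in k su)).
have le_lk : (l <= k)%N by apply: (std_nw su); rewrite lE.
rewrite /D_coef (bigD1 s) //= mulf_eq0 prodf_seq_eq0; apply/orP; left.
apply/hasP; exists (l : nat); first by rewrite mem_index_iota /= (leq_ltn_trans le_lk).
by rewrite /= JM_natE // lE /rs /node_res /= subrr expr0z mul1r subrr.
Qed.

Lemma D_coef_initial : D_coef t0 != 0.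
Proof.
apply/prodf_neq0 => s _; rewrite prodf_seq_neq0; apply/allP => k.
rewrite mem_index_iota => /andP[_ Hk] /=.
have Hkn : (k < n)%N := leq_trans Hk (comp_start_le la s).
have st := initial_std la; pose o := Ordinal Hkn.
rewrite subr_eq0 -[k]/(o : nat) JM_natE //.
apply: (node_res_cyc hr n_gt1 d_gt0 heps hq0 hq1 hQ hH hss (la := la)).
  exact: std_in.
have : (o < comp_start la s)%N by [].
by rewrite -(initial_comp_lt la) -/t0 ord_eqE; case: ltngtP.
Qed.

Definition row_adjacent (i : 'I_n) := (t0 (ord_pred i)).1 = (t0 i).1.

(** The diagonal coefficient of T_i differs from q, by the last condition. *)
Lemma apply_Tq v u (i : 'I_n) : (0 < i)%N -> std la u ->
  apply (E (T i)) v u = q * v u ->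
  (std la (tab_act u (srefl i)) -> v (tab_act u (srefl i)) = 0) ->
  q * rs (u (ord_pred i)) != rs (u i) -> v u = 0.
Proof.
move=> i0 su + vs nres; rewrite (apply_repT ET) // su /=.
have ab : rs (u (ord_pred i)) != rs (u i).
  by apply: (std_res_neq la_sep su); rewrite val_ord_pred //; lia.
set S := (if _ then sn_swap _ _ _ _ _ else _) * _.
have -> : S = 0 by rewrite /S; case: ifP vs => [_ ->|_ _] //; rewrite ?mulr0 ?mul0r.
rewrite addr0 => /eqP; rewrite -subr_eq0 -mulrBl mulf_eq0 => /orP[|/eqP//].
have -> : sn_diag eps q Q (u (ord_pred i)) (u i) - q
    = (q * rs (u (ord_pred i)) - rs (u i)) / (rs (u i) - rs (u (ord_pred i))).
  by rewrite /sn_diag -!/(rs _); field; rewrite subr_eq0 eq_sym.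
rewrite mulf_eq0 invr_eq0 !subr_eq0 [_ == rs (u (ord_pred i))]eq_sym.
by rewrite (negbTE ab) (negbTE nres).
Qed.

(** Here u agrees with the initial tableau up to i - 1 and starts a new row with i, although
    the initial tableau continues the old one. Induction on the column m of i - 1. The
    tableau u s_i, if standard, is of the same kind at i - 1, in column m - 1, so that v
    vanishes there and [apply_Tq] applies to u. *)
Lemma row_eigenvector_corner v :
  (forall i : 'I_n, (0 < i)%N -> row_adjacent i -> apply (E (T i)) v =1 (fun x => q * v x)) ->
  forall m (i : 'I_n) u, (0 < i)%N -> row_adjacent i -> std la u ->
  (forall l : 'I_n, (l < i)%N -> u l = t0 l) ->
  (u i).1.1 = (u (ord_pred i)).1.1 -> (u i).1.2 = (u (ord_pred i)).1.2.+1 :> nat ->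
  (u i).2 = 0%N :> nat -> (u (ord_pred i)).2 = m :> nat -> v u = 0.
Proof.
move=> vT; elim=> [|m IH] i u i0 adj su agree ec er e0 em; have pi := val_ord_pred i0.
  apply: (apply_Tq i0 su (vT _ i0 adj u)).
    have : ~~ std la (tab_act u (srefl i)).
      by apply: nw_swap_not_std => //; rewrite /weakly_nw ec eqxx er e0 em leqnSn.
    by move/negbTE->.
  have e2 : (u (ord_pred i)).2 = (u i).2 by apply: ord_inj; rewrite em e0.
  have -> : rs (u (ord_pred i)) = q * rs (u i).
    by apply: node_res_below => //; rewrite ec.
  rewrite mulrA -subr_eq0 -[X in _ - X]mul1r -mulrBl.
  apply: mulf_neq0; last exact: (node_res_neq0 d_gt0 heps hq0 hQ).
  have -> : q * q - 1 = (q + 1) * (q - 1) by ring.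
  by rewrite mulf_neq0 ?q_add1_neq0 // subr_eq0.
apply: (apply_Tq i0 su (vT _ i0 adj u)).
  move=> su'; set u' := tab_act u (srefl i) in su' *.
  have ep : u (ord_pred i) = t0 (ord_pred i) by apply: agree; rewrite pi; lia.
  have [p0 padj] : (0 < ord_pred i)%N /\ (t0 (ord_pred (ord_pred i))).1 = (t0 (ord_pred i)).1.
    by apply: initial_row_prev; rewrite -/t0 -ep em.
  have [next _] := initial_row_next p0 padj.
  have ppi := val_ord_pred p0.
  have epp : u (ord_pred (ord_pred i)) = t0 (ord_pred (ord_pred i)).
    by apply: agree; rewrite ppi pi; lia.
  have u'p : u' (ord_pred i) = u i by rewrite /u' tab_act_srefl /srefl tpermL.
  have u'l (l : 'I_n) : (l < ord_pred i)%N -> u' l = u l.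
    move=> Hl; rewrite /u' tab_act_srefl srefl_id // ?ord_eqE -?pi; first lia.
    by rewrite neq_ltn Hl.
  have u'pp : u' (ord_pred (ord_pred i)) = u (ord_pred (ord_pred i)).
    by apply: u'l; rewrite ppi; lia.
  apply: (IH (ord_pred i)) => //.
  - by move=> l Hl; rewrite u'l // agree //; rewrite pi in Hl; lia.
  - by rewrite u'p u'pp ec ep epp padj.
  - by rewrite u'p u'pp er ep epp padj.
  - by rewrite u'p.
  - by rewrite u'pp epp; move: em; rewrite ep /t0 next => -[].
have Di := std_in i su; have Dp := std_in (ord_pred i) su.
have B := arm_leg_bound Dp Di (esym ec).
have sz : (mp_size la (u (ord_pred i)).1.1 <= n)%N.
  by have := mp_size_sum la; rewrite (bigD1 (u (ord_pred i)).1.1) //=; lia.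
have q0 : q ^+ (u i).1.2 != 0 by apply: expf_neq0.
rewrite -(inj_eq (mulfI q0)) node_res_scale // mulrCA node_res_scale ?er //.
rewrite subnn add0n e0 mul1r mulrA -exprS subSnn em ec.
rewrite -subr_eq0 -[X in _ - X]mul1r -mulrBl mulf_neq0 ?(cyc_param_neq0 d_gt0 heps hQ) //.
rewrite subr_eq0; apply: (q_expr_neq1 n_gt1 d_gt0 hq1 hH hss).
move: B; rewrite em er => B; have := leq_trans B sz; lia.
Qed.

(** At the first entry where u departs from the initial tableau, u must start a new row
    while the initial tableau continues the old one; this is the case of
    [row_eigenvector_corner]. *)
Lemma row_eigenvector_support v :
  (forall i : 'I_n, (0 < i)%N -> row_adjacent i -> apply (E (T i)) v =1 (fun x => q * v x)) ->
  forall u, std la u -> (forall k, (u k).1.1 = (t0 k).1.1) -> u != t0 -> v u = 0.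
Proof.
have nw_step (a b x y : nat) : (b < a)%N ->
    (a.-1 < b)%N || (a.-1 == b) && (x < y)%N -> a = b.+1 /\ (x < y)%N by lia.
have pred_neq (a b : nat) : (b < a)%N -> a.-1 <> a by lia.
move=> vT u su ecomp nu; have st := initial_std la.
have [k0 nk0] : exists k, u k != t0 k.
  apply/existsP; apply: contraNT nu => /existsPn same.
  apply/eqP/ffunP => k; apply/eqP/negPn/same.
case: (arg_minnP (fun k : 'I_n => k : nat) (P := fun k => u k != t0 k) nk0) => k nk kmin.
have agree (l : 'I_n) : (l < k)%N -> u l = t0 l.
  by move=> lt_l; apply/eqP; apply: contraTT lt_l => /kmin; rewrite -leqNgt.
have before y : y \in diagram la -> weakly_nw y (u k) -> y != u k -> reads_before y (t0 k).
  move=> Dy nw ne; have [l lE] := std_onto su Dy.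
  have := std_nw su (k := l) (l := k); rewrite lE => /(_ nw).
  rewrite leq_eqVlt => /orP[/eqP/ord_inj elk|lt_lk]; first by rewrite -lE elk eqxx in ne.
  by rewrite -lE agree // /t0 initial_ltE.
have after : reads_before (t0 k) (u k).
  have [l lE] := std_onto st (std_in k su).
  rewrite -lE /t0 initial_ltE ltnNge leq_eqVlt; apply/negP => /orP[/eqP/ord_inj elk|lt_lk].
    by move: nk; rewrite -lE elk eqxx.
  have e := agree _ lt_lk; rewrite -/t0 in lE; rewrite lE in e.
  by have /(std_inj su) := e; move=> elk; rewrite elk ltnn in lt_lk.
have row_lt : ((t0 k).1.2 < (u k).1.2)%N.
  move: after; rewrite /reads_before ecomp ltnn eqxx /= => /orP[//|/andP[/eqP er lt_col]].
  have := before (t0 k) (std_in k st); rewrite (negbTE (reads_before_irr _)).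
  rewrite /weakly_nw ecomp eqxx er leqnn (ltnW lt_col) eq_sym nk /=.
  by move=> /(_ isT isT).
have Hrow : ((u k).1.2.-1 < n)%N by apply: leq_ltn_trans (leq_pred _) (ltn_ord _).
pose y : node r n := ((u k).1.1, Ordinal Hrow, (u k).2).
have nwy : weakly_nw y (u k) by rewrite /weakly_nw /= eqxx leqnn leq_pred.
have ney : y != u k.
  apply/eqP => /(congr1 (fun z : node r n => z.1.2 : nat)) /=; exact: pred_neq row_lt.
have := before y (diagram_nw nwy (std_in k su)) nwy ney.
rewrite /reads_before /= ecomp ltnn eqxx !ord_eqE /= => /(nw_step _ _ _ _ row_lt)[er lt_col].
have e0 : (u k).2 = 0%N :> nat.
  apply/eqP; rewrite -leqn0 leqNgt; apply/negP => col0.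
  have Hcol : ((u k).2.-1 < n)%N by apply: leq_ltn_trans (leq_pred _) (ltn_ord _).
  pose z : node r n := ((u k).1, Ordinal Hcol).
  have nwz : weakly_nw z (u k) by rewrite /weakly_nw /= eqxx leqnn leq_pred.
  have nez : z != u k.
    apply/eqP => /(congr1 (fun z : node r n => z.2 : nat)) /=; exact: pred_neq col0.
  have := before z (diagram_nw nwz (std_in k su)) nwz nez.
  by rewrite /reads_before /= ecomp ltnn eqxx !ord_eqE /= er ltnNge leqnSn eqn_leq ltnn.
have [k0' adj] : (0 < k)%N /\ row_adjacent k
  by apply: initial_row_prev; apply: leq_ltn_trans (leq0n _) lt_col.
have pk := val_ord_pred k0'; have ep : u (ord_pred k) = t0 (ord_pred k).
  by apply: agree; rewrite pk ltn_predL.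
apply: (row_eigenvector_corner vT k0' adj su agree _ _ e0 erefl).
  by rewrite ep ecomp adj.
by rewrite ep er adj.
Qed.

Let f (i : 'I_n) : H := T i.
Let N (x y : node r n) : K := sn_swap eps q Q x y * sn_swap eps q Q y x.

Lemma matrix_rep_sum (I : finType) (P : pred I) (g : I -> H) x y :
  E (\sum_(i | P i) g i) x y = \sum_(i | P i) E (g i) x y.
Proof.
elim/big_rec2: _ => [|i a b _ <-]; last by rewrite (matrix_repD EP).
by rewrite -(scale0r 0) (matrix_repL EP) mul0r.
Qed.

Lemma entry_mul g h x y : E (g * h) x y = apply (E g) (fun z => E h z y) x.
Proof. by case: EP => _ EM _; rewrite EM. Qed.

(** In the initial tableau i - 1 and i are neighbours in a row, where T_i acts by q alone. *)
Lemma row_word_entry u y : reduced u ->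
  all (fun i => (t0 (ord_pred i)).1 == (t0 i).1) u ->
  E (word_prod f u) t0 y = q ^+ size u * (t0 == y)%:R.
Proof.
elim: u => [|i u IH] ru /=.
  by case: EP => E1 _ _; rewrite /word_prod big_nil E1 mul1r.
have [i0 ru' _] := reduced_behead ru; case/andP=> /eqP adj /(IH ru') IHu.
have st := initial_std la; have [next ns] := initial_row_next i0 adj.
rewrite /word_prod big_cons entry_mul (apply_repT ET) // -/(word_prod f u) IHu.
have rE : rs (t0 i) = q * rs (t0 (ord_pred i)).
  by apply: node_res_right => //; rewrite adj.
rewrite st (negbTE ns) mul0r addr0.
rewrite (sn_diag_right hq1 (node_res_neq0 d_gt0 heps hq0 hQ _) rE).
by rewrite exprS mulrA.
Qed.

Let row_sum := \sum_(w in row_stab la) Tperm T w.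

Lemma row_stabE : row_stab la = young (fun k => (t0 k).1).
Proof. by []. Qed.

Lemma row_sum_entry_initial y : E row_sum t0 y = poincare q (row_stab la) * (t0 == y)%:R.
Proof.
rewrite /row_sum matrix_rep_sum /poincare mulr_suml; apply: eq_bigr => w wY.
have [u ru [uE ->]] := ex_Tperm hH.1 w.
rewrite row_word_entry //; first by case/andP: ru => _ /eqP <-; rewrite uE.
by apply: (reduced_young (@initial_row_convex _ _ la) ru); rewrite uE.
Qed.

Lemma row_sum_entry u y : std la u -> (forall k, (u k).1.1 = (t0 k).1.1) -> u != t0 ->
  E row_sum u y = 0.
Proof.
move=> su ecomp nu.
have vT (i : 'I_n) : (0 < i)%N -> row_adjacent i ->
    apply (E (T i)) (fun x => E row_sum x y) =1 (fun x => q * E row_sum x y).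
  move=> i0 adj x; rewrite -entry_mul /row_sum row_stabE (mul_row_symmetrizer hH.1 i0) //.
  by rewrite (matrix_repL EP).
exact: (row_eigenvector_support vT su ecomp nu).
Qed.

Let mu := D_coef t0 * poincare q (row_stab la).

Lemma mu_neq0 : mu != 0.
Proof.
rewrite mulf_neq0 //; first exact: D_coef_initial.
apply: poincare_young_neq0; last exact: initial_row_convex.
exact: (semisimple_poincare_neq0 n_gt1 d_gt0 hH hss).
Qed.

(** The first factor of m_elt kills the standard tableaux that do not fill the components in
    order; the symmetrizer kills the remaining ones except the initial tableau. *)
Lemma m_elt_entry u y : std la u ->
  E (m_elt eps q Q T la) u y = mu * (u == t0)%:R * (y == t0)%:R.
Proof.
move=> su; rewrite entry_mul acts_D -/row_sum.
have [->|nu] := eqVneq u t0.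
  by rewrite row_sum_entry_initial mulr1 [t0 == y]eq_sym mulrA.
rewrite mulr0 mul0r; have [->|Du] := eqVneq (D_coef u) 0.
  by rewrite mul0r.
by rewrite row_sum_entry ?mulr0 //; apply: (D_coef_comp su Du).
Qed.

Variable star : H -> H.
Hypothesis hstar : is_anti_automorphism_fixing n T star.

(** f_tt stripped of the factors F_t. *)
Definition core_elt t : H :=
  star (Tperm T (tab_perm la t)) * m_elt eps q Q T la * Tperm T (tab_perm la t).

Lemma f_elt_entry t z : std la t ->
  E (f_elt eps q Q T star la t t) t z = (t == z)%:R * E (core_elt t) t t.
Proof.
move=> st; have -> : f_elt eps q Q T star la t t =
    F_elt eps q Q T t * (core_elt t * F_elt eps q Q T t).
  by rewrite /f_elt /core_elt !mulrA.
have actF := acts_F t.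
rewrite entry_mul actF F_coef1 // mul1r entry_mul.
have -> : apply (E (core_elt t)) (fun x => E (F_elt eps q Q T t) x z) t
    = E (core_elt t) t z * F_coef t z.
  rewrite /apply (bigD1 z) //= (acts_diagonally_entry _ _ actF) eqxx mulr1.
  rewrite big1 ?addr0 // => x nx.
  by rewrite (acts_diagonally_entry _ _ actF) (negbTE nx) !mulr0.
have [<-|ntz] := eqVneq t z; first by rewrite F_coef1 // mulr1 mul1r.
rewrite mul0r; have [sz|nsz] := boolP (std la z); last first.
  by rewrite block_std ?mul0r.
by rewrite F_coef0 ?mulr0 // eq_sym.
Qed.

(** Among the rows of standard tableaux m_elt has the single nonzero entry mu, so that the
    entry is mu times one entry of a reduced word of d(t) and one of the reversed word. Both
    are products along the same path, which [path_coef_mul] pairs step by step. *)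
Lemma core_elt_entry t : std la t -> E (core_elt t) t t =
  mu * \prod_(c | inverted (tab_perm la t) c) N (t0 c.1) (t0 c.2).
Proof.
move=> st; have s0 := initial_std la.
have [u ru [uE TE]] := ex_Tperm hH.1 (tab_perm la t).
rewrite /core_elt TE (star_word _ hstar).
pose a (i : 'I_n) (x : tableau r n) :=
  if std la x then sn_diag eps q Q (x (ord_pred i)) (x i) else q.
pose b (i : 'I_n) (x : tableau r n) :=
  if std la x && std la (tab_act x (srefl i))
  then sn_swap eps q Q (x (ord_pred i)) (x i) else 0.
(* The reversed word runs along the path backwards, so that its coefficient at a step from x to
   x s_i is the one of x s_i. *)
pose b' i x := b i (tab_act x (srefl i)).
have free0 : free_point (@tab_act r n) t0.
  by move=> w; apply: tab_act_free; apply: initial_inj.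
have t0u : tab_act t0 (word_perm u) = t by rewrite uE; apply: tab_permP.
have e1 : E (word_prod f u) t0 t = path_coef (@tab_act r n) b u t0.
  rewrite -{1}t0u; apply: (path_reduced (@tab_act1 r n) (@tab_actM r n)
    (alpha := a) (G := fun u x y => E (word_prod f u) x y)) => //.
    by case: EP => E1 _ _ x y; rewrite /word_prod big_nil E1.
  by move=> i v x y i0; rewrite /word_prod big_cons entry_mul (apply_repT ET).
have e2 : E (word_prod f (rev u)) t t0 = path_coef (@tab_act r n) b' u t0.
  rewrite -{1}t0u; apply: (path_reduced (@tab_act1 r n) (@tab_actM r n)
    (alpha := a) (G := fun u x y => E (word_prod f (rev u)) y x)) => //.
    by case: EP => E1 _ _ x y; rewrite /word_prod /rev /= big_nil E1 eq_sym.
  move=> i v x y i0; rewrite rev_cons /word_prod -cats1 big_cat big_seq1 /=.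
  case: (EP) => _ EM _; rewrite EM -/(word_prod f (rev v)).
  have Tix z : E (f i) z x = a i x * (z == x)%:R + b' i x * (z == tab_act x (srefl i))%:R.
    rewrite -(apply_delta (E (f i))) (apply_repT ET) // -/(a i z) -/(b i z).
    have -> : (tab_act z (srefl i) == x) = (z == tab_act x (srefl i)).
      by apply/eqP/eqP => [<-|->]; rewrite (act_srefl2 (@tab_act1 r n) (@tab_actM r n)).
    congr (_ + _); first by case: eqP => [->//|_]; rewrite !mulr0.
    by case: eqP => [->//|_]; rewrite !mulr0.
  under eq_bigr => z _ do rewrite Tix mulrDr.
  rewrite big_split /=; congr (_ + _).
    rewrite [RHS]mulrC (bigD1 x) //= eqxx mulr1 big1 ?addr0 // => z /negbTE->.
    by rewrite !mulr0.
  rewrite [RHS]mulrC (bigD1 (tab_act x (srefl i))) //= eqxx mulr1 big1 ?addr0 //.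
  by move=> z /negbTE->; rewrite !mulr0.
have Ncoef : path_coef (@tab_act r n) b u t0 * path_coef (@tab_act r n) b' u t0
    = \prod_(c | inverted (tab_perm la t) c) N (t0 c.1) (t0 c.2).
  rewrite -uE; apply: (@path_coef_mul K n (tableau r n) (@tab_act r n) (node r n)
    (fun t k => t k) N (std la) b b' _ _ _ _ u t0 ru s0).
  - exact: tab_actM.
  - by move=> x w k; rewrite tab_actE.
  - move=> i x i0 sx sx'; rewrite /b' /b (act_srefl2 (@tab_act1 r n) (@tab_actM r n)).
    by rewrite sx sx' /= !tab_act_srefl /srefl tpermL tpermR.
  - by move=> i v x; apply: std_step.
  by rewrite t0u.
rewrite -Ncoef -e1 -e2; case: (EP) => _ EM _.
rewrite EM (bigD1 t0) //= [X in _ + X]big1 ?addr0; last first.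
  move=> y ny; rewrite EM big1 ?mul0r // => x _.
  have [sx|nsx] := boolP (std la x); last by rewrite block_std ?mul0r.
  by rewrite m_elt_entry // (negbTE ny) !mulr0.
rewrite EM (bigD1 t0) //= [X in _ + X]big1 ?addr0; last first.
  move=> x nx.
  have [sx|nsx] := boolP (std la x); last by rewrite block_std ?mul0r.
  by rewrite m_elt_entry // (negbTE nx) mulr0 mul0r mulr0.
rewrite m_elt_entry // !eqxx !mulr1 -/f [E (word_prod f _) t t0 * _]mulrC -mulrA.
by congr (_ * _); rewrite mulrC.
Qed.

Variable gam : tableau r n -> K.
Hypothesis hgam : is_gamma eps q Q T star gam.

(** Compare the entries (t, t) in f_tt f_tt = gamma_t f_tt. *)
Lemma gam_core t : std la t -> E (core_elt t) t t != 0 -> gam t = E (core_elt t) t t.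
Proof.
move=> st c0; have [_ gf] := hgam.
have := gf la la t t t t st st st st; rewrite eqxx => /(congr1 (fun h => E h t t)).
case: (EP) => _ EM _.
rewrite EM (matrix_repL EP) (bigD1 t) //= !f_elt_entry // eqxx !mul1r.
rewrite big1 ?addr0 => [|z nz]; last by rewrite f_elt_entry // eq_sym (negbTE nz) !mul0r.
by move=> /(mulIf c0).
Qed.

(** The number mu cancels; only mu <> 0 matters. *)
Lemma gam_ratio t : std la t ->
  \prod_(c | inverted (tab_perm la t) c) N (t0 c.1) (t0 c.2) != 0 ->
  gam t / gam t0 = \prod_(c | inverted (tab_perm la t) c) N (t0 c.1) (t0 c.2).
Proof.
move=> st N0; have s0 := initial_std la.
have c0 : E (core_elt t0) t0 t0 = mu.
  rewrite core_elt_entry // tab_perm_initial big1 ?mulr1 // => -[x y].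
  by rewrite invertedE !perm1; lia.
have g0 : gam t0 = mu by rewrite gam_core ?c0 // mu_neq0.
have gt : gam t = mu * \prod_(c | inverted (tab_perm la t) c) N (t0 c.1) (t0 c.2).
  by rewrite gam_core ?core_elt_entry // mulf_neq0 ?mu_neq0.
by rewrite gt g0 mulrC mulKf // mu_neq0.
Qed.
End SeminormalForm.

(** * The shift of the initial tableau by the period *)

Section Periodicity.
Variables (p d r n : nat) (la : multipartition r n).
Hypothesis hr : r = (p * d)%N.
Hypothesis p_gt0 : (0 < p)%N.
Hypothesis d_gt0 : (0 < d)%N.

Let o := o_lambda d la.
Let pl := p_lambda p d la.
Let B := (o * d)%N.

Lemma add_compA m l (c : 'I_r) : add_comp m (add_comp l c) = add_comp (l + m) c.
Proof. by apply: ord_inj; rewrite /= modnDml addnA. Qed.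

Lemma mp_shiftP k : reflect (forall c, la (add_comp (k * d) c) = la c) (mp_shift d k la == la).
Proof.
apply: (iffP eqP) => [e c|H]; last by apply/val_inj/ffunP => c; rewrite ffunE H.
by have := congr1 (fun m : multipartition r n => m c) e; rewrite /= ffunE.
Qed.

Lemma o_lambda_gt0 : (0 < o)%N.
Proof. by rewrite /o /o_lambda; case: ex_minnP => m /andP[]. Qed.

Lemma o_lambda_period c : la (add_comp B c) = la c.
Proof.
rewrite /B /o /o_lambda; case: ex_minnP => m /andP[_ /mp_shiftP H] _; exact: H.
Qed.

Lemma o_lambda_min k : (0 < k)%N -> mp_shift d k la == la -> (o <= k)%N.
Proof.
by move=> k0 Hk; rewrite /o /o_lambda; case: ex_minnP => m _; apply; rewrite k0.
Qed.

Lemma period_mul m c : la (add_comp (m * B) c) = la c.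
Proof.
elim: m c => [|m IH] c.
  by congr (mp_rows la _); apply: ord_inj; rewrite /= mul0n addn0 modn_small.
by rewrite mulSn addnC -add_compA o_lambda_period IH.
Qed.

(** Shifting by p brings every component back to its place, so that p modulo the smallest
    period is again a period. *)
Lemma o_lambda_dvd : (o %| p)%N.
Proof.
have per : mp_shift d (p %% o) la == la.
  apply/mp_shiftP => c; rewrite -(period_mul (p %/ o) (add_comp _ c)) add_compA.
  have -> : (p %% o * d + p %/ o * B = r)%N.
    by rewrite /B mulnA -mulnDl addnC -divn_eq hr.
  by congr (mp_rows la _); apply: ord_inj; rewrite /= modnDr modn_small.
have [k0|k0] := posnP (p %% o)%N; first by apply/eqP.
by have := o_lambda_min k0 per; rewrite leqNgt ltn_pmod // o_lambda_gt0.
Qed.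

Lemma p_lambdaE : (pl * o = p)%N.
Proof. exact/divnK/o_lambda_dvd. Qed.

Lemma r_blocks : r = (pl * B)%N.
Proof. by rewrite /B mulnA p_lambdaE hr. Qed.

Lemma pl_gt0 : (0 < pl)%N.
Proof. by have := p_gt0; rewrite -p_lambdaE muln_gt0 => /andP[]. Qed.

Lemma B_gt0 : (0 < B)%N.
Proof. by rewrite muln_gt0 o_lambda_gt0. Qed.

(** A bijection of the diagram, because o_lambda is a period of la. *)
Definition shift_node m (x : node r n) : node r n :=
  (add_comp (m * B) x.1.1, x.1.2, x.2).

Lemma shift_node_bij m : bijective (shift_node m).
Proof.
have [g gK Kg] := add_comp_bij r (m * B).
exists (fun x => (g x.1.1, x.1.2, x.2)) => -[[c i] j] /=; rewrite /shift_node /=.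
  by rewrite gK.
by rewrite Kg.
Qed.

Lemma in_shift_node m x : (shift_node m x \in diagram la) = (x \in diagram la).
Proof. by rewrite !inE /= period_mul. Qed.

Let t0 := initial_tableau la.
Let t := tab_shift d o t0.

Lemma shift_shifted k : shift_node 1 (t k) = t0 k.
Proof.
have tE : t k = (add_comp (r - (o * d) %% r) (t0 k).1.1, (t0 k).1.2, (t0 k).2).
  exact: ffunE.
rewrite /shift_node mul1n (tab_shift_comp d o t0 k) tE /=.
by case: (t0 k) => [[]].
Qed.

Lemma shifted_std : std la t.
Proof.
have st := initial_std la; apply: stdI.
- move=> k l e; apply: (std_inj st); rewrite -/t0 -!shift_shifted; congr (shift_node 1 _).
  exact: e.
- apply/setP => x; rewrite -(in_shift_node 1); apply/imsetP/idP.
    by case=> k _ ->; rewrite shift_shifted; apply: std_in.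
  move=> /(std_onto st)[k kE]; exists k => //.
  by apply: (bij_inj (shift_node_bij 1)); rewrite shift_shifted.
move=> k l nw; apply: (std_nw st); rewrite -/t0 -!shift_shifted.
by case/and3P: nw => /eqP e1 e2 e3; rewrite /weakly_nw /shift_node /= e1 eqxx e2 e3.
Qed.

Lemma shifted_perm k : t0 (tab_perm la t k) = shift_node 1 (t0 k).
Proof.
rewrite -shift_shifted; congr (shift_node 1 _).
by rewrite -{1}(tab_permP shifted_std) tab_actE permK.
Qed.

Let M := (pl.-1 * B)%N.

Lemma shift_compE (c : 'I_r) :
  add_comp (1 * B) c = (if (c < M)%N then c + B else c - M)%N :> nat.
Proof.
have Bpos := B_gt0; have rE : r = (M + B)%N.
  by rewrite {1}r_blocks /M -{1}(prednK pl_gt0) mulSn addnC.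
have lt_c := ltn_ord c; rewrite /= mul1n; case: ltnP => Hc.
  by rewrite modn_small //; lia.
have -> : (c + B = r + (c - M))%N by lia.
by rewrite modnDl modn_small //; lia.
Qed.

(** The permutation of the shifted tableau moves the last block of components in front of
    the others and keeps the order inside both groups. *)
Lemma inverted_shifted (a b : 'I_n) : inverted (tab_perm la t) (a, b) =
  ((t0 a).1.1 < M)%N && (M <= (t0 b).1.1)%N.
Proof.
have e1 (x : node r n) : (shift_node 1 x).1.1
    = (if (x.1.1 < M)%N then x.1.1 + B else x.1.1 - M)%N :> nat.
  exact: shift_compE.
have e2 x : (shift_node 1 x).1.2 = x.1.2 by [].
have e3 x : (shift_node 1 x).2 = x.2 by [].
have lt_r (x : node r n) : (x.1.1 < M + B)%N.
  apply: leq_trans (ltn_ord x.1.1) _; rewrite [X in (X <= _)%N]r_blocks /M.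
  by rewrite -{1}(prednK pl_gt0) mulSn addnC.
rewrite invertedE -!(initial_ltE la) -/t0 !shifted_perm /reads_before !ord_eqE.
rewrite !e1 !e2 !e3.
have := lt_r (t0 a); have := lt_r (t0 b).
move: (t0 a) (t0 b) => [[c i] j] [[c' i'] j'] /=.
by case: (ltnP c M); case: (ltnP c' M); lia.
Qed.

Lemma block_lt (c : 'I_r) : (c %/ B < pl)%N.
Proof. by rewrite ltn_divLR ?B_gt0 // -r_blocks. Qed.

Lemma block_shift m (c : 'I_r) : (m < pl)%N ->
  (add_comp (m * B) c %/ B == m)%N = (c < B)%N.
Proof.
move=> mpl; have -> : (add_comp (m * B) c = (c + m * B) %% (pl * B) :> nat)%N.
  by rewrite /= {2}r_blocks.
rewrite -modn_divl divnDMl ?B_gt0 //.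
have := block_lt c; set e := (c %/ B)%N => lt_e.
have -> : (c < B)%N = (e == 0)%N
  by rewrite -[RHS]leqn0 -[RHS]ltnS /e ltn_divLR ?B_gt0 // mul1n.
have [le_pl|lt_pl] := leqP pl (e + m).
  have -> : (e + m = pl + (e + m - pl))%N by lia.
  by rewrite modnDl modn_small; lia.
by rewrite modn_small //; lia.
Qed.

Lemma prod_block (R : comNzRingType) m (F : node r n -> R) : (m < pl)%N ->
  \prod_(x in diagram la | (x.1.1 %/ B == m)%N) F x
  = \prod_(x in diagram la | (x.1.1 < B)%N) F (shift_node m x).
Proof.
move=> mpl; rewrite (reindex (shift_node m)); last exact/onW_bij/shift_node_bij.
by apply: eq_bigl => x; rewrite in_shift_node block_shift.
Qed.

Lemma prod_first_blocks (R : comNzRingType) (F : node r n -> R) :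
  \prod_(x in diagram la | (x.1.1 < M)%N) F x
  = \prod_(m < pl.-1) \prod_(x in diagram la | (x.1.1 < B)%N) F (shift_node m x).
Proof.
pose blk (x : node r n) : 'I_pl := Ordinal (block_lt x.1.1).
rewrite (partition_big blk (fun m : 'I_pl => (m < pl.-1)%N)) /=; last first.
  by move=> x /andP[_ lt]; rewrite ltn_divLR ?B_gt0.
pose G m := \prod_(x in diagram la | (x.1.1 < B)%N) F (shift_node m x).
rewrite (big_ord_widen pl G) ?leq_pred //; apply: eq_bigr => m lt_m.
rewrite /G -prod_block ?ltn_ord //; apply: eq_bigl => x.
rewrite -andbA; congr (_ && _); rewrite ord_eqE /=.
case: eqP => [e|_]; rewrite ?andbF ?andbT //.
by rewrite /M -ltn_divLR ?B_gt0 // e.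
Qed.

Lemma prod_last_block (R : comNzRingType) (F : node r n -> R) :
  \prod_(x in diagram la | (M <= x.1.1)%N) F x
  = \prod_(x in diagram la | (x.1.1 < B)%N) F (shift_node pl.-1 x).
Proof.
have lt_pl : (pl.-1 < pl)%N by have := pl_gt0; lia.
rewrite -prod_block //; apply: eq_bigl => x; congr (_ && _).
have := block_lt x.1.1; rewrite eqn_leq /M -leq_divRL ?B_gt0 // => H.
by rewrite [X in _ = X && _](_ : _ = true) //; lia.
Qed.

Lemma prod_inverted_shifted (R : comNzRingType) (F : node r n -> node r n -> R) :
  \prod_(c | inverted (tab_perm la t) c) F (t0 c.1) (t0 c.2)
  = \prod_(m < pl.-1) \prod_(x in diagram la | (x.1.1 < B)%N)
      \prod_(y in diagram la | (y.1.1 < B)%N) F (shift_node m x) (shift_node pl.-1 y).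
Proof.
have st := initial_std la.
rewrite (eq_bigl (fun c : 'I_n * 'I_n =>
  ((t0 c.1).1.1 < M)%N && (M <= (t0 c.2).1.1)%N)); last first.
  by case=> a b; rewrite inverted_shifted.
rewrite -(pair_big (fun a => ((t0 a).1.1 < M)%N) (fun b => (M <= (t0 b).1.1)%N)
  (fun a b => F (t0 a) (t0 b))) /=.
rewrite (big_tableau _ (fun x => (x.1.1 < M)%N)
  (fun x => \prod_(b | (M <= (t0 b).1.1)%N) F x (t0 b)) st) prod_first_blocks.
apply: eq_bigr => m _; apply: eq_bigr => x _.
by rewrite (big_tableau _ (fun y => (M <= y.1.1)%N) (F (shift_node m x)) st) prod_last_block.
Qed.
End Periodicity.

(** * Symmetric products *)

Section SymmetricProducts.
Variable R : comNzRingType.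

Lemma prod_palindrome_odd (F : nat -> R) s :
  (forall k, (0 < k < s.*2.+1)%N -> F (s.*2.+1 - k)%N = F k) ->
  \prod_(1 <= k < s.*2.+1) F k = (\prod_(1 <= k < s.+1) F k) ^+ 2.
Proof.
move=> sym; have le1 : (1 <= s.+1)%N by [].
have le2 : (s.+1 <= s.*2.+1)%N by lia.
rewrite (big_cat_nat le1 le2) /= expr2; congr (_ * _).
rewrite -{1}[s.+1]add1n big_addn (_ : (s.*2.+1 - s = s.+1)%N); last by lia.
rewrite big_nat_rev /=; apply: eq_big_nat => k Hk.
have -> : (1 + s.+1 - k.+1 + s = s.*2.+1 - k)%N by lia.
by apply: sym; lia.
Qed.

Lemma prod_palindrome_even (F : nat -> R) s : (0 < s)%N ->
  (forall k, (0 < k < s.*2)%N -> F (s.*2 - k)%N = F k) ->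
  \prod_(1 <= k < s.*2) F k = (\prod_(1 <= k < s) F k) ^+ 2 * F s.
Proof.
move=> s0 sym; have le1 : (1 <= s)%N by [].
have le2 : (s <= s.*2)%N by lia.
have lt2 : (s < s.*2)%N by lia.
rewrite (big_cat_nat le1 le2) /= (big_ltn lt2).
have -> : \prod_(s.+1 <= k < s.*2) F k = \prod_(1 <= k < s) F k.
  rewrite -{1}[s.+1]add1n big_addn (_ : (s.*2 - s = s)%N); last by lia.
  rewrite big_nat_rev /=; apply: eq_big_nat => k Hk.
  have -> : (1 + s - k.+1 + s = s.*2 - k)%N by lia.
  by apply: sym; lia.
by ring.
Qed.

Lemma prod_symmetric_square n a (f : 'I_n -> 'I_n -> R) : (forall i j, f i j = f j i) ->
  \prod_(i < n | (i < a)%N) \prod_(j < n | (j < a)%N) f i j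
  = (\prod_(i < n | (i < a)%N) f i i) *
    (\prod_(i < n | (i < a)%N) \prod_(j < n | (j < i)%N) f i j) ^+ 2.
Proof.
move=> sym; rewrite expr2.
have -> : \prod_(i < n | (i < a)%N) \prod_(j < n | (j < a)%N) f i j =
    \prod_(i < n | (i < a)%N) (f i i * \prod_(j < n | (j < i)%N) f i j
                               * \prod_(j < n | (i < j < a)%N) f i j).
  apply: eq_bigr => i ia; rewrite (bigD1 i) //= -mulrA; congr (_ * _).
  rewrite (bigID (fun j : 'I_n => (j < i)%N)) /=; congr (_ * _);
    by apply: eq_bigl => j; rewrite ord_eqE; lia.
rewrite !big_split /= -mulrA; congr (_ * (_ * _)).
rewrite (exchange_big_dep (fun j : 'I_n => (j < a)%N)) /=; last by move=> i j; lia.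
by apply: eq_bigr => j ja; apply: eq_big => [i|i _]; [lia|rewrite sym].
Qed.
End SymmetricProducts.

(** * The quotient as a square *)

Section ShiftByPeriod.
Variables (K : fieldType) (r p d n : nat) (eps q : K) (Q : d.-tuple K).
Hypothesis hp : (0 < p)%N.
Hypothesis hd : (0 < d)%N.
Hypothesis hn : (1 < n)%N.
Hypothesis hr : r = (p * d)%N.
Hypothesis heps : p.-primitive_root eps.
Hypothesis hq0 : q != 0.
Hypothesis hq1 : q != 1.
Hypothesis hQ : forall c : 'I_d, tnth Q c != 0.
Variables (H : algType K) (T : nat -> H).
Hypothesis hH : is_hecke_algebra p n q Q T.
Hypothesis hss : semisimple H.
Variable la : multipartition r n.

Let o := o_lambda d la.
Let pl := p_lambda p d la.
Let B := (o * d)%N.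
Let t0 := initial_tableau la.
Let rho := res eps q Q t0.
Let a := h_bound d la.
Let rs : node r n -> K := node_res eps q Q.

(** The product of the two off-diagonal coefficients, as a function of the residues. *)
Definition swap_factor (X Y : K) : K := (q * X - Y) * (X - q * Y) / (X - Y) ^+ 2.

Lemma h_boundE : a = comp_start la B.
Proof.
rewrite /a /h_bound /comp_start; apply: eq_bigl => c.
by rewrite ltn_divLR.
Qed.

Lemma lt_h_bound (i : 'I_n) : (i < a)%N = ((t0 i).1.1 < B)%N.
Proof. by rewrite h_boundE initial_comp_lt. Qed.

Lemma eps_pow k : eps ^+ (pl * o * k) = 1.
Proof. by rewrite (p_lambdaE la hr) exprM (prim_expr_order heps) expr1n. Qed.

Lemma eps_neq0 : eps != 0.
Proof.
apply/eqP => e0; have := prim_expr_order heps.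
by rewrite e0 expr0n eqn0Ngt hp => /eqP; rewrite eq_sym oner_eq0.
Qed.

(** The parameter of component c + m o d is eps^(m o) times that of c. *)
Lemma node_res_shift m (x : node r n) : (m < pl)%N -> (x.1.1 < B)%N ->
  rs (shift_node d la m x) = eps ^+ (m * o) * rs x.
Proof.
move=> mpl xB; rewrite /rs /node_res /shift_node /=.
rewrite modn_small; last first.
  rewrite [X in (_ < X)%N](r_blocks la hr) -/pl -/o -/B.
  by apply: (@leq_trans (m.+1 * B)); rewrite ?leq_mul2r ?mpl ?orbT // mulSn; lia.
have -> : (x.1.1 + m * (o_lambda d la * d) = m * o * d + x.1.1)%N by rewrite addnC mulnA.
rewrite /cyc_param divnMDl // modnMDl -addnS exprD -[in LHS]mulrA.
by rewrite [LHS]mulrCA.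
Qed.

Lemma block_res_neq (i j : 'I_n) k e e' : (i < a)%N -> (j < a)%N -> (0 < k < pl)%N ->
  (e <= 1)%N -> (e' <= 1)%N ->
  q ^+ e * rho j != q ^+ e' * (eps ^+ (k * o) * rho i).
Proof.
rewrite !lt_h_bound => ia ja /andP[k0 kpl] He He'.
have st := initial_std la.
rewrite -[rho i]/(rs (t0 i)) -node_res_shift //.
apply: (node_res_cross hr hn hd heps hq0 hq1 hQ hH hss (la := la)) => //.
- exact: std_in.
- by rewrite (in_shift_node); apply: std_in.
apply/eqP => e1; have := block_shift hr hp hd (t0 i).1.1 kpl.
rewrite -/o -/B ia -[add_comp _ _]/((shift_node d la k (t0 i)).1.1) -e1.
by rewrite divn_small // eq_sym eqn0Ngt k0.
Qed.

(** The k-th factor of h, for all 0 < k < pl. *)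
Definition Phi (k : nat) : K := \prod_(i < n | (i < a)%N) \prod_(j < n | (j < a)%N)
  swap_factor (rho j) (eps ^+ (k * o) * rho i).

Lemma swap_factor_scale (c X Y : K) : c != 0 -> swap_factor (c * X) (c * Y) = swap_factor X Y.
Proof.
move=> c0; rewrite /swap_factor -!mulrBr ![q * (c * _)]mulrCA -!mulrBr.
rewrite mulrACA exprMn -expr2 invfM mulrACA divff ?mul1r //.
by rewrite expf_neq0.
Qed.

Lemma swap_factorC X Y : swap_factor X Y = swap_factor Y X.
Proof.
rewrite /swap_factor -[(Y - X) ^+ 2]sqrrN opprB; congr (_ / _).
by ring.
Qed.

Lemma sn_swap_factor (x y : node r n) : rs x != rs y ->
  sn_swap eps q Q x y * sn_swap eps q Q y x = swap_factor (rs x) (rs y).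
Proof.
move=> xy; rewrite /sn_swap /swap_factor -!/(rs _); field.
by rewrite !subr_eq0 xy eq_sym xy.
Qed.

(** Scaling by eps^(k o), whose product with eps^((pl - k) o) is 1, exchanges the two
    arguments of the factor. *)
Lemma Phi_sym k : (0 < k < pl)%N -> Phi (pl - k) = Phi k.
Proof.
move=> Hk; rewrite /Phi exchange_big /=; apply: eq_bigr => i _; apply: eq_bigr => j _.
have ek : eps ^+ (k * o) * eps ^+ ((pl - k) * o) = 1.
  have k_le : (k <= pl)%N by case/andP: Hk => _ /ltnW.
  by rewrite -exprD -mulnDl subnKC //; have := eps_pow 1; rewrite muln1.
have e0 : eps ^+ (k * o) != 0 by rewrite expf_neq0 ?eps_neq0.
rewrite -(swap_factor_scale _ _ e0) mulrA ek mul1r.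
by rewrite swap_factorC.
Qed.

Lemma prod_first_block (F : node r n -> K) :
  \prod_(x in diagram la | (x.1.1 < B)%N) F x = \prod_(i < n | (i < a)%N) F (t0 i).
Proof.
rewrite -(big_tableau _ (fun x => (x.1.1 < B)%N) F (initial_std la)).
by apply: eq_bigl => i; rewrite lt_h_bound.
Qed.

(** Block m meets the last block with residues scaled by eps^(m o) and eps^((pl - 1) o),
    which gives Phi (pl - 1 - m). *)
Lemma prod_swap_Phi :
  \prod_(c | inverted (tab_perm la (tab_shift d o t0)) c)
     (sn_swap eps q Q (t0 c.1) (t0 c.2) * sn_swap eps q Q (t0 c.2) (t0 c.1))
  = \prod_(1 <= k < pl) Phi k.
Proof.
rewrite (prod_inverted_shifted la hr hp hd
  (fun x y => sn_swap eps q Q x y * sn_swap eps q Q y x)) -/pl -/B -/o.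
have pl0 := pl_gt0 la hr hp; rewrite -/pl in pl0.
rewrite big_add1 big_nat_rev /= add0n big_mkord; apply: eq_bigr => m _.
have lt_m := ltn_ord m; rewrite prod_first_block /Phi [RHS]exchange_big /=.
apply: eq_bigr => i ia; rewrite prod_first_block; apply: eq_bigr => j ja.
have -> : (pl.-1 - m.+1).+1 = (pl.-1 - m)%N by lia.
have Bi : ((t0 i).1.1 < B)%N by rewrite -lt_h_bound.
have Bj : ((t0 j).1.1 < B)%N by rewrite -lt_h_bound.
have e0 : eps ^+ (m * o) != 0 by rewrite expf_neq0 ?eps_neq0.
have split : eps ^+ (pl.-1 * o) = eps ^+ (m * o) * eps ^+ ((pl.-1 - m) * o).
  by rewrite -exprD -mulnDl subnKC // ltnW.
rewrite sn_swap_factor !node_res_shift ?split //; try lia.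
  by rewrite -mulrA swap_factor_scale.
rewrite -mulrA (inj_eq (mulfI e0)).
have := block_res_neq (k := (pl.-1 - m)%N) (e := 0) (e' := 0) ja ia.
by rewrite !mul1r; apply=> //; lia.
Qed.

(** This power of eps is a square root of 1 other than 1, hence -1, and -1 <> 1. *)
Lemma eps_half_period : ~~ odd pl -> eps ^+ (pl./2 * o) = -1 /\ (2%:R : K) != 0.
Proof.
move=> ev; have plE : pl = (pl./2).*2 by rewrite -[LHS]odd_double_half (negbTE ev).
have pl0 := pl_gt0 la hr hp; rewrite -/pl in pl0.
have o0 := o_lambda_gt0 d la; rewrite -/o in o0.
have sq : (eps ^+ (pl./2 * o)) ^+ 2 = 1.
  by rewrite -exprM mulnAC muln2 -plE -[(pl * o)%N]muln1 eps_pow.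
have ne1 : eps ^+ (pl./2 * o) != 1.
  rewrite -(prim_order_dvd heps) -(p_lambdaE la hr) -/pl -/o.
  rewrite dvdn_pmul2r // gtnNdvd //; lia.
have e1 : eps ^+ (pl./2 * o) = -1.
  by apply/eqP; move/eqP: sq; rewrite sqrf_eq1 (negbTE ne1).
split=> //; apply: contra ne1 => /eqP two0.
by rewrite e1 -subr_eq0 -opprD -[1 + 1]/(2%:R) two0 oppr0.
Qed.

Lemma rho_neq0 i : rho i != 0.
Proof. exact: (node_res_neq0 hd heps hq0 hQ). Qed.

(** At k = pl / 2 the factor is symmetric in i and j, so that the factors off the diagonal
    come in pairs; those on the diagonal are ((q + 1) / 2)^2. *)
Lemma Phi_middle : ~~ odd pl ->
  Phi pl./2 = ((q + 1) ^+ a / 2%:R ^+ a) ^+ 2 *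
   (\prod_(i < n | (i < a)%N) \prod_(j < n | (j < i)%N)
     ((q * rho j + rho i) * (rho j + q * rho i) / (rho j + rho i) ^+ 2)) ^+ 2.
Proof.
move=> ev; have [e1 two0] := eps_half_period ev.
pose f (i j : 'I_n) := swap_factor (rho j) (- rho i).
have fE i j : f i j = (q * rho j + rho i) * (rho j + q * rho i) / (rho j + rho i) ^+ 2.
  by rewrite /f /swap_factor mulrN !opprK.
have fsym i j : f i j = f j i.
  by rewrite !fE [rho i + rho j]addrC; congr (_ / _); ring.
have -> : Phi pl./2 = \prod_(i < n | (i < a)%N) \prod_(j < n | (j < a)%N) f i j.
  by apply: eq_bigr => i _; apply: eq_bigr => j _; rewrite e1 mulN1r.
rewrite (prod_symmetric_square a fsym); congr (_ * _ ^+ 2); last first.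
  by apply: eq_bigr => i _; apply: eq_bigr => j _; rewrite fE.
have fii i : f i i = ((q + 1) / 2%:R) ^+ 2.
  rewrite fE; have -> : rho i + rho i = 2%:R * rho i by rewrite mulr2n; ring.
  field; by rewrite two0 rho_neq0.
rewrite (eq_bigr (fun=> ((q + 1) / 2%:R) ^+ 2)) => [|i _]; last exact: fii.
have le_a : (a <= n)%N by rewrite h_boundE comp_start_le.
rewrite -(big_ord_widen n (fun=> ((q + 1) / 2%:R) ^+ 2) le_a).
by rewrite prodr_const card_ord exprAC expr_div_n.
Qed.

Lemma factorE k : \prod_(i < n | (i < a)%N) \prod_(j < n | (j < a)%N)
    ((q * rho j - eps ^+ (k * o) * rho i)
     * (rho j - q * eps ^+ (k * o) * rho i)
     / (rho j - eps ^+ (k * o) * rho i) ^+ 2) = Phi k.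
Proof.
by apply: eq_bigr => i _; apply: eq_bigr => j _; rewrite /swap_factor [q * (_ * _)]mulrA.
Qed.

Lemma h_elt_square : h_elt p eps q Q la ^+ 2 = \prod_(1 <= k < pl) Phi k.
Proof.
have pl0 := pl_gt0 la hr hp; rewrite -/pl in pl0.
rewrite /h_elt -/o -/pl -/a -/t0 -/rho; case: ifP => od.
  under eq_bigr => k _ do rewrite factorE.
  have plE : pl = (pl./2).*2.+1 by rewrite -[LHS]odd_double_half od.
  rewrite [in RHS]plE prod_palindrome_odd; last first.
    by move=> k Hk; rewrite -plE; apply: Phi_sym; rewrite plE.
  by rewrite (_ : (pl - 1) %/ 2 = pl./2)%N //; lia.
under eq_bigr => k _ do rewrite factorE.
have ev : ~~ odd pl by rewrite od.
have plE : pl = (pl./2).*2 by rewrite -[LHS]odd_double_half od.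
have half_gt0 : (0 < pl./2)%N by lia.
rewrite [in RHS]plE (prod_palindrome_even half_gt0); last first.
  by move=> k Hk; rewrite -plE; apply: Phi_sym; rewrite plE.
rewrite Phi_middle // divn2 -[in LHS]mulrA exprMn; congr (_ * _); exact: exprMn.
Qed.

Lemma Phi_neq0 k : (0 < k < pl)%N -> Phi k != 0.
Proof.
move=> Hk; apply/prodf_neq0 => i ia; apply/prodf_neq0 => j ja.
have n1 : rho j - eps ^+ (k * o) * rho i != 0.
  by have := block_res_neq (e := 0) (e' := 0) ia ja Hk isT isT; rewrite expr0 !mul1r subr_eq0.
have n2 : rho j - q * (eps ^+ (k * o) * rho i) != 0.
  by have := block_res_neq (e := 0) (e' := 1) ia ja Hk isT isT; rewrite expr0 mul1r subr_eq0.
have n3 : q * rho j - eps ^+ (k * o) * rho i != 0.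
  by have := block_res_neq (e := 1) (e' := 0) ia ja Hk isT isT; rewrite expr0 mul1r subr_eq0.
by rewrite /swap_factor !mulf_neq0 // invr_eq0 expf_neq0.
Qed.

Lemma h_elt_neq0 : h_elt p eps q Q la != 0.
Proof.
have: h_elt p eps q Q la ^+ 2 != 0.
  rewrite h_elt_square prodf_seq_neq0; apply/allP => k; rewrite mem_index_iota => Hk.
  by rewrite Phi_neq0.
by rewrite expf_eq0.
Qed.

Lemma h_elt_well_defined : h_well_defined p eps q Q la.
Proof.
have pl0 := pl_gt0 la hr hp; rewrite -/pl in pl0.
rewrite /h_well_defined -/o -/pl -/a -/t0 -/rho.
have ok k (i j : 'I_n) : (0 < k < pl)%N -> (i < a)%N -> (j < a)%N ->
    (rho j - eps ^+ (k * o) * rho i) ^+ 2 != 0.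
  move=> Hk ia ja; rewrite expf_neq0 // subr_eq0.
  by have := @block_res_neq i j k 0 0 ia ja Hk isT isT; rewrite !mul1r.
case: ifP => od.
  by move=> k Hk i j ia ja; apply: ok => //; lia.
have ev : ~~ odd pl by rewrite od.
have plE : pl = (pl./2).*2 by rewrite -[LHS]odd_double_half od.
have [e1 two0] := eps_half_period ev; split.
- by move=> k Hk i j ia ja; apply: ok => //; lia.
- by rewrite expf_neq0.
move=> i j ia ji; have ja : (j < a)%N := ltn_trans ji ia.
by have := ok pl./2 i j _ ia ja; rewrite e1 mulN1r opprK; apply; lia.
Qed.

Lemma gam_shift_ratio (star : H -> H) (hstar : is_anti_automorphism_fixing n T star)
    (gam : tableau r n -> K) (hgam : is_gamma eps q Q T star gam) :
  gam (tab_shift d o t0) / gam t0 = h_elt p eps q Q la ^+ 2.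
Proof.
have la_sep : separated eps q Q la := all_separated hr hn hd heps hq0 hq1 hQ hH hss (la := la).
have [E EP ET] := ex_seminormal_rep hq0 hn hd heps la_sep hH.
rewrite (gam_ratio hr heps hq0 hq1 hQ hH hss EP ET hstar hgam).
- by rewrite prod_swap_Phi h_elt_square.
- exact: (shifted_std d la).
by rewrite prod_swap_Phi -h_elt_square expf_neq0 ?h_elt_neq0.
Qed.
End ShiftByPeriod.

Theorem theorem1p3 (K : fieldType) (r p d n : nat)
    (hp : (0 < p)%N) (hd : (0 < d)%N) (hn : (1 < n)%N) (hr : r = (p * d)%N)
    (eps q : K) (Q : d.-tuple K)
    (heps : p.-primitive_root eps) (hq0 : q != 0) (hq1 : q != 1)
    (hQ : forall c : 'I_d, tnth Q c != 0)
    (H : algType K) (T : nat -> H) (hH : is_hecke_algebra p n q Q T)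
    (hss : semisimple H)
    (star : H -> H) (hstar : is_anti_automorphism_fixing n T star)
    (gam : tableau r n -> K) (hgam : is_gamma eps q Q T star gam)
    (la : multipartition r n) :
  [/\ h_well_defined p eps q Q la,
      h_elt p eps q Q la != 0 &
      gam (tab_shift d (o_lambda d la) (initial_tableau la))
        / gam (initial_tableau la)
      = h_elt p eps q Q la ^+ 2].
Proof.
split.
- exact: (h_elt_well_defined hp hd hn hr heps hq0 hq1 hQ hH hss la).
- exact: (h_elt_neq0 hp hd hn hr heps hq0 hq1 hQ hH hss la).
exact: (gam_shift_ratio hp hd hn hr heps hq0 hq1 hQ hH hss la hstar hgam).
Qed.
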